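(* Let $\epsilon\in\{-1,0,1\}$ and let $M=M^\epsilon=G^\epsilon/K$ be the irreducible hermitian symmetric space associated with the complex hermitian Jordan triple $Z=T_oM$. Let $H$ be a connected complex Lie group with Lie algebra $\mathfrak h$, $f:K\to H$ a homomorphism, $Q=G^\epsilon\times_{K,f}H$, and $b:Z\to\mathfrak h$ an $f$-covariant $\mathbb C$-antilinear map. Then the invariant complexion $J$ on $Q$ generated by $b$ is integrable if and only if $[b\wedge b]=0$, i.e. $[b\,u,b\,v]=0$ for all $u,v\in Z$.
   Context: **Jordan triples and the spaces $M^\epsilon$.** A hermitian Jordan triple is a finite-dimensional complex vector space $Z$ with a product $(u,v,w)\mapsto\{uv^*w\}$, symmetric bilinear in $(u,w)$, conjugate-linear in $v$, such that with $(u\Box v^* )z:=\{uv^*z\}$ one has $[u\Box v^*,z\Box w^*]=\{uv^*z\}\Box w^*-z\Box\{wu^*v\}^*$. $Z$ is assumed positive and irreducible. Put $Q_zw=\{zw^*z\}$, $B_{z,w}=\mathrm{id}-2z\Box w^*+Q_zQ_w$, and $z^w=B_{z,w}^{-1}(z-Q_zw)$ when $B_{z,w}$ is invertible. $M^0=Z$; $M^-=M^{-1}$ is the connected component containing $0$ of $\{z\in Z:\det B_{z,z}\ne0\}$ (a bounded symmetric domain); $M^+=M^{1}=(Z\times Z)/\sim$ is the compact manifold of classes $[z,a]=[z^{b-a},b]$ whenever $B_{z,a-b}$ is invertible; $Z\subset M^+$ via $z\mapsto[z,0]$. The base point is $o=0$, $T_oM^\epsilon=Z$, and $j$ denotes the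 complex structure of $M^\epsilon$ ($j_o$ = multiplication by $\sqrt{-1}$). $K\subset GL(Z)$ is the identity component of the group of Jordan triple automorphisms; $G^\epsilon$ is the connected real Lie group generated by $K$ and the transvections $z\mapsto w+B_{w,-\epsilon w}^{1/2}z^{\epsilon w}$ ($w\in Z\cap M^\epsilon$); it acts transitively and holomorphically on $M^\epsilon$, and $K$ is the stabilizer of $o$. The Lie algebra is $\mathfrak g^\epsilon=\mathfrak k\oplus\mathfrak p^\epsilon$ ($\mathrm{Ad}_K$-invariant), where elements are identified with the vector fields they generate on $Z$, $\mathfrak k$ is the Lie algebra of $K$ (linear vector fields) and $\mathfrak p^\epsilon=\{v^\epsilon=(v+\epsilon\{zv^*z\})\frac{\partial}{\partial z}:v\in Z\}$. **Bundles.** With $G=G^\epsilon$ and a (real-analytic) homomorphism $f:K\to H$, $Q=G\times_{K,f}H$ is the set of classes $\langle g|h\rangle=\langle gk^{-1}|f(k)h\rangle$ ($k\in K$); it is a principal $H$-bundle over $M$ with projection $\pi\langle g|h\rangle=g(o)$ and actions $a\langle g|h\rangle b=\langle ag|hb\rangle$ of $a\in G$, $b\in H$. **Complexions.** Write $L_q^Q(b)=R_b^Q(q)=qb$, $L_a^Q(q)=aq$. A complexion on $Q$ is an almost complex structure $J$ on $Q$ with $(d_q\pi)J_q=j_{\pi(q)}(d_q\pi)$, $(d_qR_b^Q)J_q=J_{qb}(d_qR_b^Q)$, and $J_q(d_eL_q^Q)\beta=(d_eL_q^Q)(\sqrt{-1}\beta)$ for $\beta\in\mathfrak h$. It is invariant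 if $(d_qL_a^Q)J_q=J_{aq}(d_qL_a^Q)$ for all $a\in G$; it is integrable if its Nijenhuis tensor vanishes. A linear map $b:T_oM\to\mathfrak h$ is $f$-covariant if $\mathrm{Ad}_{f(k)}\circ b=b\circ(d_oL_k^M)$ for all $k\in K$, where $L_k^M(x)=k(x)$. The tautological complexion $J^0$ on $Q$ is the complexion that preserves the horizontal subspaces $\{\langle(d_eL^G_g)\tau|0_h\rangle:\tau\in\mathfrak p^\epsilon\}\subset T_{\langle g|h\rangle}Q$, where $L^G_g$ is left translation on $G$ and $\langle\dot g|\dot h\rangle$ denotes the image of $(\dot g,\dot h)\in T_gG\times T_hH$ under the differential of $G\times H\to Q$. The complexion generated by an $f$-covariant antilinear $b$ is $J_q=J^0_q+(d_eL_q^Q)\circ B^Q_q\circ d_q\pi$, where $B^Q_{\langle g|h\rangle}:T_{g(o)}M\to\mathfrak h$ is given by $B^Q_{\langle g|h\rangle}\circ(d_oL_g^M)=\mathrm{Ad}_{h^{-1}}\circ b$. *)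

(* Defs.v *)
(* Smoothness is handled through smooth parametrizations
   (plots): a space is a type with a family of plots from open subsets of R^n.
   For a manifold the plots are the smooth maps U -> X, and the plots of a
   product, of an open subset and of the quotient by a free proper Lie group
   action are those of the usual manifold structures. *)
From HB Require Import structures.
From mathcomp Require Import all_boot all_order all_algebra complex.
From mathcomp Require Import all_classical all_reals all_analysis.
Set Implicit Arguments.
Unset Strict Implicit.
Unset Printing Implicit Defensive.
Import passmx.
Import Order.TTheory GRing.Theory Num.Theory numFieldNormedType.Exports.
Local Open Scope classical_set_scope.
Local Open Scope ring_scope.
Local Open Scope complex_scope.

Section Smooth.
Variable R : realType.

Fixpoint Ck (k n : nat) (U : set 'rV[R]_n) (f : 'rV[R]_n -> R) : Prop :=
  if k is k'.+1 then
    (forall x, U x -> differentiable f x) /\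
    (forall v, Ck k' U (fun x => 'D_v f x))
  else forall x, U x -> {for x, continuous f}.

Definition Cinf (n : nat) (U : set 'rV[R]_n) (f : 'rV[R]_n -> R) : Prop :=
  forall k, Ck k U f.

Definition plots (X : Type) : Type :=
  forall n : nat, set 'rV[R]_n -> ('rV[R]_n -> X) -> Prop.

Definition rplots (E : vectType R) : plots E := fun n U p =>
  open U /\ forall l : {linear E -> R^o}, Cinf U (fun x => l (p x)).

Definition cplots (V : vectType R[i]) : plots V := fun n U p =>
  open U /\ forall l : {linear V -> R[i]^o}, Cinf U (fun x => complex.Re (l (p x))).

Definition prod_plots (X Y : Type) (P : plots X) (P' : plots Y) :
    plots (X * Y)%type := fun n U p =>
  P n U (fun x => (p x).1) /\ P' n U (fun x => (p x).2).

Section Space.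
Variables (X : Type) (P : plots X).

Definition smooth_fun (phi : X -> R) : Prop :=
  forall n U p, @P n U p -> Cinf U (fun x => phi (p x)).

Definition smooth_map_on (S : set X) (Y : Type) (P' : plots Y) (F : X -> Y) :
    Prop :=
  forall n U p, @P n U p -> (forall x, U x -> S (p x)) ->
    P' n U (fun x => F (p x)).

Definition smooth_map (Y : Type) (P' : plots Y) (F : X -> Y) : Prop :=
  smooth_map_on setT P' F.

Definition smooth_curve (c : R -> X) : Prop :=
  @P 1 setT (fun x => c (x 0 0)).

Definition Dopen (A : set X) : Prop :=
  forall n U p, @P n U p -> open (U `&` p @^-1` A).

Definition Dconnected (C : set X) : Prop :=
  forall A B, Dopen A -> Dopen B -> C `<=` A `|` B ->
    C `&` A !=set0 -> C `&` B !=set0 -> C `&` (A `&` B) !=set0.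

Definition component (S : set X) (x : X) : set X :=
  [set y | exists C, [/\ C `<=` S, Dconnected C, C x & C y]].

(* Tangent vectors are the functionals phi |-> (phi o c)'(0) on smooth
   functions; they are set to 0 at the other functions so that equality of
   tangent vectors is equality on smooth functions. *)
Definition velocity (c : R -> X) : (X -> R) -> R := fun phi =>
  if `[< smooth_fun phi >] then derive1 (fun t : R => phi (c t)) 0 else 0.

Definition tangent (x : X) : set ((X -> R) -> R) :=
  [set v | exists c, [/\ smooth_curve c, c 0 = x & v = velocity c]].

Definition vector_field (xi : X -> (X -> R) -> R) : Prop :=
  (forall x, tangent x (xi x)) /\
  (forall phi, smooth_fun phi -> smooth_fun (fun x => xi x phi)).

Definition field_bracket (xi eta : X -> (X -> R) -> R) : X -> (X -> R) -> R :=
  fun x phi => if `[< smooth_fun phi >] then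
    xi x (fun y => eta y phi) - eta x (fun y => xi y phi) else 0.

Definition almost_complex (J : X -> ((X -> R) -> R) -> ((X -> R) -> R)) :
    Prop :=
  [/\ forall x v, tangent x v -> tangent x (J x v),
      forall x v w (a : R), tangent x v -> tangent x w ->
        J x (a *: v + w) = a *: J x v + J x w,
      forall x v, tangent x v -> J x (J x v) = - v
    & forall xi, vector_field xi -> vector_field (fun x => J x (xi x))].

Definition nijenhuis (J : X -> ((X -> R) -> R) -> ((X -> R) -> R))
    (xi eta : X -> (X -> R) -> R) : X -> (X -> R) -> R := fun x =>
  let Jf zeta := fun y => J y (zeta y) in
  field_bracket (Jf xi) (Jf eta) x - J x (field_bracket (Jf xi) eta x)
  - J x (field_bracket xi (Jf eta) x) - field_bracket xi eta x.

Definition integrable_acs (J : X -> ((X -> R) -> R) -> ((X -> R) -> R)) : Prop :=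
  forall xi eta, vector_field xi -> vector_field eta ->
    forall x, nijenhuis J xi eta x = 0.

End Space.

Definition differential (X Y : Type) (P' : plots Y) (F : X -> Y)
    (v : (X -> R) -> R) : (Y -> R) -> R := fun phi =>
  if `[< smooth_fun P' phi >] then v (fun x => phi (F x)) else 0.

(* A chart is given by its inverse psi, used on the domain W. *)
Definition chart (V X : Type) : Type := (set V * (V -> X))%type.

Definition aplots (V X : Type) (PV : plots V) (A : set (chart V X)) : plots X :=
  fun n U p => open U /\ forall x, U x ->
    exists c W s, [/\ A c, open W, W x, PV n W s &
      forall y, W y -> c.1 (s y) /\ p y = c.2 (s y)].

Definition overlap (V X : Type) (c c' : chart V X) : set V :=
  [set z | c.1 z /\ exists2 z', c'.1 z' & c'.2 z' = c.2 z].

Definition transition (V X : Type) (c c' : chart V X) (s : V -> V) : Prop :=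
  forall z, overlap c c' z -> c'.1 (s z) /\ c'.2 (s z) = c.2 z.

(* Second countability is expressed by a countable cover by chart domains. *)
Definition is_manifold (V X : Type) (PV : plots V) (A : set (chart V X)) :
    Prop :=
  [/\ exists e : nat -> chart V X, (forall i, A (e i)) /\
        forall x, exists i, exists2 z, (e i).1 z & (e i).2 z = x,
      forall x y, x <> y -> exists B C, [/\ Dopen (aplots PV A) B,
        Dopen (aplots PV A) C, B x, C y & B `&` C = set0],
      forall c, A c -> Dopen PV c.1 /\
        forall z z', c.1 z -> c.1 z' -> c.2 z = c.2 z' -> z = z'
    & forall c c', A c -> A c' -> Dopen PV (overlap c c') /\
        forall s, transition c c' s -> smooth_map_on PV (overlap c c') PV s].

Definition complex_differentiable (V W : vectType R[i]) (s : V -> W) (z : V) :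
    Prop :=
  exists L : 'Hom(V, W), forall (u : V) (l : {linear W -> R[i]^o}),
    is_derive (0 : R) (1 : R) (fun t : R => complex.Re (l (s (z + t%:C *: u))))
      (complex.Re (l (L u))).

Definition is_complex_manifold (V : vectType R[i]) (X : Type)
    (A : set (chart V X)) : Prop :=
  is_manifold (@cplots V) A /\
  forall c c' s, A c -> A c' -> transition c c' s ->
    forall z, overlap c c' z -> complex_differentiable s z.

Section ComplexAtlas.
Variables (V : vectType R[i]) (X : Type) (A : set (chart V X)).

Definition caplots : plots X := aplots (@cplots V) A.

Definition chart_vector (psi : V -> X) (z u : V) : (X -> R) -> R :=
  velocity caplots (fun t : R => psi (z + t%:C *: u)).

(* w = j_x v *)
Definition jrel (x : X) (v w : (X -> R) -> R) : Prop :=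
  exists c z u, [/\ A c, c.1 z, c.2 z = x,
    v = chart_vector c.2 z u & w = chart_vector c.2 z ('i%C *: u)].
End ComplexAtlas.

Definition holomorphic_map (V W : vectType R[i]) (X Y : Type)
    (A : set (chart V X)) (B : set (chart W Y)) (F : X -> Y) : Prop :=
  smooth_map (caplots A) (caplots B) F /\
  forall x v w, jrel A x v w ->
    jrel B (F x) (differential (caplots B) F v) (differential (caplots B) F w).

Definition prod_atlas (V W X Y : Type) (A : set (chart V X))
    (B : set (chart W Y)) : set (chart (V * W) (X * Y)) :=
  [set c | exists a b, [/\ A a, B b &
    c = (a.1 `*` b.1, fun z => (a.2 z.1, b.2 z.2))]].

Definition is_lie_group (E : vectType R) (G : groupType)
    (A : set (chart E G)) : Prop :=
  let P := aplots (@rplots E) A in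
  [/\ is_manifold (@rplots E) A,
      smooth_map (prod_plots P P) P (fun x => (x.1 * x.2)%g)
    & smooth_map P P (fun x => x^-1%g)].

Definition is_complex_lie_group (V : vectType R[i]) (H : groupType)
    (A : set (chart V H)) : Prop :=
  [/\ is_complex_manifold A,
      holomorphic_map (prod_atlas A A) A (fun x => (x.1 * x.2)%g)
    & holomorphic_map A A (fun x => x^-1%g)].

Section LieAlgebra.
Variables (H : groupType) (P : plots H).

(* The Lie algebra is the tangent space at 1; the bracket is that of the
   left-invariant fields h |-> d_1 L_h (beta). *)
Definition lie_bracket (beta gamma : (H -> R) -> R) : (H -> R) -> R :=
  let left_inv v := fun h => differential P (fun x => (h * x)%g) v in
  field_bracket P (left_inv beta) (left_inv gamma) 1%g.

Definition Ad (h : H) : ((H -> R) -> R) -> ((H -> R) -> R) :=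
  differential P (fun x => (h * x * h^-1)%g).
End LieAlgebra.

End Smooth.

(* tp u v w = {u v^* w} *)
Record hermitian_jordan_triple (R : realType) (Z : vectType R[i]) := HJT {
  tp : Z -> Z -> Z -> Z;
  tpC : forall u v w, tp u v w = tp w v u;
  tpDl : forall (a : R[i]) u u' v w,
    tp (a *: u + u') v w = a *: tp u v w + tp u' v w;
  tpDm : forall (a : R[i]) u v v' w,
    tp u (a *: v + v') w = (a^*) *: tp u v w + tp u v' w;
  tpJ : forall u v z w x,
    tp u v (tp z w x) - tp z w (tp u v x)
    = tp (tp u v z) w x - tp z (tp w u v) x }.

Section Jordan.
Variables (R : realType) (Z : vectType R[i]) (T : hermitian_jordan_triple Z).

Definition box (u v : Z) : 'End(Z) := linfun (tp T u v).

Definition end_mx (h : 'End(Z)) :=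
  mxof (vbasis {:Z}) (vbasis {:Z}) h.

Definition trace_form (u v : Z) : R[i] := \tr (end_mx (box u v)).

Definition positive_triple : Prop := forall u : Z, u != 0 -> 0 < trace_form u u.

Definition triple_ideal (I : {vspace Z}) : Prop :=
  forall u v x, x \in I -> tp T u v x \in I /\ tp T u x v \in I.

Definition irreducible_triple : Prop :=
  ({:Z} <> 0)%VS /\
  forall I I' : {vspace Z}, triple_ideal I -> triple_ideal I' ->
    (I + I' = {:Z})%VS -> (I :&: I' = 0)%VS -> (I = 0)%VS \/ (I' = 0)%VS.

Definition bergman (z w : Z) : 'End(Z) :=
  linfun (fun x => x - 2%:R *: tp T z w x + tp T z (tp T w x w) z).

Definition bergman_inv (z w : Z) : Prop := \det (end_mx (bergman z w)) <> 0.

(* z^w *)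
Definition quasi_inverse (z w : Z) : Z :=
  ((bergman z w)^-1)%VF (z - tp T z w z).

(* The positive square root, for the inner product trace_form. *)
Definition is_sqrt (h s : 'End(Z)) : Prop :=
  [/\ (s \o s)%VF = h,
      forall u v, trace_form (s u) v = trace_form u (s v)
    & forall u, u != 0 -> 0 < trace_form (s u) u].

Definition bounded_domain : set Z :=
  component (@cplots R Z) [set z | bergman_inv z z] 0.

(* The class [z,a]: (z,a) ~ (z^(a-b), b) when B(z,a-b) is invertible. *)
Definition dual_class (z a : Z) : set (Z * Z) :=
  [set y | bergman_inv z (a - y.2) /\ y.1 = quasi_inverse z (a - y.2)].

(* M^eps as an open subset of the compact dual, through z |-> [z,0]. *)
Definition Mset (eps : int) (A : set (Z * Z)) : Prop :=
  if eps == 1 then exists z a, A = dual_class z a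
  else if eps == 0 then exists z, A = dual_class z 0
  else exists2 z, bounded_domain z & A = dual_class z 0.

Definition Mpt (eps : int) : Type := {A : set (Z * Z) | Mset eps A}.

Lemma tp0r u v : tp T u v 0 = 0.
Proof.
rewrite tpC; have := tpDl T 1 0 0 v u; rewrite !scale1r addr0 => /eqP.
by rewrite -subr_eq0 opprD addNKr oppr_eq0 => /eqP.
Qed.

Lemma bergman00 : bergman 0 0 = \1%VF.
Proof.
apply/lfunP => x; rewrite id_lfunE /bergman.
have E : (fun x => x - 2%:R *: tp T 0 0 x + tp T 0 (tp T 0 x 0) 0) =1 idfun.
  by move=> y; rewrite tp0r (tpC T 0 0 y) tp0r scaler0 subr0 addr0.
have /funext -> := E.
by rewrite lfunE.
Qed.

Lemma base_in_M eps : Mset eps (dual_class 0 0).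
Proof.
rewrite /Mset; case: ifP => _; first by exists 0, 0.
case: ifP => _; first by exists 0.
exists 0 => //; exists [set 0]; split => //.
- move=> _ -> /=; rewrite /bergman_inv bergman00 /end_mx.
  have -> : mxof (vbasis {:Z}) (vbasis {:Z}) \1%VF = 1%:M.
    exact: mxof1 (basis_free (vbasisP _)).
  by rewrite det1; apply/eqP; rewrite oner_eq0.
- by move=> A B _ _ _ [_ [->] A0] [_ [->] B0]; exists 0.
Qed.

End Jordan.

Section HermitianSymmetric.
Variables (R : realType) (Z : vectType R[i]) (T : hermitian_jordan_triple Z).
Variable eps : int.

Local Notation M := (Mpt T eps).

Definition base_point : M := exist _ _ (base_in_M T eps).

(* [z,a] as a point of M^eps; the value off M^eps is irrelevant. *)
Definition pt (z a : Z) : M :=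
  if pselect (Mset T eps (dual_class T z a)) is left h then exist _ _ h
  else base_point.

Definition Zpt (z : Z) : M := pt z 0.

Definition in_M (z : Z) : Prop := Mset T eps (dual_class T z 0).

Definition Matlas : set (chart Z M) :=
  [set c | exists a, c = ([set z | Mset T eps (dual_class T z a)], pt^~ a)].

Definition Mplots : plots R M := caplots Matlas.

(* The vector u of Z = T_z Z as a tangent vector of M at z. *)
Definition Zvec (z u : Z) : (M -> R) -> R := chart_vector Matlas Zpt z u.

Definition triple_automorphism : set 'End(Z) :=
  [set k | lker k == 0%VS /\
    forall u v w, k (tp T u v w) = tp T (k u) (k v) (k w)].

Definition Kset : set 'End(Z) :=
  component (@cplots R _) triple_automorphism \1%VF.

(* g is the action of k on M: k [z,a] = [kz,ka] *)
Definition K_action (k : 'End(Z)) (g : M -> M) : Prop :=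
  forall (x : M) z a, sval x = dual_class T z a ->
    sval (g x) = dual_class T (k z) (k a).

(* The formula holds where it makes sense; for eps = 1 this is a dense open
   subset, and g is the unique continuous extension to M. *)
Definition transvection (g : M -> M) : Prop :=
  exists w s, [/\ in_M w,
    is_sqrt T (bergman T w (- (eps%:~R *: w))) s,
    smooth_map Mplots Mplots g
  & forall z, in_M z -> bergman_inv T z (eps%:~R *: w) ->
      sval (g (Zpt z)) =
      dual_class T (w + s (quasi_inverse T z (eps%:~R *: w))) 0].

Inductive generated_transformation : (M -> M) -> Prop :=
| gen_id : generated_transformation id
| gen_K k g : Kset k -> K_action k g -> generated_transformation g
| gen_transvection g : transvection g -> generated_transformation g
| gen_comp g h : generated_transformation g -> generated_transformation h ->
    generated_transformation (g \o h)
| gen_inv g h : generated_transformation g -> cancel g h -> cancel h g ->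
    generated_transformation h.

(* The Lie algebra of K: velocities at id of smooth curves in K. *)
Definition k_algebra : set 'End(Z) :=
  [set kappa | exists c : R -> 'End(Z),
    [/\ smooth_curve (@cplots R _) c, c 0 = \1%VF, forall t, Kset (c t)
    & forall l : {linear 'End(Z) -> R[i]^o},
        is_derive (0 : R) (1 : R) (fun t : R => complex.Re (l (c t)))
          (complex.Re (l kappa))]].

Definition p_field (v : Z) : Z -> Z :=
  fun z => v + eps%:~R *: tp T z v z.

Section Group.
Variables (E : vectType R) (G : groupType) (AG : set (chart E G)).
Variables (act : G -> M -> M) (incK : 'End(Z) -> G).

Definition Gplots : plots R G := aplots (@rplots R E) AG.

(* xi is the vector field on Z generated by tau in T_1 G. *)
Definition generates (tau : (G -> R) -> R) (xi : Z -> Z) : Prop :=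
  forall z, in_M z ->
    differential Mplots (fun g => act g (Zpt z)) tau = Zvec z (xi z).

(* G with its action is the connected Lie group of transformations of M
   generated by K and the transvections (the first eight fields determine it
   up to isomorphism), incK is the inclusion of K, and the remaining fields
   are the standard properties of this group. *)
Record is_Geps : Prop := IsGeps {
  Geps_lie : is_lie_group AG;
  Geps_connected : Dconnected Gplots setT;
  Geps_act1 : forall x, act 1%g x = x;
  Geps_actM : forall g h x, act (g * h)%g x = act g (act h x);
  Geps_smooth : smooth_map (prod_plots Gplots Mplots) Mplots
                  (fun x => act x.1 x.2);
  Geps_effective : forall g, (forall x, act g x = x) -> g = 1%g;
  Geps_generated : forall F : M -> M,
    (exists g, act g = F) <-> generated_transformation F;
  Geps_incK : forall k, Kset k -> K_action k (act (incK k));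
  Geps_incK_smooth : smooth_map_on (@cplots R _) Kset Gplots incK;
  Geps_transitive : forall x y, exists g, act g x = y;
  Geps_holomorphic : forall g, holomorphic_map Matlas Matlas (act g);
  Geps_stabilizer : forall g, act g base_point = base_point <->
    exists2 k, Kset k & incK k = g;
  Geps_algebra : forall tau, tangent Gplots 1%g tau ->
    exists v kappa, k_algebra kappa /\
      generates tau (fun z => p_field v z + kappa z);
  Geps_algebra_unique : forall v kappa, k_algebra kappa ->
    exists! tau, tangent Gplots 1%g tau /\
      generates tau (fun z => p_field v z + kappa z) }.

Definition p_space : set ((G -> R) -> R) :=
  [set tau | tangent Gplots 1%g tau /\ exists v, generates tau (p_field v)].

Section Bundle.
Variables (V : vectType R[i]) (H : groupType) (AH : set (chart V H)).
Variable f : 'End(Z) -> H.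

Definition Hplots : plots R H := caplots AH.

(* For Lie groups smooth homomorphisms are real-analytic. *)
Definition K_homomorphism : Prop :=
  smooth_map_on (@cplots R _) Kset Hplots f /\
  forall k l, Kset k -> Kset l -> f (k \o l)%VF = (f k * f l)%g.

Definition bundle_class (g : G) (h : H) : set (G * H) :=
  [set x | exists2 k, Kset k & x = (g * (incK k)^-1, f k * h)%g].

Definition bundle : Type :=
  {A : set (G * H) | exists g h, A = bundle_class g h}.

Definition bpt (g : G) (h : H) : bundle :=
  exist _ (bundle_class g h)
    (ex_intro _ g (ex_intro _ h (erefl (bundle_class g h)))).

(* A representative; the uses below do not depend on its choice. *)
Definition brep (q : bundle) : G * H :=
  let gE := cid (proj2_sig q) in (projT1 gE, projT1 (cid (projT2 gE))).

Definition bplots : plots R bundle := fun n U p =>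
  open U /\ forall x, U x -> exists W s,
    [/\ open W, W x, prod_plots Gplots Hplots W s &
        forall y, W y -> p y = bpt (s y).1 (s y).2].

Definition bproj (q : bundle) : M := act (brep q).1 base_point.

(* a <g|h> c = <ag|hc> *)
Definition bact (a : G) (q : bundle) (c : H) : bundle :=
  bpt (a * (brep q).1)%g ((brep q).2 * c)%g.

Local Notation TQ := ((bundle -> R) -> R).
Local Notation dproj := (differential Mplots bproj).
Local Notation dR c := (differential bplots (fun q => bact 1%g q c)).
Local Notation dL q := (differential bplots (bact 1%g q)).

Definition complexion (J : bundle -> TQ -> TQ) : Prop :=
  [/\ almost_complex bplots J,
      forall q X, tangent bplots q X ->
        jrel Matlas (bproj q) (dproj X) (dproj (J q X)),
      forall q c X, tangent bplots q X ->
        J (bact 1%g q c) (dR c X) = dR c (J q X)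
    & forall q beta beta', jrel AH 1%g beta beta' ->
        J q (dL q beta) = dL q beta'].

Definition horizontal (g : G) (h : H) : set TQ :=
  [set X | exists2 tau, p_space tau &
    X = differential bplots (bpt^~ h)
          (differential Gplots (fun x => (g * x)%g) tau)].

Definition tautological_complexion (J0 : bundle -> TQ -> TQ) : Prop :=
  complexion J0 /\
  forall g h X, horizontal g h X -> horizontal g h (J0 (bpt g h) X).

Definition antilinear_map (b : Z -> (H -> R) -> R) : Prop :=
  [/\ forall u, tangent Hplots 1%g (b u),
      forall u v, b (u + v) = b u + b v,
      forall (t : R) u, b (t%:C *: u) = t *: b u
    & forall u, jrel AH 1%g (b u) (- b ('i%C *: u))].

Definition covariant (b : Z -> (H -> R) -> R) : Prop :=
  forall k u u', Kset k ->
    differential Mplots (act (incK k)) (Zvec 0 u) = Zvec 0 u' ->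
    Ad Hplots (f k) (b u) = b u'.

Definition generated_complexion (J0 : bundle -> TQ -> TQ)
    (b : Z -> (H -> R) -> R) (J : bundle -> TQ -> TQ) : Prop :=
  exists B : bundle -> ((M -> R) -> R) -> ((H -> R) -> R),
    (forall g h u, B (bpt g h) (differential Mplots (act g) (Zvec 0 u)) =
      Ad Hplots h^-1%g (b u)) /\
    (forall q X, tangent bplots q X ->
      J q X = J0 q X + dL q (B q (dproj X))).

End Bundle.
End Group.
End HermitianSymmetric.

(* Main.v *)
(* Every tangent vector of Q at <g|h> can be written <g tau_v | beta h>, where
   tau_v in p^eps generates v^eps, v in Z and beta in the Lie algebra of H; in
   these terms J sends (v, beta) to (i v, b v + i beta), with constant
   coefficients. Expand two vector fields in this frame: since the matrix of J
   is constant with square -1, the derivatives of the coefficients cancel in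
   the Nijenhuis tensor and only brackets of constant pairs remain. The bracket
   [tau_u, tau_v] lies in k and depends only on the hermitian structure, so
   [tau_iu, tau_iv] = [tau_u, tau_v] and these terms cancel; the bracket of the
   Lie algebra of H is complex bilinear and b is antilinear, which leaves
   N((u, beta), (v, gamma)) = (0, -[b u, b v]).
   For the converse, the fields generated by the left action of G realize
   (u, 0) and (v, 0) at <1|1>, and a vertical vector (0, beta) at <1|1> is zero
   only if beta = 0: a local section of G -> M extends functions on the fibre
   to smooth functions on Q. *)
Require Import Defs.
From HB Require Import structures.
From mathcomp Require Import all_boot all_order all_algebra complex.
From mathcomp Require Import all_classical all_reals all_analysis.
From mathcomp Require Import ring lra.
Set Implicit Arguments.
Unset Strict Implicit.
Unset Printing Implicit Defensive.
Import passmx.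
Import Order.TTheory GRing.Theory Num.Theory numFieldNormedType.Exports.
Local Open Scope classical_set_scope.
Local Open Scope ring_scope.
Local Open Scope complex_scope.

(** * Smooth functions on open subsets of R^n *)

(** A tangent vector is a functional on globally smooth functions, so an equality of vectors carries
    information only when there are enough such functions. On [M] they are coordinates of the chart
    z |-> [z,0] times a bump function, extended by zero. Smoothness of the extension at points
    outside the chart rests on the transition maps z |-> z^a, and the Jordan identities for
    quasi-inverses are developed for this. [Q] is given by plots only, so its functions come from a
    local section of [G] over [M], hence the inverse function theorem. In <g tau | beta h> the two
    vectors stand side by side, so the part of tau in k passes through f into beta and v alone
    remains. The pair (v, beta) changes with the representative (g,h); coefficients of a field are
    therefore functions on [G * H], and they are controlled only after multiplication by a
    determinant. The fields beta h are right invariant, which is the origin of the minus sign before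
    the bracket of [H]. That bracket is complex linear since it is the derivative of Ad, and Ad
    commutes with i because [J0] is right invariant and prescribed on vertical vectors. *)

Section Calculus.
Variable R : realType.

Lemma Ck_sub k n (U V : set 'rV[R]_n) f : Ck k U f -> V `<=` U -> Ck k V f.
Proof.
move=> + VU; elim: k f => [|k IH] f /=; first by move=> cf x /VU Ux; exact: cf.
by move=> [df dv]; split=> [x /VU /df //|v]; exact/IH/dv.
Qed.

Lemma Ck_local k n (U : set 'rV[R]_n) f :
  (forall x, U x -> exists2 W : set 'rV_n, W x & Ck k W f) -> Ck k U f.
Proof.
elim: k f => [|k IH] f loc /=.
  by move=> x /loc[W Wx cW]; exact: cW.
split=> [x /loc[W Wx [dW _]]|v]; first exact: dW.
by apply: IH => x /loc[W Wx [_ dW]]; exists W => //; exact: dW.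
Qed.

(** Differentiability with the remainder in epsilon form, the form in which it is estimated by hand
    for inverse maps and for [flat] at 0. *)
Lemma is_diff_eps (V W : normedModType R) (f : V -> W)
    (L : {linear V -> W}) x : continuous L ->
  (forall e : R, 0 < e ->
    \forall h \near (0 : V), `|f (h + x) - f x - L h| <= e * `|h|) ->
  differentiable f x /\ 'd f x = L :> (V -> W).
Proof.
move=> cL H.
have E : f \o shift x = cst (f x) + L +o_ (0 : V) id.
  apply/eqaddoP => e e0; have := H e e0; apply: filterS => h.
  by rewrite !fctE /= opprD addrA.
have dE := diff_unique cL E; split=> //.
by apply/diff_locallyP; rewrite dE.
Qed.

Lemma differentiable_near (V : normedModType R) (f g : V -> R) x :
  (\forall y \near x, f y = g y) -> differentiable f x -> differentiable g x.
Proof.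
move=> fg df.
have fgx : f x = g x by exact: nbhs_singleton fg.
apply: (proj1 (@is_diff_eps _ _ g ('d f x) x _ _)).
  exact: diff_continuous.
move=> e e0; have /diff_locallyP[_ /eqaddoP H] := df.
have fg0 : \forall h \near (0 : V), f (h + x) = g (h + x).
  by rewrite (near_shift x) sub0r; apply: filterS fg => y; rewrite /= subrK.
near=> h.
have <- : f (h + x) = g (h + x) by near: h.
rewrite -fgx -addrA -opprD.
by near: h; have := H e e0; apply: filterS => h; rewrite !fctE.
Unshelve. all: by end_near. Qed.

Lemma Ck_eq k n (U : set 'rV[R]_n) f g : open U ->
  (forall x, U x -> f x = g x) -> Ck k U f -> Ck k U g.
Proof.
move=> oU; elim: k f g => [|k IH] f g fg /=.
  move=> cf x Ux; have nfg : \forall y \near x, f y = g y.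
    by apply: filterS (open_nbhs_nbhs (conj oU Ux)) => y; exact: fg.
  suff : g @ x --> g x by [].
  rewrite -(fg x Ux); apply: cvg_trans (cf x Ux).
  exact: (@near_eq_cvg _ _ (nbhs x) _ f g nfg).
move=> [df dv]; split=> [x Ux|v].
  apply: differentiable_near (df x Ux).
  by apply: filterS (open_nbhs_nbhs (conj oU Ux)) => y; exact: fg.
apply: IH (dv v) => x Ux; apply: near_eq_derive.
by apply: filterS (open_nbhs_nbhs (conj oU Ux)) => y; exact: fg.
Qed.

Lemma Ck_pred k n (U : set 'rV[R]_n) f : Ck k.+1 U f -> Ck k U f.
Proof.
elim: k f => [|k IH] f /=.
  by move=> [df _] x /df; exact: differentiable_continuous.
by move=> [df dv]; split=> // v; apply: IH; exact: dv.
Qed.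

Lemma Ck_cst k n (U : set 'rV[R]_n) c : Ck k U (cst c).
Proof.
elim: k c => [|k IH] c /=; first by move=> x _; exact: cst_continuous.
split=> [x _|v]; first exact: differentiable_cst.
have -> : 'D_v (cst c) = cst 0 :> ('rV[R]_n -> R).
  by apply/funext => x; rewrite derive_cst.
exact: IH.
Qed.

Lemma Ck_add k n (U : set 'rV[R]_n) f g : open U ->
  Ck k U f -> Ck k U g -> Ck k U (fun x => f x + g x).
Proof.
move=> oU; elim: k f g => [|k IH] f g /=.
  by move=> cf cg x Ux; exact: (continuousD (cf x Ux) (cg x Ux)).
move=> [df dvf] [dg dvg]; split=> [x Ux|v].
  by apply: differentiableD; [exact: df|exact: dg].
apply: (@Ck_eq k n U (fun x => 'D_v f x + 'D_v g x)) => //; last exact: IH.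
by move=> x Ux; rewrite -deriveD//; apply/diff_derivable; [exact: df|exact: dg].
Qed.

Lemma Ck_mul k n (U : set 'rV[R]_n) f g : open U ->
  Ck k U f -> Ck k U g -> Ck k U (fun x => f x * g x).
Proof.
move=> oU; elim: k f g => [|k IH] f g.
  by move=> cf cg x Ux; exact: (continuousM (cf x Ux) (cg x Ux)).
move=> cf cg; have cf' := Ck_pred cf; have cg' := Ck_pred cg.
case: cf cg => [df dvf] [dg dvg]; split=> [x Ux|v].
  by apply: differentiableM; [exact: df|exact: dg].
apply: (@Ck_eq k n U (fun x => f x * 'D_v g x + g x * 'D_v f x)) => //.
  move=> x Ux; have := @deriveM _ _ f g x v.
  by move=> -> //; apply/diff_derivable; [exact: df|exact: dg].
exact: (Ck_add oU (IH _ _ cf' (dvg v)) (IH _ _ cg' (dvf v))).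
Qed.

Lemma Ck_opp k n (U : set 'rV[R]_n) f : open U ->
  Ck k U f -> Ck k U (fun x => - f x).
Proof.
move=> oU cf; apply: (@Ck_eq k n U (fun x => (-1) * f x)) => //.
  by move=> x _; rewrite mulN1r.
by apply: Ck_mul => //; exact: Ck_cst.
Qed.

(** The derivative of 1/f is -(1/f)^2 f', so order k for 1/f itself is what the step to order k+1
    consumes. *)
Lemma Ck_inv k n (U : set 'rV[R]_n) f : open U ->
  (forall x, U x -> f x != 0) -> Ck k U f -> Ck k U (fun x => (f x)^-1).
Proof.
move=> oU f0; elim: k => [|k IH] cf.
  by move=> x Ux; exact: (continuousV (f0 x Ux) (cf x Ux)).
have cV := IH (Ck_pred cf).
case: cf => [df dvf]; split=> [x Ux|v].
  by apply: (@differentiableV _ _ f); [exact: df|exact: f0].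
apply: (@Ck_eq k n U (fun x => - ((f x)^-1 * (f x)^-1) * 'D_v f x)) => //.
  move=> x Ux; have := @deriveV _ _ f x v.
  move=> -> //; [|exact: f0|exact/diff_derivable/df].
  by rewrite -invfM -expr2.
exact: (Ck_mul oU (Ck_opp oU (Ck_mul oU cV cV)) (dvf v)).
Qed.

Lemma Ck_sum k n (U : set 'rV[R]_n) I (r : seq I) (F : I -> 'rV[R]_n -> R) :
  open U -> (forall i, Ck k U (F i)) -> Ck k U (fun x => \sum_(i <- r) F i x).
Proof.
move=> oU cF; elim: r => [|i r IH].
  rewrite (_ : (fun _ => _) = cst 0); first exact: Ck_cst.
  by apply/funext => x; rewrite big_nil.
rewrite (_ : (fun _ => _) = fun x => F i x + \sum_(j <- r) F j x).
  exact: Ck_add.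
by apply/funext => x; rewrite big_cons.
Qed.

Lemma rowE n (v : 'rV[R]_n) : v = \sum_i v 0 i *: delta_mx 0 i.
Proof. exact: row_sum_delta. Qed.

Lemma continuous_rV (T : topologicalType) n (p : T -> 'rV[R]_n) (x : T) :
  (forall i, {for x, continuous (fun y => p y 0 i)}) -> {for x, continuous p}.
Proof.
move=> H.
have -> : p = \sum_i (fun y => p y 0 i *: delta_mx 0 i).
  by apply/funext => y; rewrite fct_sumE -rowE.
apply: (big_ind (fun f : T -> 'rV[R]_n => {for x, continuous f})).
- exact: cst_continuous.
- by move=> f g cf cg; exact: (continuousD cf cg).
- by move=> i _; exact: (continuousZr_tmp (H i)).
Qed.

Lemma affine_continuous n (x v : 'rV[R]_n) : continuous (fun t : R => x + t *: v).
Proof.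
move=> t; apply: continuous_rV => i; apply: differentiable_continuous.
have -> : (fun y : R => (x + y *: v) 0 i) = (fun y : R => x 0 i + y * v 0 i).
  by apply/funext => y; rewrite !mxE.
by apply/derivable1_diffP; apply: ex_derive.
Qed.

Lemma differentiable_rV (V : normedModType R) n (p : V -> 'rV[R]_n) x :
  (forall i, differentiable (fun y => p y 0 i) x) -> differentiable p x.
Proof.
move=> H.
have -> : p = \sum_i (fun y => p y 0 i *: delta_mx 0 i).
  by apply/funext => y; rewrite fct_sumE -rowE.
by apply: differentiable_sum => i; apply: differentiableZl; exact: H.
Qed.

Lemma diff_coordE (V : normedModType R) n (p : V -> 'rV[R]_n) x v i :
  differentiable p x -> 'D_v (fun y => p y 0 i) x = ('d p x v) 0 i.
Proof.
move=> dp.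
have dc : differentiable (fun M : 'rV[R]_n => M 0 i : R) (p x).
  exact: differentiable_coord.
have -> : (fun y => p y 0 i) = (fun M : 'rV[R]_n => M 0 i : R) \o p by [].
rewrite deriveE; last exact: differentiable_comp.
rewrite diff_comp //= .
pose L : 'rV[R]_n -> R := fun M => M 0 i.
have lL : linear L by move=> a u w; rewrite /L !mxE.
pose LL := GRing.isLinear.Build _ _ _ _ L lL.
pose LH : {linear 'rV[R]_n -> R} := HB.pack L LL.
rewrite (_ : (fun M : 'rV[R]_n => M 0 i) = LH) //.
by rewrite diff_lin //; exact: coord_continuous.
Qed.

Lemma derive_compE (V : normedModType R) n (p : V -> 'rV[R]_n) (f : 'rV[R]_n -> R) x v :
  (forall i, differentiable (fun y => p y 0 i) x) -> differentiable f (p x) ->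
  'D_v (fun y => f (p y)) x =
    \sum_i 'D_(delta_mx 0 i) f (p x) * 'D_v (fun y => p y 0 i) x.
Proof.
move=> dpi df; have dp := differentiable_rV dpi.
rewrite deriveE; last exact: differentiable_comp.
rewrite (@diff_comp _ _ _ _ p f) //= [in LHS](rowE ('d p x v)) linear_sum.
apply: eq_bigr => i _; rewrite linearZ /= deriveE // mulrC.
by rewrite diff_coordE.
Qed.

Lemma Ck_comp k m n (U : set 'rV[R]_m) (V : set 'rV[R]_n)
    (p : 'rV[R]_m -> 'rV[R]_n) f : open U ->
  (forall i, Ck k U (fun y => p y 0 i)) -> (forall x, U x -> V (p x)) ->
  Ck k V f -> Ck k U (fun x => f (p x)).
Proof.
move=> oU; elim: k f => [|k IH] f.
  move=> cp UV cf x Ux; apply: continuous_comp.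
    by apply: continuous_rV => i; exact: cp.
  exact/cf/UV.
move=> cp UV [df dvf]; split=> [x Ux|v].
  apply: (differentiable_comp (f := p)); last exact/df/UV.
  by apply: differentiable_rV => i; case: (cp i) => dpi _; exact: dpi.
apply: (@Ck_eq k m U (fun x => \sum_i 'D_(delta_mx 0 i) f (p x) *
    'D_v (fun y => p y 0 i) x)) => //.
  move=> x Ux; rewrite derive_compE //; last exact/df/UV.
  by move=> i; case: (cp i) => dpi _; exact: dpi.
apply: Ck_sum => // i; have [_ dpi] := cp i.
have A := IH _ (fun j => Ck_pred (cp j)) UV (dvf (delta_mx 0 i)).
exact: (Ck_mul oU A (dpi v)).
Qed.

Lemma Ck_coord k n (U : set 'rV[R]_n) i : Ck k U (fun x => x 0 i).
Proof.
case: k => [|k] /=; first by move=> x _; exact: coord_continuous.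
split=> [x _|v]; first exact: differentiable_coord.
have -> : 'D_v (fun x : 'rV[R]_n => x 0 i) = cst (v 0 i).
  by apply/funext => x; rewrite (@diff_coordE _ _ id) // diff_val.
exact: Ck_cst.
Qed.

Lemma Cinf_sub n (U V : set 'rV[R]_n) f : Cinf U f -> V `<=` U -> Cinf V f.
Proof. by move=> cf VU k; exact: Ck_sub (cf k) VU. Qed.

Lemma Cinf_local n (U : set 'rV[R]_n) f :
  (forall x, U x -> exists2 W : set 'rV_n, W x & Cinf W f) -> Cinf U f.
Proof.
by move=> H k; apply: Ck_local => x /H[W Wx cf]; exists W => //; exact: cf.
Qed.

Lemma Cinf_eq n (U : set 'rV[R]_n) f g : open U ->
  (forall x, U x -> f x = g x) -> Cinf U f -> Cinf U g.
Proof. by move=> oU fg cf k; exact: Ck_eq fg (cf k). Qed.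

Lemma Cinf_cst n (U : set 'rV[R]_n) c : Cinf U (fun=> c).
Proof. by move=> k; exact: Ck_cst. Qed.

Lemma Cinf_coord n (U : set 'rV[R]_n) i : Cinf U (fun x => x 0 i).
Proof. by move=> k; exact: Ck_coord. Qed.

Lemma Cinf_add n (U : set 'rV[R]_n) f g : open U ->
  Cinf U f -> Cinf U g -> Cinf U (fun x => f x + g x).
Proof. by move=> oU cf cg k; apply: Ck_add. Qed.

Lemma Cinf_mul n (U : set 'rV[R]_n) f g : open U ->
  Cinf U f -> Cinf U g -> Cinf U (fun x => f x * g x).
Proof. by move=> oU cf cg k; apply: Ck_mul. Qed.

Lemma Cinf_opp n (U : set 'rV[R]_n) f : open U ->
  Cinf U f -> Cinf U (fun x => - f x).
Proof. by move=> oU cf k; apply: Ck_opp. Qed.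

Lemma Cinf_inv n (U : set 'rV[R]_n) f : open U ->
  (forall x, U x -> f x != 0) -> Cinf U f -> Cinf U (fun x => (f x)^-1).
Proof. by move=> oU f0 cf k; apply: Ck_inv. Qed.

Lemma Cinf_sum n (U : set 'rV[R]_n) I (r : seq I) (F : I -> 'rV[R]_n -> R) :
  open U -> (forall i, Cinf U (F i)) -> Cinf U (fun x => \sum_(i <- r) F i x).
Proof. by move=> oU cF k; apply: Ck_sum => // i; exact: cF. Qed.

Lemma Cinf_comp m n (U : set 'rV[R]_m) (V : set 'rV[R]_n)
    (p : 'rV[R]_m -> 'rV[R]_n) f : open U ->
  (forall i, Cinf U (fun y => p y 0 i)) -> (forall x, U x -> V (p x)) ->
  Cinf V f -> Cinf U (fun x => f (p x)).
Proof.
move=> oU cp UV cf k; apply: (Ck_comp oU) (cf k) => // i; exact: cp.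
Qed.

Lemma Cinf_derive n (U : set 'rV[R]_n) f v : Cinf U f -> Cinf U (fun x => 'D_v f x).
Proof. by move=> cf k; case: (cf k.+1) => _ dv; exact: dv. Qed.

Lemma Cinf_differentiable n (U : set 'rV[R]_n) f x :
  Cinf U f -> U x -> differentiable f x.
Proof. by move=> /(_ 1%N)[df _] Ux; exact: df. Qed.

Lemma Cinf_continuous n (U : set 'rV[R]_n) f x :
  Cinf U f -> U x -> {for x, continuous f}.
Proof. by move=> /(_ 0%N) cf Ux; exact: cf. Qed.

Lemma open_normP (V : normedModType R) (U : set V) x : open U -> U x ->
  exists2 r : R, 0 < r & forall y, `|y| < r -> U (x + y).
Proof.
move=> oU Ux; have /nbhs_normP[r r0 rU] := open_nbhs_nbhs (conj oU Ux).
exists r => // y yr; apply: rU; rewrite /ball_ /=.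
by rewrite opprD addNKr normrN.
Qed.

Lemma normP_open (V : normedModType R) (U : set V) :
  (forall x, U x -> exists2 r : R, 0 < r & forall y, `|y| < r -> U (x + y)) ->
  open U.
Proof.
move=> H; rewrite openE => x /H[r r0 Hr]; apply/nbhs_normP; exists r => // y.
by rewrite /ball_ /= distrC => yr; rewrite -(subrK x y) addrC; exact: Hr.
Qed.

Lemma lipschitz_continuous_at (V W : normedModType R) (S : V -> W) (A : set V) c w :
  open A -> A w -> 0 < c -> (forall y, A y -> `|S w - S y| <= c * `|w - y|) ->
  {for w, continuous S}.
Proof.
move=> oA Aw c0 lip; apply/cvgrPdist_le => d d0.
have [r r0 rA] := open_normP oA Aw.
apply/nbhs_normP; exists (Num.min r (d / c)).
  by rewrite /= lt_min r0 divr_gt0.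
move=> y; rewrite /ball_ /= lt_min => /andP[yr yd].
apply: (le_trans (lip _ _)).
  by rewrite -(subrK w y) addrC; apply: rA; rewrite distrC.
by move: yd; rewrite ltr_pdivlMr // mulrC => /ltW.
Qed.

(** With h = S(w + k) - S w one has h - A k = -A(k - dF h). The bracket is o(|h|) because F(S w + h)
    - F(S w) = k, and the Lipschitz bound |h| <= c |k| turns this into o(|k|). *)
Lemma diff_right_inverse (V : normedModType R) (F S : V -> V) (W : set V) c w
    (A : {linear V -> V}) :
  open W -> W w -> (forall y, W y -> F (S y) = y) -> 0 < c ->
  (forall y, W y -> `|S w - S y| <= c * `|w - y|) ->
  differentiable F (S w) -> continuous A -> (forall h, A ('d F (S w) h) = h) ->
  differentiable S w /\ 'd S w = A :> (V -> V).
Proof.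
move=> oW Ww FS c0 lip dF cA AF; apply: is_diff_eps => // e e0.
have /linear_lipschitz[C C0 CA] := cA.
(* The tolerance for [F] absorbs the factor [C] lost under [A] and the factor [c] lost in passing
   from |h| to |k|. *)
have e1 : 0 < e / (c * C) by rewrite divr_gt0 // mulr_gt0.
have /diff_locallyP[_ /eqaddoP HF] := dF.
have /nbhs_normP[d d0 Hd] := HF _ e1.
have [r r0 rW] := open_normP oW Ww.
apply/nbhs_normP; exists (Num.min r (d / c)).
  by rewrite /= lt_min r0 divr_gt0.
move=> k; rewrite /ball_ /= sub0r normrN lt_min => /andP[kr kd].
have Wk : W (k + w) by rewrite addrC; exact: rW.
set h := S (k + w) - S w.
have hk : `|h| <= c * `|k|.
  by have := lip _ Wk; rewrite distrC => /le_trans; apply; rewrite opprD addrCA subrr addr0 normrN.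
have hd : `|h| < d.
  by apply: le_lt_trans hk _; rewrite mulrC -ltr_pdivlMr.
have := Hd h; rewrite /ball_ /= sub0r normrN => /(_ hd).
rewrite !fctE /= subrK FS // FS // opprD addrA addrK => Hk.
have -> : h - A k = - A (k - 'd F (S w) h) by rewrite linearB AF opprB.
rewrite normrN; apply: le_trans (CA _) _.
apply: (@le_trans _ _ (C * (e / (c * C) * `|h|))).
  by rewrite ler_wpM2l // ltW.
have -> : C * (e / (c * C) * `|h|) = e * (`|h| / c).
  by field; rewrite !gt_eqF.
by apply: ler_wpM2l; [exact: ltW|rewrite ler_pdivrMr // mulrC].
Qed.

Lemma line_is_derive (V : normedModType R) (f : V -> R) x v (t : R) :
  differentiable f (x + t *: v) ->
  is_derive t 1 (fun s : R => f (x + s *: v)) ('D_v f (x + t *: v)).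
Proof.
move=> df.
have E : (fun h : R => h^-1 *: (((fun s : R => f (x + s *: v)) \o shift t) (h *: 1)
     - f (x + t *: v))) =
   (fun h : R => h^-1 *: ((f \o shift (x + t *: v)) (h *: v) - f (x + t *: v))).
  apply/funext => h /=; congr (_ *: (f _ - _)).
  by rewrite [h *: 1]mulr1 scalerDl addrCA.
have dv : derivable f (x + t *: v) v by exact: diff_derivable.
by split; [rewrite /derivable E|rewrite /derive E].
Qed.

Lemma derive1_line (V : normedModType R) (f : V -> R) x v :
  differentiable f x -> derive1 (fun s : R => f (x + s *: v)) 0 = 'D_v f x.
Proof.
move=> df; rewrite derive1E.
have := @line_is_derive _ f x v 0; rewrite scale0r addr0 => /(_ df) [_].
by [].
Qed.

Lemma derive1_chain n (F : 'rV[R]_n -> R) (p : R -> 'rV[R]_n) (dp : 'I_n -> R) :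
  differentiable F (p 0) -> (forall i, is_derive (0 : R) (1 : R) (fun t : R => p t 0 i) (dp i)) ->
  is_derive (0 : R) (1 : R) (fun t : R => F (p t)) (\sum_i 'D_(delta_mx 0 i) F (p 0) * dp i).
Proof.
move=> dF dpi.
have dpd i : differentiable (fun t => p t 0 i) 0.
  by apply/derivable1_diffP; have [] := dpi i.
split.
  apply/derivable1_diffP; apply: (differentiable_comp (f := p)) => //.
  exact: differentiable_rV.
rewrite derive_compE //; apply: eq_bigr => i _.
by have [_ ->] := dpi i.
Qed.

Lemma MVT_line (V : normedModType R) (f : V -> R) x v (h : R) : 0 < h ->
  (forall t : R, 0 <= t <= h -> differentiable f (x + t *: v)) ->
  exists2 c : R, 0 < c < h & f (x + h *: v) - f x = h * 'D_v f (x + c *: v).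
Proof.
move=> h0 df.
have [||c] := @MVT _ (fun s : R => f (x + s *: v))
    (fun s : R => 'D_v f (x + s *: v)) 0 h h0.
- move=> t; rewrite in_itv /= => /andP[t0 th].
  by apply: line_is_derive; apply: df; rewrite !ltW.
- apply: derivable_within_continuous => t; rewrite in_itv /= => th.
  by have [] := line_is_derive (df t th).
rewrite in_itv /= scale0r addr0 subr0 mulrC => ch Ec.
by exists c.
Qed.

(** The second difference of f over the parallelogram spanned by h v and h w is symmetric in v and
    w. Two applications of the mean value theorem write it as h^2 times an iterated derivative at a
    nearby point, in either order; both iterated derivatives are then within e/2 of the same
    quotient. *)
Lemma schwarz n (U : set 'rV[R]_n) f x v w : open U -> U x -> Cinf U f ->
  'D_v (fun y => 'D_w f y) x = 'D_w (fun y => 'D_v f y) x.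
Proof.
move=> oU Ux cf.
have sw (a b c d : R) : a - b - (c - d) = a - c - (b - d) by ring.
have cancel2 (a b c : R) : b - c = - (a - b) + (a - c) by ring.
apply/eqP; rewrite eq_sym -subr_eq0 -normr_eq0 eq_le normr_ge0 andbT.
apply/ler_addgt0Pl => e e0; rewrite addr0.
pose F := fun y => 'D_w ('D_v f) y; pose G := fun y => 'D_v ('D_w f) y.
have key : forall v w, let F := fun y => 'D_w ('D_v f) y in
    exists2 r : R, 0 < r & forall h : R, 0 < h < r ->
    `|(f (x + h *: w + h *: v) - f (x + h *: w) - (f (x + h *: v) - f x))
      / h ^+ 2 - F x| <= e / 2.
  move=> {F G v w} v w F.
  have cF : {for x, continuous F}.
    by apply: (@Cinf_continuous n U) => //; do 2 apply: Cinf_derive.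
  have [r r0 rU] := open_normP oU Ux.
  have e20 : 0 < e / 2 by rewrite divr_gt0.
  have /cvgrPdist_le/(_ _ e20)/nbhs_normP[d d0 dF] := cF.
  (* [h * K] bounds s v + t w for s, t in [0,h]; the summand 1 keeps [K] positive when both vectors
     vanish. *)
  pose K := 1 + `|v| + `|w|.
  have K0 : 0 < K by rewrite /K -addrA ltr_pwDl // addr_ge0.
  exists (Num.min r d / K); first by rewrite divr_gt0 // lt_min r0.
  move=> h /andP[h0]; rewrite ltr_pdivlMr // lt_min => /andP[hr hd].
  have small : forall s t : R, 0 <= s <= h -> 0 <= t <= h ->
      `|s *: v + t *: w| <= h * K.
    move=> s t /andP[s0 sh] /andP[t0 th].
    apply: (le_trans (ler_normD _ _)); rewrite !normrZ !ger0_norm //.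
    rewrite /K !mulrDr mulr1 -addrA ler_wpDl //; first exact: ltW.
    by rewrite lerD // ler_wpM2r.
  have inU : forall s t : R, 0 <= s <= h -> 0 <= t <= h ->
      U (x + t *: w + s *: v).
    move=> s t hs ht; rewrite -addrA (addrC (t *: w)).
    by apply: rU; apply: le_lt_trans hr; exact: small.
  have h01 : 0 <= h <= h by rewrite ltW /=.
  have h00 : (0 : R) <= 0 <= h by rewrite lexx ltW.
  pose g y := f (y + h *: w) - f y.
  have dfw : forall y, U (y + h *: w) -> differentiable (fun y => f (y + h *: w)) y.
    move=> y Uy; apply: (differentiable_comp (f := fun y => y + h *: w)).
      exact: differentiableD.
    exact: Cinf_differentiable Uy.
  have [t /andP[t0 th]|c /andP[c0 ch]] := @MVT_line _ g x v h h0.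
    have th' : 0 <= t <= h by rewrite t0.
    apply: differentiableB.
      by apply: dfw; rewrite addrAC; apply: inU.
    have Ut := inU t 0 th' h00; rewrite scale0r addr0 in Ut.
    exact: Cinf_differentiable cf Ut.
  have ch' : 0 <= c <= h by rewrite !ltW.
  have -> : 'D_v g (x + c *: v) = 'D_v f (x + c *: v + h *: w) - 'D_v f (x + c *: v).
    have d1 : differentiable (fun y => f (y + h *: w)) (x + c *: v).
      by apply: dfw; rewrite addrAC; apply: inU.
    have d2 : differentiable f (x + c *: v).
      have Ut := inU c 0 ch' h00; rewrite scale0r addr0 in Ut.
      exact: Cinf_differentiable cf Ut.
    rewrite (@deriveB _ _ _ (fun y => f (y + h *: w)) f);
      [|exact: diff_derivable|exact: diff_derivable].
    have d3 : differentiable f (x + c *: v + h *: w).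
      have Ut := inU c h ch' h01; rewrite addrAC in Ut.
      exact: Cinf_differentiable cf Ut.
    congr (_ - _); rewrite -(derive1_line v d1) -(derive1_line v d3).
    by congr (derive1 _ 0); apply/funext => s; rewrite addrAC.
  have [t ht|c2 /andP[c20 c2h]] := @MVT_line _ ('D_v f) (x + c *: v) w h h0.
    apply: (@Cinf_differentiable n U); first exact: Cinf_derive.
    by rewrite addrAC; exact: inU.
  rewrite -/(F _) => -> E.
  have -> : f (x + h *: w + h *: v) - f (x + h *: w) - (f (x + h *: v) - f x) =
      g (x + h *: v) - g x.
    by rewrite /g (addrAC x (h *: w)) sw.
  rewrite E mulrA -expr2 mulrC mulKf ?expf_neq0 ?gt_eqF // distrC.
  apply: dF; rewrite /ball_ /= -addrA opprD addNKr normrN.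
  by apply: le_lt_trans hd; apply: small => //; rewrite !ltW.
have [r r0 hr] := key v w; have [s s0 hs] := key w v.
pose h := Num.min r s / 2.
have m0 : 0 < Num.min r s by rewrite lt_min r0.
have h0 : 0 < h by rewrite divr_gt0.
have hlt : h < Num.min r s by rewrite ltr_pdivrMr // ltr_pMr // ltrDl.
have [h1 h2] : h < r /\ h < s by split; move: hlt; rewrite lt_min => /andP[].
have B1 := hr h; rewrite h0 h1 in B1; have {}B1 := B1 isT.
have B2 := hs h; rewrite h0 h2 in B2; have {}B2 := B2 isT.
have D1 : f (x + h *: v + h *: w) - f (x + h *: v) - (f (x + h *: w) - f x) =
    f (x + h *: w + h *: v) - f (x + h *: w) - (f (x + h *: v) - f x).
  by rewrite (addrAC x (h *: w)) sw.
rewrite D1 in B2; rewrite (splitr e).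
set D := _ / h ^+ 2 in B1 B2.
rewrite (cancel2 D).
apply: (le_trans (ler_normD _ _)); rewrite normrN.
by apply: lerD; [exact: B1|exact: B2].
Qed.

End Calculus.

(** * Determinants and Cramer's rule over an algebra of functions *)

Section FunctionAlgebra.
Variables (K : fieldType) (T : Type) (P : (T -> K) -> Prop).
Hypotheses (P_cst : forall c, P (fun=> c))
  (P_add : forall f g, P f -> P g -> P (fun x => f x + g x))
  (P_mul : forall f g, P f -> P g -> P (fun x => f x * g x)).

Lemma alg_sum I (r : seq I) (Q : pred I) (F : I -> T -> K) :
  (forall i, P (F i)) -> P (fun x => \sum_(i <- r | Q i) F i x).
Proof.
move=> PF; elim: r => [|i r IH].
  by have -> : (fun x => \sum_(j <- [::] | Q j) F j x) = (fun=> 0)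
    by apply/funext => x; rewrite big_nil.
have -> : (fun x => \sum_(j <- i :: r | Q j) F j x) =
    (fun x => (if Q i then 1 else 0) * F i x + \sum_(j <- r | Q j) F j x).
  by apply/funext => x; rewrite big_cons; case: ifP; rewrite (mul1r, mul0r) ?add0r.
by apply: P_add => //; exact: P_mul.
Qed.

Lemma alg_prod I (r : seq I) (F : I -> T -> K) :
  (forall i, P (F i)) -> P (fun x => \prod_(i <- r) F i x).
Proof.
move=> PF; elim: r => [|i r IH].
  by have -> : (fun x => \prod_(j <- [::]) F j x) = (fun=> 1)
    by apply/funext => x; rewrite big_nil.
have -> : (fun x => \prod_(j <- i :: r) F j x) =
    (fun x => F i x * \prod_(j <- r) F j x).
  by apply/funext => x; rewrite big_cons.
exact: P_mul.
Qed.

Lemma alg_det n (M : T -> 'M[K]_n) :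
  (forall i j, P (fun x => M x i j)) -> P (fun x => \det (M x)).
Proof.
move=> PM.
rewrite /determinant; apply: alg_sum => s.
by apply: P_mul => //; apply: alg_prod => i; exact: PM.
Qed.

(** The inverse as adjugate over determinant: its entries are polynomials in those of [A] times one
    inverse, so a class of functions closed under sums and products contains them as soon as it
    contains that inverse. *)
Definition cramer n (A : 'M[K]_n) : 'M[K]_n := (\det A)^-1 *: \adj A.

Lemma alg_cramer n (M : T -> 'M[K]_n) i j :
  (forall i j, P (fun x => M x i j)) -> P (fun x => (\det (M x))^-1) ->
  P (fun x => cramer (M x) i j).
Proof.
move=> PM Pd.
have -> : (fun x => cramer (M x) i j) =
    (fun x => (\det (M x))^-1 * ((-1) ^+ (j + i) * \det (row' j (col' i (M x))))).
  by apply/funext => x; rewrite !mxE.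
apply: P_mul => //; apply: P_mul => //; apply: alg_det => k l.
have -> : (fun x => row' j (col' i (M x)) k l) =
    (fun x => M x (lift j k) (lift i l)) by apply/funext => x; rewrite !mxE.
exact: PM.
Qed.

End FunctionAlgebra.

Lemma cramerK (K : fieldType) n (A : 'M[K]_n) : \det A != 0 -> A *m cramer A = 1%:M.
Proof.
by move=> d; rewrite -scalemxAr mul_mx_adj -mul_scalar_mx -scalar_mxM mulVf.
Qed.

Lemma cramerVK (K : fieldType) n (A : 'M[K]_n) : \det A != 0 -> cramer A *m A = 1%:M.
Proof.
by move=> d; rewrite -scalemxAl mul_adj_mx -mul_scalar_mx -scalar_mxM mulVf.
Qed.

(** * The inverse function theorem *)

Section InverseFunction.
Variable R : realType.

Lemma rV_normP n (x : 'rV[R]_n) c : 0 <= c ->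
  (`|x| <= c) <-> (forall i, `|x 0 i| <= c).
Proof.
move=> c0; rewrite [`|x|]mx_normrE; split=> [|H].
  by move=> /bigmax_leP[_ H] i; exact: (H (0, i)).
by apply/bigmax_leP; split=> // -[i j] _ /=; rewrite ord1.
Qed.

Lemma derive_row n (f : 'rV[R]_n -> R) x v : differentiable f x ->
  'D_v f x = \sum_i v 0 i * 'D_(delta_mx 0 i) f x.
Proof.
move=> df; rewrite deriveE // [in LHS](rowE v) linear_sum /=.
by apply: eq_bigr => i _; rewrite linearZ /= deriveE.
Qed.

Lemma mulmxr_continuous m n (A : 'M[R]_(m, n)) : continuous (mulmxr A : 'rV_m -> 'rV_n).
Proof.
move=> x; apply: continuous_rV => i; rewrite /=.
have -> : (fun y : 'rV[R]_m => (y *m A) 0 i) = (fun y => \sum_j y 0 j * A j i).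
  by apply/funext => y; rewrite mxE.
apply: (@alg_sum _ _ (fun f : 'rV[R]_m -> R => {for x, continuous f})) => [c|f g|f g|j].
- exact: cst_continuous.
- by move=> cf cg; exact: (continuousD cf cg).
- by move=> cf cg; exact: (continuousM cf cg).
- apply: (@continuousM _ _ (fun y : 'rV[R]_m => y 0 j) (cst (A j i))).
    exact: coord_continuous.
  exact: cst_continuous.
Qed.

(** Joins the complete and the normed structure of row vectors in the single type that the Banach
    fixed point theorem expects. *)
Definition complete_rV n := HB.pack_for (completeNormedModType R) 'rV[R]_n
  (Complete.on 'rV[R]_n) (NormedModule.on 'rV[R]_n).

(** F x = w is the fixed point equation of x |-> w + (x - F x), and x - F x is 1/2-Lipschitz near 0
    because its differential vanishes at 0. The solution is Lipschitz in w, hence differentiable,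
    with the inverse matrix of DF at [S w] as differential; this formula raises the order of
    smoothness inductively. *)
Lemma local_inverse n (U : set 'rV[R]_n) (F : 'rV[R]_n -> 'rV[R]_n) :
  open U -> U 0 -> F 0 = 0 -> (forall i, Cinf U (fun x => F x 0 i)) ->
  (forall i j, 'D_(delta_mx 0 i) (fun x => F x 0 j) 0 = (i == j)%:R) ->
  exists (W : set 'rV[R]_n) (S : 'rV[R]_n -> 'rV[R]_n), [/\ open W, W 0, S 0 = 0,
    forall w, W w -> U (S w) /\ F (S w) = w &
    forall i, Cinf W (fun w => S w 0 i)].
Proof.
move=> oU U0 F0 cF DF0.
(* Entries of id - DF bounded by [e] give |v - D_v F| <= n e |v| <= |v| / 2; [n.+1] keeps the
   denominator nonzero when n = 0. *)
pose e : R := (2 * n.+1%:R)^-1.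
have e0 : 0 < e by rewrite invr_gt0 mulr_gt0.
pose DF i j (x : 'rV[R]_n) := 'D_(delta_mx 0 i) (fun x => F x 0 j) x.
have near_small : \forall x \near (0 : 'rV[R]_n),
    U x /\ forall i j, `|(i == j)%:R - DF i j x| <= e.
  have H0 : \forall x \near (0 : 'rV[R]_n), U x by apply: open_nbhs_nbhs.
  have H1 : \forall x \near (0 : 'rV[R]_n), forall ij : 'I_n * 'I_n,
      `|(ij.1 == ij.2)%:R - DF ij.1 ij.2 x| <= e.
    apply: (@filter_forall _ _ (fun ij x => `|(ij.1 == ij.2)%:R - DF ij.1 ij.2 x| <= e)
      (nbhs (0 : 'rV[R]_n)) _) => -[i j] /=.
    have cD : {for 0, continuous (DF i j)}.
      by apply: (@Cinf_continuous _ _ U) => //; apply: Cinf_derive; exact: cF.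
    have := (cvgrPdist_le (F := nbhs (0 : 'rV[R]_n)) (DF i j) (DF i j 0)).1 cD e e0.
    have -> : DF i j 0 = (i == j)%:R by exact: DF0.
    exact.
  by apply: filterS2 H0 H1 => x Ux Hx; split=> // i j; exact: (Hx (i, j)).
have [r0 r00 Hr0] := (nbhs_normP _ _).1 near_small.
pose r := r0 / 2.
have r_gt0 : 0 < r by rewrite divr_gt0.
have Hr (x : 'rV[R]_n) : `|x| <= r -> U x /\ forall i j, `|(i == j)%:R - DF i j x| <= e.
  move=> xr; apply: Hr0; rewrite /ball_ /= sub0r normrN.
  by apply: le_lt_trans xr _; rewrite ltr_pdivrMr // ltr_pMr // ltrDl.
have dFi (x : 'rV[R]_n) j : `|x| <= r -> differentiable (fun x => F x 0 j) x.
  by move=> /Hr[Ux _]; exact: Cinf_differentiable (cF j) Ux.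
have DFv (x v : 'rV[R]_n) j : `|x| <= r ->
    `|v 0 j - 'D_v (fun x => F x 0 j) x| <= `|v| / 2.
  move=> xr; rewrite derive_row; last exact: dFi.
  have -> : v 0 j = \sum_i v 0 i * (i == j)%:R.
    rewrite (bigD1 j) //= eqxx mulr1 big1 ?addr0 // => i /negbTE ->.
    by rewrite mulr0.
  rewrite -sumrB; apply: le_trans (ler_norm_sum _ _ _) _.
  apply: (@le_trans _ _ (\sum_(i < n) `|v| * e)).
    apply: ler_sum => i _; rewrite -mulrBr normrM ler_pM //.
      by have /(rV_normP v (normr_ge0 v)) := lexx `|v|.
    by have [_ /(_ i j)] := Hr x xr.
  rewrite sumr_const card_ord -[X in X <= _]mulr_natr -mulrA ler_wpM2l //.
  have n1 : n%:R <= n.+1%:R :> R by rewrite ler_nat.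
  have n0 : 0 < n.+1%:R :> R by [].
  rewrite /e mulrC ler_pdivrMr ?mulr_gt0 // mulrA mulVf // mul1r.
  exact: n1.
pose G (x : 'rV[R]_n) := x - F x.
have GL (x y : 'rV[R]_n) : `|x| <= r -> `|y| <= r -> `|G x - G y| <= `|x - y| / 2.
  move=> xr yr; apply/rV_normP; first by rewrite divr_ge0.
  move=> j.
  have seg t : 0 <= t <= 1 -> `|y + t *: (x - y)| <= r.
    move=> /andP[t0 t1].
    have -> : y + t *: (x - y) = (1 - t) *: y + t *: x.
      by apply/rowP => i; rewrite !mxE; ring.
    apply: le_trans (ler_normD _ _) _; rewrite !normrZ !ger0_norm ?subr_ge0 //.
    have -> : r = (1 - t) * r + t * r by rewrite -mulrDl subrK mul1r.
    by rewrite lerD // ler_wpM2l // subr_ge0.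
  have [t /seg /dFi|c /andP[c0 c1]] :=
    @MVT_line _ _ (fun x => F x 0 j) y (x - y) 1 ltr01; first exact.
  rewrite mul1r scale1r (addrC y (x - y)) subrK => E.
  have -> : (G x - G y) 0 j = (x - y) 0 j - (F x 0 j - F y 0 j).
    by rewrite !mxE; ring.
  by rewrite E; apply: DFv; apply: seg; rewrite !ltW.
have FL (x y : 'rV[R]_n) : `|x| <= r -> `|y| <= r -> `|x - y| <= 2 * `|F x - F y|.
  move=> xr yr; have := GL x y xr yr.
  move=> H.
  have := ler_normD (G x - G y) (F x - F y).
  have -> : (G x - G y) + (F x - F y) = x - y.
    by apply/rowP => i; rewrite !mxE; ring.
  by lra.
pose B := [set x : 'rV[R]_n | `|x| <= r].
have G0 : G 0 = 0 by rewrite /G F0 subrr.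
have B0 : B 0 by rewrite /B /= normr0 ltW.
have fixp (w : 'rV[R]_n) : `|w| < r / 2 -> exists2 x, B x & F x = w.
  move=> wr.
  have fB : {homo (fun x => w + G x) : x / B x >-> B x}.
    move=> x xr; rewrite /B /=; apply: le_trans (ler_normD _ _) _.
    have := GL x 0 xr B0; rewrite G0 !subr0 => Gx.
    rewrite /B /= in xr; lra.
  pose fun0 := isFun.Build _ _ B B (fun x => w + G x) fB.
  pose T : {fun B >-> B} := HB.pack (fun x => w + G x) fun0.
  have ctr : is_contraction T.
    exists (2^-1)%:nng; split; first by rewrite /= invf_lt1 // ltr1n.
    move=> [x y] [/= xr yr]; rewrite /T /= opprD addrACA subrr add0r mulrC.
    exact: GL.
  have clB : closed B.
    have -> : B = closed_ball (0 : 'rV[R]_n) r.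
      rewrite closed_ballE // /closed_ball_; apply/seteqP; split=> x /=;
        by rewrite sub0r normrN.
    exact: closed_ball_closed.
  have [x Bx Ex] :=
    @banach_fixed_point R (complete_rV n) B T ctr clB (ex_intro _ 0 B0).
  exists x => //; move: Ex; rewrite /T /= /G => /eqP.
  rewrite addrCA -subr_eq0 opprD addNKr oppr_eq0 subr_eq0.
  by move/eqP.
have [S HS] : exists S : 'rV[R]_n -> 'rV[R]_n, forall w, `|w| < r / 2 -> B (S w) /\ F (S w) = w.
  have /choice[S HS] : forall w : 'rV[R]_n, exists x : 'rV[R]_n, `|w| < r / 2 -> B x /\ F x = w.
    move=> w; case: (boolP (`|w| < r / 2)) => [/fixp[x Bx Fx]|_].
      by exists x.
    by exists 0.
  by exists S.
pose W := [set w : 'rV[R]_n | `|w| < r / 2].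
have oW : open W.
  apply: normP_open => w Ww; exists (r / 2 - `|w|); first by rewrite subr_gt0.
  move=> y yr; have := ler_normD w y; rewrite /W /=; lra.
have W0 : W 0 by rewrite /W /= normr0 divr_gt0.
have SL w w' : W w -> W w' -> `|S w - S w'| <= 2 * `|w - w'|.
  move=> /HS[Bw Fw] /HS[Bw' Fw']; rewrite -{2}Fw -{2}Fw'; exact: FL.
have S0 : S 0 = 0.
  have [BS0 FS0] := HS 0 W0.
  have := FL (S 0) 0 BS0 B0; rewrite FS0 F0 !subrr normr0 mulr0 subr0.
  by rewrite normr_le0 => /eqP.
have cS w : W w -> {for w, continuous S}.
  move=> Ww; apply: (lipschitz_continuous_at oW Ww (c := 2)) => // y Wy.
  exact: SL.
pose M (x : 'rV[R]_n) : 'M[R]_n := \matrix_(i, j) DF i j x.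
have ME (x h : 'rV[R]_n) : `|x| <= r -> h *m M x = \row_j 'D_h (fun x => F x 0 j) x.
  move=> xr; apply/rowP => j; rewrite !mxE derive_row; last exact: dFi.
  by apply: eq_bigr => i _; rewrite !mxE.
(* By [DFv] a vector in the kernel satisfies |h| <= |h| / 2. *)
have Mdet (x : 'rV[R]_n) : `|x| <= r -> \det (M x) != 0.
  move=> xr; rewrite -unitfE -[_ \is a GRing.unit]/(M x \in unitmx).
  rewrite -row_free_unit -kermx_eq0; apply/eqP/row_matrixP => i.
  set h := row i _; rewrite row0.
  have hM : h *m M x = 0 by rewrite /h -row_mul mulmx_ker row0.
  have : `|h| <= `|h| / 2.
    apply/rV_normP; first by rewrite divr_ge0.
    move=> j; have := DFv x h j xr.
    have -> : 'D_h (fun x => F x 0 j) x = 0.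
      by have := ME x h xr; rewrite hM => /rowP/(_ j); rewrite !mxE.
    by rewrite subr0.
  move=> hh; apply/eqP; rewrite -normr_le0.
  by have := normr_ge0 h; lra.
have dS (w v : 'rV[R]_n) : W w -> differentiable S w /\ 'd S w v = v *m cramer (M (S w)).
  move=> Ww; have [Bw Fw] := HS w Ww.
  set A := cramer _.
  have cA : continuous (mulmxr A : {linear 'rV[R]_n -> 'rV[R]_n}).
    exact: mulmxr_continuous.
  have dFS : differentiable F (S w) by apply: differentiable_rV => i; exact: dFi.
  have dFE h : 'd F (S w) h = h *m M (S w).
    apply/rowP => j; rewrite -(diff_coordE h j dFS) ME // mxE.
    by [].
    have FS y : W y -> F (S y) = y by move=> /HS[].
    have SLw y : W y -> `|S w - S y| <= 2 * `|w - y| by move=> Wy; exact: SL.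
    have AF h : mulmxr A ('d F (S w) h) = h.
      by rewrite dFE /= -mulmxA cramerK ?mulmx1 //; exact: Mdet.
    have [dSw dSE] := @diff_right_inverse _ _ F S W 2 w (mulmxr A) oW Ww FS
      (ltr0Sn R 1) SLw dFS cA AF.
    split; first exact: dSw.
    by rewrite dSE.
(* D_v S is v times Cramer's inverse evaluated at [S w], so order k of [S] gives order k of its
   derivatives. *)
have cinfS k : forall i, Ck k W (fun w => S w 0 i).
  elim: k => [|k IH] i.
    move=> w Ww; apply: (@continuous_comp _ _ _ S (fun x : 'rV[R]_n => x 0 i)).
      exact: cS.
    exact: coord_continuous.
  split=> [w Ww|v].
    apply: (@differentiable_comp _ _ _ _ S (fun x : 'rV[R]_n => x 0 i)).
      exact: (dS w 0 Ww).1.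
    exact: differentiable_coord.
  apply: (@Ck_eq _ k n W (fun w => \sum_j v 0 j * cramer (M (S w)) j i)) => //.
    move=> w Ww; have [dSw dSE] := dS w v Ww.
    by rewrite diff_coordE // dSE mxE.
  have aC : forall c, Ck k W (fun=> c) by move=> c; exact: Ck_cst.
  have aA : forall f g, Ck k W f -> Ck k W g -> Ck k W (fun x => f x + g x).
    by move=> f g; exact: Ck_add.
  have aM : forall f g, Ck k W f -> Ck k W g -> Ck k W (fun x => f x * g x).
    by move=> f g; exact: Ck_mul.
  apply: (alg_sum aC aA aM) => j.
  have cM a b : Ck k W (fun w => M (S w) a b).
    have -> : (fun w => M (S w) a b) = (fun w => DF a b (S w)).
      by apply/funext => w; rewrite mxE.
    apply: (@Ck_comp _ k n n W U S) => //.
      by move=> w /HS[/Hr[]].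
    by apply: Cinf_derive; exact: cF.
  apply: (aM (fun=> v 0 j) (fun w => cramer (M (S w)) j i)) => //.
  apply: (alg_cramer aC aA aM) => //.
  apply: Ck_inv => //; last exact: (alg_det aC aA aM).
  by move=> w /HS[Bw _]; exact: Mdet.
exists W, S; split=> //.
- by move=> w /HS[/Hr[]].
- by move=> i k; exact: cinfS.
Qed.

End InverseFunction.

(** * A smooth function that is flat at the origin *)

Section Bump.
Variable R : realType.

(* The family t^-n exp(-1/t) is closed under differentiation. *)
Definition flat (n : nat) (t : R) : R :=
  if 0 < t then t^-1 ^+ n * expR (- t^-1) else 0.

(** With s = 1/t and m = n + 2, s/m <= exp(s/m) gives s^m <= m^m exp(s). The two powers of s beyond
    n leave the factor t^2, which makes the derivative at 0 vanish. *)
Lemma flat_bound n : exists C, forall t, `|flat n t| <= C * t ^+ 2.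
Proof.
pose m := n.+2; exists (m%:R ^+ m) => t; rewrite /flat.
have m0 : 0 < m%:R :> R by rewrite ltr0n.
case: ifP => [t0|_]; last by rewrite normr0 mulr_ge0 ?sqr_ge0 // exprn_ge0 // ltW.
have s0 : 0 <= t^-1 by rewrite invr_ge0 ltW.
rewrite ger0_norm; last by rewrite mulr_ge0 ?exprn_ge0 // expR_ge0.
have H : t^-1 ^+ m * expR (- t^-1) <= m%:R ^+ m.
  have h1 : t^-1 / m%:R <= expR (t^-1 / m%:R).
    by apply: le_trans (expR_ge1Dx _); rewrite lerDr.
  have h2 : (t^-1 / m%:R) ^+ m <= expR (t^-1).
    have -> : expR t^-1 = expR (t^-1 / m%:R) ^+ m.
      by rewrite -expRM_natl mulrC divfK // gt_eqF.
    by rewrite lerXn2r // nnegrE ?expR_ge0 // divr_ge0 // ltW.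
  rewrite expRN ler_pdivrMr ?expR_gt0 //.
  by move: h2; rewrite expr_div_n ler_pdivrMr ?exprn_gt0 // mulrC.
have -> : t^-1 ^+ n = t^-1 ^+ m * t ^+ 2.
  by rewrite /m -addn2 exprD -mulrA -exprMn mulVf ?gt_eqF // expr1n mulr1.
by rewrite mulrAC ler_wpM2r // sqr_ge0.
Qed.

Lemma flat_is_derive n (t : R) :
  is_derive t 1 (flat n) (- n%:R * flat n.+1 t + flat n.+2 t).
Proof.
have [t0|t0|t0] := ltgtP t 0.
- have E : \forall s \near t, (cst 0 : R -> R) s = flat n s.
    apply: filterS (open_nbhs_nbhs (conj (@open_lt R 0) t0)) => s /= s0.
    by rewrite /flat ltNge (ltW s0).
  apply: (near_eq_is_derive E).
  have -> : - n%:R * flat n.+1 t + flat n.+2 t = 0.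
    by rewrite /flat ltNge (ltW t0) /= mulr0 addr0.
  exact: is_derive_cst.
- have E : \forall s \near t, s^-1 ^+ n * expR (- s^-1) = flat n s.
    apply: filterS (open_nbhs_nbhs (conj (@open_gt R 0) t0)) => s /= s0.
    by rewrite /flat s0.
  apply: (near_eq_is_derive E).
  have tn0 : t != 0 by rewrite gt_eqF.
  have dV : is_derive t 1 (fun s : R => s^-1) (- t ^- 2).
    have dd : derivable (@id R) t 1 by exact: derivable_id.
    split; first exact: (derivableV tn0 dd).
    by rewrite (deriveV tn0 dd) derive_id [_ *: _]mulr1.
  have dVn : is_derive t 1 (fun s : R => s^-1 ^+ n) (- n%:R * t^-1 ^+ n.+1).
    case: (n) => [|m].
      by rewrite oppr0 mul0r; exact: is_derive_cst.
    have -> : (fun s : R => s^-1 ^+ m.+1) = (fun s : R => s^-1) ^+ m.+1.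
      by apply/funext => s; rewrite exprfctE.
    apply: (is_derive_eq (is_deriveX m.+1 dV)).
    by rewrite -exprVn /= [LHS]mulrN mulNr -mulrA -exprD addn2.
  have dE : is_derive t 1 (fun s : R => expR (- s^-1)) (expR (- t^-1) * t^-1 ^+ 2).
    have dN : is_derive t 1 (fun s : R => - s^-1) (t^-1 ^+ 2).
      by apply: (is_derive_eq (is_deriveN dV)); rewrite opprK exprVn.
    exact: (@is_derive1_comp _ expR (fun s : R => - s^-1) t _ _ (is_derive_expR _) dN).
  apply: (is_derive_eq (is_deriveM dVn dE)).
  rewrite /flat t0 /GRing.scale /=.
  by rewrite !exprS; ring.
(* At t = 0 the bound C t^2 yields derivative 0, which is also the value of the right-hand side
   there. *)
- have fl m : flat m 0 = 0 by rewrite /flat ltxx.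
  rewrite t0 !fl mulr0 addr0.
  have [C HC] := flat_bound n.
  have c0 : continuous (\0 : {linear R -> R}) by move=> x; exact: cst_continuous.
  have [e e0|dF dE] := @is_diff_eps _ _ _ (flat n) \0 0 c0.
    apply/nbhs_normP; exists (e / (`|C| + 1)).
      by rewrite /= divr_gt0 // ltr_wpDl.
    move=> h; rewrite /ball_ /= sub0r normrN addr0 fl !subr0 => he.
    apply: le_trans (HC h) _; apply: le_trans (ler_norm _) _.
    rewrite normrM normrX expr2 mulrA ler_wpM2r //.
    move: he; rewrite ltr_pdivlMr ?ltr_wpDl // => /ltW he.
    by apply: le_trans he; rewrite mulrDr mulr1 mulrC lerDl.
  by split; [exact: diff_derivable|rewrite deriveE // dE].
Qed.

Lemma flat_Cinf n : Cinf [set: 'rV[R]_1] (fun x => flat n (x 0 0)).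
Proof.
have dfl m (x : 'rV[R]_1) : differentiable (fun x : 'rV[R]_1 => flat m (x 0 0)) x.
  apply: (@differentiable_comp _ _ _ _ (fun x : 'rV[R]_1 => x 0 0) (flat m)).
    exact: differentiable_coord.
  by apply/derivable1_diffP; have [] := flat_is_derive m (x 0 0).
move=> k; elim: k n => [|k IH] n.
  by move=> x _; exact: differentiable_continuous.
split=> [x _|v]; first exact: dfl.
apply: (@Ck_eq _ k 1 _ (fun x => v 0 0 * (- n%:R * flat n.+1 (x 0 0) + flat n.+2 (x 0 0)))).
- exact: openT.
- move=> x _; rewrite deriveE //.
  rewrite (@diff_comp _ _ _ _ (fun x : 'rV[R]_1 => x 0 0) (flat n)) /=.
  + have [dd <-] := flat_is_derive n (x 0 0).
    rewrite (@deriv1E _ _ (flat n)) // derive1E.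
    rewrite -(deriveE v (differentiable_coord x 0 0)).
    by rewrite (@diff_coordE _ _ _ id) // diff_val.
  + exact: differentiable_coord.
  + by apply/derivable1_diffP; have [] := flat_is_derive n (x 0 0).
- have oT := @openT 'rV[R]_1.
  have c c : Ck k [set: 'rV[R]_1] (fun=> c) by exact: Ck_cst.
  exact: (Ck_mul oT (c _) (Ck_add oT (Ck_mul oT (c _) (IH _)) (IH _))).
Qed.

End Bump.

(** * Quasi-inverses *)

Section JordanShift.
Variables (R : realType) (Z : vectType R[i]) (T : hermitian_jordan_triple Z).

(** Reduces an identity between vectors to linear arithmetic: after an arbitrary additive real
    functional the monomials are just real unknowns, and instances of the Jordan identity are
    combined by [lra]. *)
Lemma additive_sep (u v : Z) :
  (forall l : Z -> R, {morph l : a b / a + b} -> {morph l : a / - a} ->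
     l u = l v) -> u = v.
Proof.
move=> H; rewrite (coord_vbasis (memvf u)) (coord_vbasis (memvf v)).
apply: eq_bigr => i _; congr (_ *: _).
apply/eqP; rewrite eq_complex; apply/andP; split; apply/eqP.
  apply: (H (fun x => complex.Re (coord (vbasis {:Z}) i x))) => [a b|a].
    by rewrite !linearD.
  by rewrite !linearN.
apply: (H (fun x => complex.Im (coord (vbasis {:Z}) i x))) => [a b|a].
  by rewrite !linearD.
by rewrite !linearN.
Qed.

Lemma tpDr u v w w' : tp T u v (w + w') = tp T u v w + tp T u v w'.
Proof. by rewrite !(tpC T u); have := tpDl T 1 w w' v u; rewrite !scale1r. Qed.
Lemma tpDl' u u' v w : tp T (u + u') v w = tp T u v w + tp T u' v w.
Proof. by have := tpDl T 1 u u' v w; rewrite !scale1r. Qed.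
Lemma tpZr (a : R[i]) u v w : tp T u v (a *: w) = a *: tp T u v w.
Proof.
rewrite !(tpC T u); have := tpDl T a w 0 v u.
by rewrite addr0 (tpC T 0) tp0r addr0.
Qed.
Lemma tpZl (a : R[i]) u v w : tp T (a *: u) v w = a *: tp T u v w.
Proof. by rewrite tpC tpZr tpC. Qed.
Lemma tpDm' u v v' w : tp T u (v + v') w = tp T u v w + tp T u v' w.
Proof. by have := tpDm T 1 u v v' w; rewrite rmorph1 !scale1r. Qed.
Lemma tp0m u w : tp T u 0 w = 0.
Proof.
have := tpDm' u 0 0 w; rewrite addr0 => /eqP.
by rewrite -subr_eq0 opprD addNKr oppr_eq0 => /eqP.
Qed.
Lemma tpZm (a : R[i]) u v w : tp T u (a *: v) w = a^* *: tp T u v w.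
Proof. by have := tpDm T a u v 0 w; rewrite addr0 tp0m addr0. Qed.
Lemma tp0l v w : tp T 0 v w = 0. Proof. by rewrite tpC tp0r. Qed.
Lemma tpNr u v w : tp T u v (- w) = - tp T u v w.
Proof. by rewrite -scaleN1r tpZr scaleN1r. Qed.
Lemma tpNl u v w : tp T (- u) v w = - tp T u v w.
Proof. by rewrite -scaleN1r tpZl scaleN1r. Qed.
Lemma tpNm u v w : tp T u (- v) w = - tp T u v w.
Proof. by rewrite -scaleN1r tpZm rmorphN1 scaleN1r. Qed.

Definition tpE := (tpDr, tpDl', tpDm', tpNr, tpNl, tpNm).

(** The Jordan pair identity D(x,c) Q_x = Q_x D(c,x), where D(x,c) is the box operator; it is a
    combination of two instances of [tpJ]. *)
Lemma jordan_swap (x c u : Z) : tp T x c (tp T x u x) = tp T x (tp T c x u) x.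
Proof.
apply: additive_sep => l lD lN.
have := congr1 l (tpJ T x c x u x); have := congr1 l (tpJ T x u x c x).
rewrite !(lD, lN) (tpC T (tp T x u x) c x) (tpC T (tp T x c x) u x) (tpC T u x c).
lra.
Qed.

Lemma jordan_swap' (x c u : Z) : tp T x c (tp T x u x) = tp T x u (tp T x c x).
Proof. by rewrite !jordan_swap (tpC T c). Qed.

Section Homotope.
Variable y : Z.
Local Notation "a ⊛ b" := (tp T a y b) (at level 40, left associativity).

Lemma homotopeC a b : a ⊛ b = b ⊛ a. Proof. exact: tpC. Qed.

(** Eliminates Q_y in favour of the product {a y b} of the homotope algebra at [y], so that B(x,y)
    becomes a polynomial in multiplications of that algebra. *)
Lemma quadratic_homotope z u w : tp T z (tp T y u y) w = (u ⊛ z) ⊛ w + z ⊛ (u ⊛ w) - u ⊛ (z ⊛ w).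
Proof.
apply: additive_sep => l lD lN.
by have := congr1 l (tpJ T u y z y w); rewrite !(lD, lN); lra.
Qed.

(** The full linearization of x(x^2 w) = x^2(x w): the homotope is a Jordan algebra. *)
Lemma homotope_jordan u c z w :
  u ⊛ ((c ⊛ z) ⊛ w) + c ⊛ ((u ⊛ z) ⊛ w) + z ⊛ ((u ⊛ c) ⊛ w) =
  (c ⊛ z) ⊛ (u ⊛ w) + (u ⊛ z) ⊛ (c ⊛ w) + (u ⊛ c) ⊛ (z ⊛ w).
Proof.
have key a b : tp T (tp T y a y) b y = tp T y (b ⊛ a) y by rewrite tpC jordan_swap.
apply: additive_sep => l lD lN.
have := congr1 l (tpJ T u y z (tp T y c y) w).
have := congr1 l (tpJ T u y c (tp T y z y) w).
rewrite !key !quadratic_homotope !tpE !(lD, lN).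
rewrite (homotopeC z c) (homotopeC z (u ⊛ c)) (homotopeC c (u ⊛ z)).
lra.
Qed.

Lemma homotope_jordan' u c w z :
  u ⊛ (w ⊛ (c ⊛ z)) + c ⊛ (w ⊛ (u ⊛ z)) + (w ⊛ (u ⊛ c)) ⊛ z =
  (u ⊛ w) ⊛ (c ⊛ z) + (c ⊛ w) ⊛ (u ⊛ z) + (u ⊛ c) ⊛ (w ⊛ z).
Proof.
apply: additive_sep => l lD lN; have := congr1 l (homotope_jordan u c z w).
rewrite !(lD, lN) (homotopeC (c ⊛ z) w) (homotopeC (u ⊛ z) w) (homotopeC (w ⊛ (u ⊛ c)) z).
rewrite (homotopeC w (u ⊛ c)) (homotopeC (u ⊛ w) (c ⊛ z)) (homotopeC (c ⊛ w) (u ⊛ z)) (homotopeC w z).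
lra.
Qed.

Variable x : Z.
Local Notation X u := (x ⊛ u).
Local Notation x2 := (x ⊛ x).
Local Notation Y u := (x2 ⊛ u).

Lemma hx2x w : Y (X w) = X (Y w).
Proof.
apply: additive_sep => l lD lN; have := congr1 l (homotope_jordan x x x w).
by rewrite !(lD, lN); lra.
Qed.

(** The classical formula L(x^3) = 3 L(x^2) L(x) - 2 L(x)^3 for multiplication operators. Through
    it, commuting with L(x) and L(x^2) implies commuting with L(x^3). *)
Lemma hx3 w : (X x2) ⊛ w = Y (X w) + Y (X w) + Y (X w) - (X (X (X w)) + X (X (X w))).
Proof.
apply: additive_sep => l lD lN; have := congr1 l (homotope_jordan' x x x w).
by rewrite !(lD, lN); lra.
Qed.

Lemma hQx w : tp T x (tp T y w y) x = X (X w) + X (X w) - Y w.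
Proof. by rewrite quadratic_homotope (homotopeC w x) (homotopeC (X w) x) (homotopeC w x2). Qed.

(** The Bergman operator B(x,y) as a bare function; after the section the homotope element [y] is
    the first argument. The double is written as a sum so that additive functionals pass through
    it. *)
Definition B0 u := u - (X u + X u) + tp T x (tp T y u y) x.

(* In the homotope algebra at [y], the multiplication by [u] commutes with those
   by [x] and [x ^ 2]. The space of such [u] is stable under B(x,y), which is
   injective, so it contains the quasi-inverse. *)
Record stable (u : Z) : Prop := Stable {
  stX : forall w, X (u ⊛ w) = u ⊛ X w;
  stY : forall w, Y (u ⊛ w) = u ⊛ Y w;
  stQ : forall w, tp T x w (X u) = u ⊛ tp T x w x }.

Lemma stable_mul u w : stable u ->
  (Y u) ⊛ w = (X u) ⊛ (X w) + (X u) ⊛ (X w) + Y (u ⊛ w) - (X (u ⊛ X w) + X (u ⊛ X w)).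
Proof.
move=> su; apply: additive_sep => l lD lN; have := congr1 l (homotope_jordan' x x u w).
by rewrite !(lD, lN) (homotopeC u x2); lra.
Qed.

Lemma stable_x : stable x.
Proof.
split=> // w; first exact: hx2x.
by rewrite jordan_swap'.
Qed.

Lemma stable_X1 u : stable u -> forall w, X (X u ⊛ w) = X u ⊛ X w.
Proof.
move=> su w; apply: additive_sep => l lD lN; have := congr1 l (homotope_jordan x x u w).
rewrite !(lD, lN) (stY su) .
by lra.
Qed.

Lemma stable_Y1 u : stable u -> forall w, X (Y u ⊛ w) = Y u ⊛ X w.
Proof.
move=> su w; rewrite !(stable_mul _ su) !tpE (stable_X1 su) (stX su).
by rewrite -!(hx2x) (stX su) (stX su).
Qed.

Lemma stable_X u : stable u -> stable (X u).
Proof.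
move=> su; split=> w; first exact: stable_X1.
  have Hx3 : (X x2) ⊛ (u ⊛ w) = u ⊛ (X x2 ⊛ w).
    by rewrite !hx3 !tpE (stX su) (stY su) !(stX su).
  apply: additive_sep => l lD lN; have := congr1 l (homotope_jordan x2 x u w).
  by rewrite !(lD, lN) (stable_Y1 su) (homotopeC x2 x) Hx3; lra.
have sw w' : tp T x w' (X u) = u ⊛ tp T x w' x := stQ su w'.
apply: additive_sep => l lD lN.
have := congr1 l (tpJ T x w x y (X u)).
rewrite !(lD, lN) !sw -jordan_swap (stX su) (homotopeC (tp T x w x)).
by lra.
Qed.

Lemma stable_Y u : stable u -> stable (Y u).
Proof.
move=> su; have sXu := stable_X su; split=> w; first exact: stable_Y1.
  by rewrite !(stable_mul _ su) !tpE !(stY sXu) !hx2x !(stY su) !hx2x.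
have sw w' : tp T x w' (X u) = u ⊛ tp T x w' x := stQ su w'.
have sw2 w' : tp T x w' (X (X u)) = X u ⊛ tp T x w' x := stQ sXu w'.
rewrite -hx2x (stable_mul _ su).
pose w' := tp T y x w.
have Ek' : tp T x w' x = X (tp T x w x) by rewrite jordan_swap.
apply: additive_sep => l lD lN.
have := congr1 l (tpJ T x w x2 y (X u)).
have := congr1 l (tpJ T x y x w' (X u)).
have := congr1 l (tpJ T x w' x y (X u)).
rewrite -/w' !(lD, lN) !(sw w) !(sw w') !(sw2 w') !Ek' -/w'.
rewrite -(jordan_swap' x w y) (tpC T x w x2) (homotopeC _ (X u)) (tpC T w' x y).
by lra.
Qed.

Lemma stable_lin (a : R[i]) u v : stable u -> stable v -> stable (a *: u + v).
Proof.
move=> su sv; split=> w; rewrite !(tpDl', tpZl, tpDr, tpZr).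
- by rewrite (stX su) (stX sv).
- by rewrite (stY su) (stY sv).
- by rewrite (stQ su) (stQ sv).
Qed.

Lemma stable_B0 u : stable u -> stable (B0 u).
Proof.
move=> su; rewrite /B0 hQx.
have sX := stable_X su; have sXX := stable_X sX; have sY := stable_Y su.
have -> : u - (X u + X u) + (X (X u) + X (X u) - Y u) =
  (- 1) *: X u + ((-1) *: X u + (1 *: X (X u) + (1 *: X (X u) + ((-1) *: Y u + u)))).
  by apply: additive_sep => l lD lN; rewrite !scaleN1r !scale1r !(lD, lN); ring.
by do 5 (apply: stable_lin => //).
Qed.

End Homotope.

Lemma B0_linear y x : linear (B0 y x).
Proof.
move=> a v w; rewrite /B0 !(tpDr, tpDl', tpZr, tpDm', tpZm) conjCK.
apply: additive_sep => l lD lN.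
by rewrite !(scalerDr, scalerN) !(lD, lN); lra.
Qed.

Lemma bergmanE x y u : bergman T x y u = B0 y x u.
Proof.
pose f := GRing.isLinear.Build _ _ _ _ _ (@B0_linear y x).
pose g : {linear Z -> Z} := HB.pack (B0 y x) f.
have E : (fun v => v - 2%:R *: tp T x y v + tp T x (tp T y v y) x) = g.
  by apply/funext => v; rewrite /= /B0 scaler_nat mulr2n.
by rewrite /bergman E lfunE.
Qed.

Lemma end_mx_inj (h : 'End(Z)) : \det (end_mx h) <> 0 <-> lker h == 0%VS.
Proof.
have bZ := vbasisP {:Z}%VS.
rewrite (lker_ker bZ) -/(end_mx h) (vsof_eq0 bZ) kermx_eq0 row_free_unit.
by rewrite unitmxE unitfE; split=> [/eqP//|/eqP].
Qed.

Lemma end_mx_comp (g h : 'End(Z)) : end_mx (g \o h)%VF = end_mx h *m end_mx g.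
Proof. by apply: mxof_comp; exact: vbasisP. Qed.

(** An injective map of a finite-dimensional subspace into itself is onto. [S] is only a predicate,
    so the subspace is a [vspace] of largest dimension among those inside [S]; maximality forces it
    to contain all of [S]. *)
Lemma lin_closed_inv (S : Z -> Prop) (h : 'End(Z)) v : S 0 ->
  (forall a u w, S u -> S w -> S (a *: u + w)) -> lker h == 0%VS ->
  (forall u, S u -> S (h u)) -> S (h v) -> S v.
Proof.
move=> S0 Slin h0 Sh Shv.
pose P n := `[< exists2 W : {vspace Z}, (forall u, u \in W -> S u) & \dim W = n >].
have P0 : exists n, P n.
  exists 0%N; apply/asboolP; exists 0%VS; last exact: dimv0.
  by move=> u; rewrite memv0 => /eqP ->.
have Pb n : P n -> (n <= \dim {:Z})%N.
  by move=> /asboolP[W _ <-]; apply: dimvS; exact: subvf.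
case: (ex_maxnP P0 Pb) => n /asboolP[W WS dW] nmax.
have SW u : S u -> u \in W.
  move=> Su; apply/negPn/negP => uW.
  suff : (\dim (W + <[u]>) <= n)%N.
    rewrite -dW => H; have E : W = (W + <[u]>)%VS.
      by apply/eqP; rewrite eqEdim addvSl.
    by move: uW; rewrite E memvE addvSr.
  apply: nmax; apply/asboolP; exists (W + <[u]>)%VS => // w.
  move=> /memv_addP[w1 w1W [w2 /vlineP[a ->] ->]].
  by rewrite addrC; apply: Slin => //; exact: WS.
have hW : (h @: W)%VS = W.
  apply/eqP; rewrite eqEdim limg_dim_eq ?leqnn ?andbT; last first.
    by rewrite (eqP h0) capv0.
  by apply/subvP => _ /memv_imgP[u uW ->]; apply: SW; apply: Sh; exact: WS.
have := SW _ Shv; rewrite -{1}hW => /memv_imgP[w wW hvw].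
by rewrite (lker0P h0 _ _ hvw); exact: WS.
Qed.

Section Quasi.
Variables x y : Z.
Hypothesis Bxy : bergman_inv T x y.
Local Notation "a ⊛ b" := (tp T a y b) (at level 40, left associativity).
Local Notation X u := (x ⊛ u).
Let p := quasi_inverse T x y.
Let Bker : lker (bergman T x y) == 0%VS := (end_mx_inj _).1 Bxy.

Lemma bergman_quasi : B0 y x p = x - X x.
Proof. by rewrite -bergmanE /p /quasi_inverse lker0_lfunVK. Qed.

Lemma B0_inj u v : B0 y x u = B0 y x v -> u = v.
Proof. by rewrite -!bergmanE => /(lker0P Bker). Qed.

Lemma stable_quasi : stable y x p.
Proof.
apply: (lin_closed_inv (S := stable y x) _ _ Bker).
- by split=> w; rewrite !(tp0r, tp0l).
- by move=> a u w; exact: stable_lin.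
- by move=> u su; rewrite bergmanE; exact: stable_B0.
- rewrite bergmanE bergman_quasi -[x - _]addrC -scaleN1r.
  by apply: stable_lin; [apply: stable_X|]; exact: stable_x.
Qed.

(** In the homotope p is x(1 - x)^-1, so x p = p - x. The identity is verified after applying the
    injective B(x,y), which commutes with multiplication by x. *)
Lemma homotope_quasi : X p = p - x.
Proof.
have sp := stable_quasi.
apply: B0_inj.
have -> : B0 y x (X p) = X (B0 y x p).
  by rewrite /B0 !hQx !tpE !hx2x.
have -> : B0 y x (p - x) = B0 y x p - B0 y x x.
  by apply: additive_sep => l lD lN; rewrite /B0 !tpE !(lD, lN); lra.
rewrite bergman_quasi /B0 hQx !tpE.
rewrite (homotopeC y (X x) x).
apply: additive_sep => l lD lN; rewrite !(lD, lN); ring.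
Qed.

Lemma tp_quasi_homotope u : tp T u (tp T y p y) x = u ⊛ (p - x).
Proof.
rewrite (tpC T u) quadratic_homotope (homotopeC y p x) homotope_quasi (stX stable_quasi).
by rewrite addrK tpC.
Qed.

Lemma quadratic_quasi w : tp T x (tp T w p y) x = tp T x w p - tp T x w x.
Proof.
apply: additive_sep => l lD lN; have := congr1 l (tpJ T p y x w x).
have := congr1 l (stQ stable_quasi w).
rewrite homotope_quasi !tpE !(lD, lN) (homotopeC y p x) homotope_quasi !tpE !(lD, lN) (tpC T p w x) .
by lra.
Qed.

(** The central computation on quasi-inverses: seven consequences of the Jordan identity and of
    stability of p, combined linearly. It makes {u v p} accessible although p is defined by an
    inverse. *)
Lemma bergman_tp_quasi u v : B0 y x (tp T u v p) = tp T u v x - tp T x (tp T y u v) x.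
Proof.
apply: additive_sep => l lD lN.
have E1 := congr1 l (tpJ T u v x y p).
have E2 := congr1 l (tpJ T u v x (tp T y p y) x).
have E3 := congr1 l (congr1 (fun q => tp T x q x) (tpJ T v u y p y)).
have E4 := congr1 l (tp_quasi_homotope (tp T u v x)).
have E5 := congr1 l (quadratic_quasi (tp T y u v)).
have E6 := congr1 l (tpJ T u v x y x).
have E7 := congr1 l (congr1 (tp T u v) bergman_quasi).
move: E1 E2 E3 E4 E5 E6 E7.
rewrite /B0 !homotope_quasi.
rewrite !(tpE, lD, lN).
rewrite (tpC T x (tp T y p y) (tp T u v x)) (tpC T (tp T y p y) u v).
rewrite (tpC T v u y) (tpC T y p (tp T y u v)) (tpC T p v u).
rewrite (tpC T x y (tp T u v x)).
lra.
Qed.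

Lemma bergman_quasi_tp_quasi v : B0 y x (tp T p v p) = tp T x v x.
Proof. by rewrite bergman_tp_quasi (tpC T y p) quadratic_quasi (tpC T p v x) opprB addrC subrK. Qed.

(** The addition formula B(x,y) B(x^y,z) = B(x,y+z). It controls both the invertibility of Bergman
    operators under a change of chart and, through determinants, the growth of the coordinate. *)
Lemma bergman_shift z u : B0 y x (B0 z p u) = B0 (y + z) x u.
Proof.
have E1 : B0 y x (tp T p z u) = tp T x z u - tp T x (tp T y u z) x.
  by rewrite tpC bergman_tp_quasi (tpC T u) .
have E2 := bergman_quasi_tp_quasi (tp T z u z).
have -> : B0 y x (B0 z p u) = B0 y x u - (B0 y x (tp T p z u) + B0 y x (tp T p z u))
    + B0 y x (tp T p (tp T z u z) p).
  rewrite {2}/B0; apply: additive_sep => l lD lN.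
  by rewrite /B0 !tpE !(lD, lN); lra.
rewrite E1 E2 /B0 !tpE (tpC T z u y); apply: additive_sep => l lD lN.
by rewrite !(lD, lN); lra.
Qed.

Lemma bergman_comp z :
  (bergman T x y \o bergman T p z)%VF = bergman T x (y + z).
Proof. by apply/lfunP => u; rewrite comp_lfunE !bergmanE bergman_shift. Qed.

Lemma bergman_det z : \det (end_mx (bergman T x (y + z))) =
  \det (end_mx (bergman T p z)) * \det (end_mx (bergman T x y)).
Proof. by rewrite -bergman_comp end_mx_comp det_mulmx. Qed.

Lemma bergman_inv_shift z : bergman_inv T p z <-> bergman_inv T x (y + z).
Proof.
rewrite /bergman_inv bergman_det; split=> [H /eqP|H H'].
  rewrite mulf_eq0 => /orP[/eqP//|/eqP]; exact: Bxy.
by apply: H; rewrite H' mul0r.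
Qed.

(** (x^y)^z = x^(y+z), checked under the injective B(x,y+z): by the addition formula both sides
    become x - Q_x(y + z). *)
Lemma quasi_shift z : bergman_inv T p z ->
  quasi_inverse T p z = quasi_inverse T x (y + z).
Proof.
move=> Bpz; have Bxyz := (bergman_inv_shift z).1 Bpz.
have k1 := (end_mx_inj _).1 Bpz; have k2 := (end_mx_inj _).1 Bxyz.
apply: (lker0P k2); rewrite -bergman_comp comp_lfunE.
rewrite {1}/quasi_inverse lker0_lfunVK // bergman_comp lker0_lfunVK //.
rewrite bergmanE.
have -> : B0 y x (p - tp T p z p) = B0 y x p - B0 y x (tp T p z p).
  by apply: additive_sep => l lD lN; rewrite /B0 !tpE !(lD, lN); lra.
by rewrite bergman_quasi_tp_quasi bergman_quasi !tpE opprD addrA.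
Qed.

End Quasi.

Lemma bergman0r z : bergman T z 0 = \1%VF.
Proof.
apply/lfunP => u; rewrite id_lfunE bergmanE /B0.
by rewrite !(tp0m, tp0l, tp0r, addr0, subr0).
Qed.

Lemma bergman0l z : bergman T 0 z = \1%VF.
Proof.
apply/lfunP => u; rewrite id_lfunE bergmanE /B0.
by rewrite !(tp0m, tp0l, tp0r, addr0, subr0).
Qed.

Lemma det_id : \det (end_mx (\1%VF : 'End(Z))) = 1.
Proof. by rewrite /end_mx mxof1 ?det1 //; exact: basis_free (vbasisP _). Qed.

Lemma bergman_inv0r z : bergman_inv T z 0.
Proof. by rewrite /bergman_inv bergman0r det_id; apply/eqP/oner_neq0. Qed.

Lemma bergman_inv0l z : bergman_inv T 0 z.
Proof. by rewrite /bergman_inv bergman0l det_id; apply/eqP/oner_neq0. Qed.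

Lemma quasi0r z : quasi_inverse T z 0 = z.
Proof.
apply: (B0_inj (@bergman_inv0r z)).
rewrite bergman_quasi; last exact: bergman_inv0r.
by rewrite /B0 !(tp0m, tp0l, tp0r, addr0, subr0).
Qed.

Lemma quasi0l z : quasi_inverse T 0 z = 0.
Proof.
apply: (B0_inj (@bergman_inv0l z)).
rewrite bergman_quasi; last exact: bergman_inv0l.
by rewrite /B0 !(tp0m, tp0l, tp0r, addr0, subr0).
Qed.

(** A class [z,a] can be described from any of its members, because (z^y)^c = z^(y+c) and both sides
    are defined together. *)
Lemma dual_class_shift z a y : bergman_inv T z y ->
  dual_class T z a = dual_class T (quasi_inverse T z y) (a - y).
Proof.
move=> Bzy; apply/seteqP; split=> -[q c]; rewrite /dual_class /= => -[B1 Eq].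
  have E : a - c = y + (a - y - c) by apply: additive_sep => l lD lN; rewrite !(lD, lN); lra.
  rewrite E in B1; have B2 := (bergman_inv_shift Bzy _).2 B1.
  by split=> //; rewrite (quasi_shift Bzy) // -E.
have E : a - c = y + (a - y - c) by apply: additive_sep => l lD lN; rewrite !(lD, lN); lra.
rewrite E; split; first exact: (bergman_inv_shift Bzy _).1 B1.
by rewrite -(quasi_shift Bzy).
Qed.

Lemma mem_dual_class z a : dual_class T z a (z, a).
Proof.
by rewrite /dual_class /= subrr quasi0r; split=> //; exact: bergman_inv0r.
Qed.

Lemma dual_class_inj z z' a : dual_class T z a = dual_class T z' a -> z = z'.
Proof.
move=> E; have := mem_dual_class z a; rewrite E /dual_class /= subrr quasi0r.
by case.
Qed.

End JordanShift.

(** * Tangent vectors of spaces with plots *)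

Section Diffeology.
Variable R : realType.

Lemma open_preim m n (U : set 'rV[R]_m) (V : set 'rV[R]_n) (q : 'rV[R]_m -> 'rV[R]_n) :
  open U -> open V -> (forall i, Cinf U (fun x => q x 0 i)) ->
  open [set x | U x /\ V (q x)].
Proof.
move=> oU oV cq; rewrite openE => x [Ux Vx].
have cqx : {for x, continuous q}.
  by apply: continuous_rV => i; exact: Cinf_continuous (cq i) Ux.
have H1 : \forall y \near x, U y by exact: open_nbhs_nbhs.
have H2 : \forall y \near x, V (q y) by exact: (cqx _ (open_nbhs_nbhs (conj oV Vx))).
exact: filterS2 H1 H2.
Qed.

(** The properties of plots used from here on: they form a sheaf, are stable under smooth
    reparametrization and contain the constants. Plots are total functions, so [plot_eq] states that
    values off the domain do not matter. *)
Record diffeology (X : Type) (P : plots R X) : Prop := Diffeology {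
  plot_open : forall n U p, P n U p -> open U;
  plot_comp : forall n m U p W (q : 'rV[R]_m -> 'rV[R]_n), P n U p -> open W ->
    (forall i, Cinf W (fun x => q x 0 i)) -> (forall x, W x -> U (q x)) ->
    P m W (fun x => p (q x));
  plot_local : forall n U p, open U ->
    (forall x, U x -> exists2 W, W x & P n W p) -> P n U p;
  plot_eq : forall n U p p', P n U p -> (forall x, U x -> p x = p' x) -> P n U p';
  plot_cst : forall n (U : set 'rV[R]_n) x, open U -> P n U (fun=> x) }.

Lemma prod_diffeology (X Y : Type) (P : plots R X) (P' : plots R Y) :
  diffeology P -> diffeology P' -> diffeology (prod_plots P P').
Proof.
move=> dP dP'; split.
- by move=> n U p [/(plot_open dP)].
- by move=> n m U p W q [p1 p2] oW cq WU; split;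
    [exact: (plot_comp dP p1)|exact: (plot_comp dP' p2)].
- move=> n U p oU H; split; [apply: (plot_local dP) => //|apply: (plot_local dP') => //];
    by move=> x /H[W Wx [p1 p2]]; exists W.
- move=> n U p p' [p1 p2] E; split.
    by apply: (plot_eq dP p1) => x /E ->.
  by apply: (plot_eq dP' p2) => x /E ->.
- by move=> n U [x y] oU; split; [exact: (plot_cst dP)|exact: (plot_cst dP')].
Qed.

Lemma aplots_diffeology (V X : Type) (PV : plots R V) (A : set (chart V X)) :
  diffeology PV -> (forall x, exists c z, [/\ A c, c.1 z & c.2 z = x]) ->
  diffeology (aplots PV A).
Proof.
move=> dV cov; split.
- by move=> n U p [].
- move=> n m U p W q [oU H] oW cq WU; split=> // x Wx.
  have [c [W' [s [Ac oW' W'x ps Hs]]]] := H _ (WU _ Wx).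
  exists c, [set x | W x /\ W' (q x)], (fun x => s (q x)); split=> //.
  + exact: open_preim.
  + apply: (plot_comp dV ps) => [|i|y []//]; first exact: open_preim.
    by apply: (Cinf_sub (cq i)) => y [].
  + by move=> y [_ /Hs].
- move=> n U p oU H; split=> // x Ux; have [W Wx [oW HW]] := H x Ux.
  exact: HW.
- move=> n U p p' [oU H] E; split=> // x Ux.
  have [c [W [s [Ac oW Wx ps Hs]]]] := H x Ux.
  have oWU : open (W `&` U) by exact: openI.
  exists c, (W `&` U), s; split=> //.
    have cI i : Cinf (W `&` U) (fun x : 'rV_n => x 0 i) by exact: Cinf_coord.
    by apply: (plot_comp dV ps oWU cI) => y [].
  by move=> y [Wy Uy]; rewrite -E //; exact: Hs.
- move=> n U x oU; split=> // u Uu; have [c [z [Ac cz cE]]] := cov x.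
  by exists c, U, (fun=> z); split=> //; exact: (plot_cst dV).
Qed.

Section OneSpace.
Variables (X : Type) (P : plots R X).
Hypothesis dP : diffeology P.

Definition local_curve (c : R -> X) : Prop :=
  exists2 W : set 'rV[R]_1, W 0 & P W (fun x => c (x 0 0)).

Lemma smooth_curve_local c : smooth_curve P c -> local_curve c.
Proof. by move=> sc; exists setT. Qed.

Definition line1 (t : R) : 'rV[R]_1 := \row__ t.

Lemma line1_continuous : continuous line1.
Proof.
move=> t; apply: continuous_rV => i.
have -> : (fun y : R => line1 y 0 i) = (fun y : R => y) by apply/funext => y; rewrite mxE.
exact: cvg_id.
Qed.

Lemma local_curve_diff c phi : local_curve c -> smooth_fun P phi ->
  differentiable (fun x : 'rV[R]_1 => phi (c (x 0 0))) 0.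
Proof.
move=> [W W0 pW] sphi; exact: Cinf_differentiable (sphi _ _ _ pW) W0.
Qed.

Lemma local_curve_chain c phi (u : R -> R) du : local_curve c -> smooth_fun P phi ->
  u 0 = 0 -> is_derive (0 : R) (1 : R) u du ->
  is_derive (0 : R) (1 : R) (fun t : R => phi (c (u t)))
    ('D_(delta_mx 0 0) (fun x : 'rV[R]_1 => phi (c (x 0 0))) 0 * du).
Proof.
move=> lc sphi u0 hu; have df := local_curve_diff lc sphi.
have l0 : line1 (u 0) = 0 by apply/rowP => i; rewrite !mxE.
have := @derive1_chain _ _ (fun x : 'rV[R]_1 => phi (c (x 0 0)))
  (fun t => line1 (u t)) (fun=> du).
rewrite /= l0 big_ord1 => /(_ df) H.
have := H (fun i => _).
have -> : (fun t => phi (c (line1 (u t) 0 0))) = (fun t => phi (c (u t))).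
  by apply/funext => t; rewrite mxE.
apply => i.
by have -> : (fun t => line1 (u t) 0 i) = u by apply/funext => t; rewrite mxE.
Qed.

Lemma velocityE c phi : local_curve c -> smooth_fun P phi ->
  velocity P c phi = 'D_(delta_mx 0 0) (fun x : 'rV[R]_1 => phi (c (x 0 0))) 0.
Proof.
move=> lc sphi; rewrite /velocity; case: asboolP => // _; rewrite derive1E.
have [_ ->] := local_curve_chain lc sphi (erefl _) (is_derive_id (0 : R) (1 : R)).
by rewrite mulr1.
Qed.

Lemma velocity_is_derive c phi : local_curve c -> smooth_fun P phi ->
  is_derive (0 : R) (1 : R) (fun t : R => phi (c t)) (velocity P c phi).
Proof.
move=> lc sphi; rewrite velocityE //.
by have := local_curve_chain lc sphi (erefl _) (is_derive_id (0 : R) (1 : R)); rewrite mulr1.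
Qed.

(* Bounded by [r] and tangent to the identity at 0: turns a local curve into a
   global one with the same velocity. *)
Definition damp (r t : R) : R := t * (1 + (t / r) ^+ 2)^-1.

Lemma local_tangent c : local_curve c -> tangent P (c 0) (velocity P c).
Proof.
move=> [W W0 pW]; have oW := plot_open dP pW.
have [r r0 rW] := open_normP oW W0.
have den t : 1 + (t / r) ^+ 2 != 0 by rewrite gt_eqF // ltr_pwDl // sqr_ge0.
pose q (x : 'rV[R]_1) := line1 (damp r (x 0 0)).
have cq i : Cinf setT (fun x => q x 0 i).
  have oT := @openT 'rV[R]_1.
  have cc a : Cinf [set: 'rV[R]_1] (fun=> a) by exact: Cinf_cst.
  have c0 : Cinf [set: 'rV[R]_1] (fun x => x 0 0) by exact: Cinf_coord.
  have -> : (fun x => q x 0 i) = fun x => x 0 0 * (1 + (x 0 0 * r^-1) * (x 0 0 * r^-1))^-1.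
    by apply/funext => x; rewrite mxE /damp expr2.
  apply: (Cinf_mul oT c0); apply: (Cinf_inv oT).
    by move=> x _; rewrite -expr2; exact: den.
  have cr := Cinf_mul oT c0 (cc r^-1).
  exact: (Cinf_add oT (cc 1) (Cinf_mul oT cr cr)).
(* Amounts to |t| r < r^2 + t^2. *)
have small t : `|damp r t| < r.
  have hr : `|r| = r by rewrite ger0_norm // ltW.
  rewrite /damp normrM normfV ltr_pdivrMr ?normr_gt0 //.
  rewrite [`|1 + _|]ger0_norm; last by rewrite addr_ge0 // sqr_ge0.
  have -> : r * (1 + (t / r) ^+ 2) = (r ^+ 2 + t ^+ 2) / r by field; rewrite gt_eqF.
  rewrite ltr_pdivlMr // -(real_normK (num_real t)).
  have := sqr_ge0 `|t|; have := sqr_ge0 (`|t| - r); have : 0 < r ^+ 2 by rewrite exprn_gt0.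
  nra.
have qW x : setT x -> W (q x).
  move=> _; rewrite -(add0r (q x)); apply: rW.
  apply: le_lt_trans (small (x 0 0)); apply/rV_normP => // i.
  by rewrite mxE.
exists (fun t => c (damp r t)); split.
- have := plot_comp dP pW (@openT _) cq qW.
  by congr (P _ _); apply/funext => x; rewrite mxE.
- by rewrite /damp mul0r.
- apply/funext => phi; rewrite /velocity; case: ifP => // /asboolP sphi.
  have lc : local_curve c by exists W.
  have dd : is_derive (0 : R) (1 : R) (damp r) 1.
    have dg : derivable (fun t : R => (1 + (t / r) ^+ 2)^-1) 0 1.
      apply: derivableV; first exact: den.
      apply: derivableD; first exact: derivable_cst.
      have h1 : derivable (fun t : R => t / r) 0 1.
        have -> : (fun t : R => t / r) = r^-1 \*: id.
          by apply/funext => t; rewrite /= [RHS]mulrC.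
        exact/derivableZ/derivable_id.
      have -> : (fun t : R => (t / r) ^+ 2) = (fun t : R => t / r) * (fun t : R => t / r).
        by apply/funext => t; rewrite expr2.
      exact: (derivableM h1 h1).
    have H := is_deriveM (is_derive_id (0 : R) (1 : R)) (derivableP dg).
    have -> : damp r = (id : R -> R) * (fun t : R => (1 + (t / r) ^+ 2)^-1) by [].
    apply: (is_derive_eq H); rewrite scale0r add0r /=.
    by rewrite mul0r expr0n /= addr0 invr1 scale1r.
  rewrite !derive1E; have d0 : damp r 0 = 0 by rewrite /damp mul0r.
  have [_ ->] := local_curve_chain lc sphi d0 dd.
  by have [_ ->] := local_curve_chain lc sphi (erefl _) (is_derive_id (0 : R) (1 : R)).
Qed.

End OneSpace.

End Diffeology.

(** * Derivations along tangent vectors; functions of two variables *)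

Section TangentCalculus.
Variable R : realType.

Section SmoothFun.
Variables (X : Type) (P : plots R X).
Hypothesis dP : diffeology P.

Lemma smooth_add phi psi : smooth_fun P phi -> smooth_fun P psi ->
  smooth_fun P (fun x => phi x + psi x).
Proof. by move=> s t n U p pp; apply: Cinf_add (s _ _ _ pp) (t _ _ _ pp); exact: plot_open pp. Qed.

Lemma smooth_mul phi psi : smooth_fun P phi -> smooth_fun P psi ->
  smooth_fun P (fun x => phi x * psi x).
Proof. by move=> s t n U p pp; apply: Cinf_mul (s _ _ _ pp) (t _ _ _ pp); exact: plot_open pp. Qed.

Lemma smooth_cst k : smooth_fun P (fun=> k).
Proof. by move=> n U p pp; exact: Cinf_cst. Qed.

Lemma smooth_lin a phi psi : smooth_fun P phi -> smooth_fun P psi ->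
  smooth_fun P (fun x => a * phi x + psi x).
Proof. by move=> s t; apply: smooth_add t; apply: smooth_mul s; exact: smooth_cst. Qed.

Lemma smooth_sum I (r : seq I) (F : I -> X -> R) : (forall i, smooth_fun P (F i)) ->
  smooth_fun P (fun x => \sum_(i <- r) F i x).
Proof.
move=> H; apply: (alg_sum smooth_cst smooth_add smooth_mul); exact: H.
Qed.

Lemma tangent_is_derive x v : tangent P x v -> exists c, [/\ smooth_curve P c, c 0 = x &
  forall phi, smooth_fun P phi -> is_derive (0 : R) (1 : R) (fun t : R => phi (c t)) (v phi)].
Proof.
move=> [c [sc c0 ->]]; exists c; split=> // phi sphi.
by apply: velocity_is_derive => //; exact: smooth_curve_local.
Qed.

Lemma tangent0 x v phi : tangent P x v -> ~ smooth_fun P phi -> v phi = 0.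
Proof. by move=> [c [_ _ ->]] ns; rewrite /velocity asboolF. Qed.

Lemma tan_cst x v k : tangent P x v -> v (fun=> k) = 0.
Proof.
move=> /tangent_is_derive[c [_ _ /(_ _ (smooth_cst k))[_ <-]]].
by rewrite derive_cst.
Qed.

Lemma tan_lin x v a phi psi : tangent P x v -> smooth_fun P phi -> smooth_fun P psi ->
  v (fun x => a * phi x + psi x) = a * v phi + v psi.
Proof.
move=> /tangent_is_derive[c [_ _ H]] s t.
have [_ <-] := H _ (smooth_lin a s t); have H1 := H _ s; have H2 := H _ t.
have [_] := is_deriveD (is_deriveZ a H1) H2.
by [].
Qed.

Lemma tan_mul x v phi psi : tangent P x v -> smooth_fun P phi -> smooth_fun P psi ->
  v (fun x => phi x * psi x) = phi x * v psi + psi x * v phi.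
Proof.
move=> /tangent_is_derive[c [_ c0 H]] s t.
have [_ <-] := H _ (smooth_mul s t); have H1 := H _ s; have H2 := H _ t.
have [_] := is_deriveM H1 H2; rewrite -c0.
by [].
Qed.

Lemma tan_add x v phi psi : tangent P x v -> smooth_fun P phi -> smooth_fun P psi ->
  v (fun x => phi x + psi x) = v phi + v psi.
Proof.
move=> tv s t; rewrite -[v phi]mul1r -(tan_lin _ tv) //; congr (v _).
by apply/funext => z; rewrite mul1r.
Qed.

Lemma tan_scale x v a phi : tangent P x v -> smooth_fun P phi ->
  v (fun x => a * phi x) = a * v phi.
Proof.
move=> tv s; have := tan_lin a tv s (smooth_cst 0); rewrite (tan_cst _ tv) addr0 => <-.
by congr (v _); apply/funext => z; rewrite addr0.
Qed.

Lemma tan_sub x v phi psi : tangent P x v -> smooth_fun P phi -> smooth_fun P psi ->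
  v (fun x => phi x - psi x) = v phi - v psi.
Proof.
move=> tv s t; have := tan_lin (-1) tv t s; rewrite mulN1r addrC => <-.
by congr (v _); apply/funext => z; rewrite mulN1r addrC.
Qed.

Lemma tangent_vel c : smooth_curve P c -> tangent P (c 0) (velocity P c).
Proof. by move=> sc; exists c. Qed.

Lemma tangent_zero x : tangent P x (fun=> 0).
Proof.
exists (fun=> x); split=> //; first exact: (plot_cst dP _ (@openT _)).
apply/funext => phi; rewrite /velocity; case: ifP => // _.
by rewrite derive1_cst.
Qed.

End SmoothFun.

Section TwoSpaces.
Variables (X Y : Type) (P : plots R X) (P' : plots R Y).
Hypotheses (dP : diffeology P) (dP' : diffeology P').

Definition smooth2 (F : X -> Y -> R) : Prop :=
  smooth_fun (prod_plots P P') (fun z => F z.1 z.2).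

Lemma smooth2_left F y : smooth2 F -> smooth_fun P (fun x => F x y).
Proof.
move=> sF n U p pp; apply: (sF n U (fun x => (p x, y))); split=> //=.
exact: (plot_cst dP' _ (plot_open dP pp)).
Qed.

Lemma smooth2_right F x : smooth2 F -> smooth_fun P' (F x).
Proof.
move=> sF n U p pp; apply: (sF n U (fun y => (x, p y))); split=> //=.
exact: (plot_cst dP _ (plot_open dP' pp)).
Qed.

Lemma two_curves F c d : smooth2 F -> smooth_curve P c -> smooth_curve P' d ->
  Cinf setT (fun x : 'rV[R]_2 => F (c (x 0 0)) (d (x 0 1))).
Proof.
move=> sF sc sd; apply: (sF 2 setT (fun x => (c (x 0 0), d (x 0 1)))).
have q k i : Cinf setT (fun x : 'rV[R]_2 => line1 (x 0 k) 0 i).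
  have -> : (fun x : 'rV[R]_2 => line1 (x 0 k) 0 i) = (fun x => x 0 k).
    by apply/funext => x; rewrite mxE.
  exact: Cinf_coord.
split=> /=.
  have := plot_comp dP sc (@openT _) (q 0) (fun _ _ => I).
  by congr (P _ _); apply/funext => x; rewrite mxE.
have := plot_comp dP' sd (@openT _) (q 1) (fun _ _ => I).
by congr (P' _ _); apply/funext => x; rewrite mxE.
Qed.

Local Notation e0 := (delta_mx 0 0 : 'rV[R]_2).
Local Notation e1 := (delta_mx 0 1 : 'rV[R]_2).

(** The chain rule for the function (s,t) |-> F(c s)(d t) on the plane, taken along the diagonal. *)
Lemma tan_pair F c d : smooth2 F -> smooth_curve P c -> smooth_curve P' d ->
  derive1 (fun t => F (c t) (d t)) 0 =
  velocity P c (fun x => F x (d 0)) + velocity P' d (F (c 0)).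
Proof.
move=> sF sc sd; pose Phi (x : 'rV[R]_2) := F (c (x 0 0)) (d (x 0 1)).
have dPhi : differentiable Phi 0 := Cinf_differentiable (two_curves sF sc sd) I.
rewrite /velocity !asboolT; [|exact: smooth2_right|exact: smooth2_left].
have D v : derive1 (fun t => Phi (0 + t *: v)) 0 = 'D_v Phi 0 by exact: derive1_line.
have := D (e0 + e1); rewrite deriveE // linearD /= -!deriveE // -!D.
have E0 : (fun t => Phi (0 + t *: e0)) = (fun t => F (c t) (d 0)).
  by apply/funext => t; rewrite /Phi !mxE /= !add0r mulr1 mulr0.
have E1 : (fun t => Phi (0 + t *: e1)) = (fun t => F (c 0) (d t)).
  by apply/funext => t; rewrite /Phi !mxE /= !add0r mulr1 mulr0.
have E01 : (fun t => Phi (0 + t *: (e0 + e1))) = (fun t => F (c t) (d t)).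
  by apply/funext => t; rewrite /Phi !mxE /= !add0r ?addr0 !mulr1.
by rewrite E0 E1 E01.
Qed.

(** If p is a plot and c a curve representing v, then (x,t) |-> F(p x)(c t) is smooth with one more
    variable, and v(F(p x)) is its partial derivative in t at t = 0. *)
Lemma tan_param F y v : tangent P' y v -> smooth2 F -> smooth_fun P (fun x => v (F x)).
Proof.
move=> [c [sc c0 ->]] sF n U p pp; have oU := plot_open dP pp.
pose W := [set x : 'rV[R]_(n + 1) | U (lsubmx x)].
have cl i : Cinf [set: 'rV[R]_(n + 1)] (fun x => (lsubmx x : 'rV[R]_n) 0 i).
  have -> : (fun x : 'rV[R]_(n + 1) => (lsubmx x : 'rV[R]_n) 0 i) =
     (fun x => x 0 (lshift 1 i)) by apply/funext => x; rewrite mxE.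
  exact: Cinf_coord.
have oW : open W.
  have := open_preim (@openT _) oU cl; congr open.
  by apply/seteqP; split=> x // [].
have cr : forall i, Cinf W (fun x => (line1 (x 0 (rshift n 0))) 0 i).
  move=> i; have -> : (fun x : 'rV[R]_(n + 1) => line1 (x 0 (rshift n 0)) 0 i) =
     (fun x => x 0 (rshift n 0)) by apply/funext => x; rewrite mxE.
  exact: Cinf_coord.
have cl' i : Cinf W (fun x => (lsubmx x : 'rV[R]_n) 0 i) by exact: Cinf_sub (cl i) _.
have pp1 := plot_comp dP pp oW cl' (fun x Wx => Wx).
have pp2 := plot_comp dP' sc oW cr (fun x _ => I).
pose Phi (x : 'rV[R]_(n + 1)) := F (p (lsubmx x)) (c (x 0 (rshift n 0))).
have cPhi : Cinf W Phi.
  have := sF _ W (fun x => (p (lsubmx x), c (line1 (x 0 (rshift n 0)) 0 0))) (conj pp1 pp2).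
  by congr Cinf; apply/funext => x; rewrite /= mxE.
pose e : 'rV[R]_(n + 1) := delta_mx 0 (rshift n 0).
have key : Cinf U (fun x => 'D_e Phi (row_mx x 0)).
  apply: (Cinf_comp (p := fun x => row_mx x 0) oU _ _ (Cinf_derive e cPhi)).
    move=> i; case: (split_ordP i) => j ->.
      have -> : (fun y : 'rV[R]_n => (row_mx y 0 : 'rV[R]_(n + 1)) 0 (lshift 1 j)) = (fun y => y 0 j).
        by apply/funext => z; rewrite row_mxEl.
      exact: Cinf_coord.
    have -> : (fun y : 'rV[R]_n => (row_mx y 0 : 'rV[R]_(n + 1)) 0 (rshift n j)) = (fun y => 0).
      by apply/funext => z; rewrite row_mxEr mxE.
    exact: Cinf_cst.
  by move=> x Ux; rewrite /W /= row_mxKl.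
apply: (Cinf_eq oU _ key) => x Ux.
rewrite /velocity asboolT; last exact: smooth2_right.
have dPhi : differentiable Phi (row_mx x 0).
  by apply: (Cinf_differentiable cPhi); rewrite /W /= row_mxKl.
rewrite -(derive1_line e dPhi); congr (derive1 _ 0); apply/funext => t.
have El : lsubmx (row_mx x 0 + t *: e) = x.
  apply/rowP => j; rewrite [LHS]mxE [LHS]mxE row_mxEl [(t *: e) _ _]mxE.
  by rewrite [e _ _]mxE eq_lrshift andbF mulr0 addr0.
have Er : (row_mx x 0 + t *: e) 0 (rshift n 0) = t.
  rewrite [LHS]mxE row_mxEr [(t *: e) _ _]mxE [e _ _]mxE !eqxx mulr1.
  by rewrite mxE add0r.
by rewrite /Phi El Er.
Qed.

End TwoSpaces.

Section Swap.
Variables (X Y : Type) (P : plots R X) (P' : plots R Y).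
Hypotheses (dP : diffeology P) (dP' : diffeology P').
Local Notation e0 := (delta_mx 0 0 : 'rV[R]_2).
Local Notation e1 := (delta_mx 0 1 : 'rV[R]_2).

Lemma smooth2_swap F : smooth2 P P' F -> smooth2 P' P (fun y x => F x y).
Proof.
by move=> sF n U p [p1 p2]; exact: (sF n U (fun x => ((p x).2, (p x).1)) (conj p2 p1)).
Qed.

(** Both sides are mixed second derivatives at 0 of (a,b) |-> F(c a)(d b), so [schwarz] applies. *)
Lemma tan_swap F x y s t : tangent P x s -> tangent P' y t -> smooth2 P P' F ->
  s (fun x => t (F x)) = t (fun y => s (fun x => F x y)).
Proof.
move=> ts tt sF; have sm1 := tan_param dP dP' tt sF.
have sm2 := tan_param dP' dP ts (smooth2_swap sF).
move: ts tt sm1 sm2 => [c [sc c0 Es]] [d [sd d0 Et]] sm1 sm2.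
have cPhi := two_curves dP dP' sF sc sd.
set Phi := (fun _ => _) in cPhi.
have dPhi z : differentiable Phi z := Cinf_differentiable cPhi I.
have dD v z : differentiable ('D_v Phi) z := Cinf_differentiable (Cinf_derive v cPhi) I.
have A1 : s (fun x => t (F x)) = 'D_e0 ('D_e1 Phi) 0.
  rewrite Es /velocity asboolT; last exact: sm1.
  rewrite -(derive1_line e0 (dD e1 0)); congr (derive1 _ 0).
  apply/funext => a; rewrite Et /velocity asboolT; last exact: (smooth2_right dP dP').
  rewrite -(derive1_line e1 (dPhi _)); congr (derive1 _ 0).
  apply/funext => b; rewrite /Phi !mxE /=.
  by rewrite !mulr1 !mulr0 !add0r addr0.
have A2 : t (fun y => s (fun x => F x y)) = 'D_e1 ('D_e0 Phi) 0.
  rewrite Et /velocity asboolT; last exact: sm2.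
  rewrite -(derive1_line e1 (dD e0 0)); congr (derive1 _ 0).
  apply/funext => b; rewrite Es /velocity asboolT; last exact: (smooth2_left dP dP').
  rewrite -(derive1_line e0 (dPhi _)); congr (derive1 _ 0).
  apply/funext => a; rewrite /Phi !mxE /=.
  by rewrite !mulr1 !mulr0 !add0r addr0.
rewrite A1 A2; exact: (@schwarz _ _ setT _ _ _ _ (@openT _) I cPhi).
Qed.

End Swap.

End TangentCalculus.

(** * Lie groups *)

Section Reproducing.
Variables (R : realType) (S : Type).

(** Here [S] plays the role of a set of test functions on which the functionals of [C] are
    evaluated. A biorthogonal system of maximal size spans: a functional that it fails to reproduce
    would enlarge it. *)
Lemma dual_basis (C : (S -> R) -> Prop) N (F : 'I_N -> S -> R) :
  (forall a v w, C v -> C w -> C (fun s => a * v s + w s)) ->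
  (forall v, C v -> exists r : 'I_N -> R, forall s, v s = \sum_i r i * F i s) ->
  exists n (G : 'I_n -> S -> R) (t : 'I_n -> S),
    [/\ forall i, C (G i), forall i j, G i (t j) = (i == j)%:R &
        forall v, C v -> forall s, v s = \sum_j v (t j) * G j s].
Proof.
move=> Clin Cspan.
pose ok n := exists (G : 'I_n -> S -> R) (t : 'I_n -> S),
  (forall i, C (G i)) /\ (forall i j, G i (t j) = (i == j)%:R).
(* The identity matrix of size n factors through R^N, so n <= N by rank. *)
have bound n : ok n -> (n <= N)%N.
  move=> [G [t [CG Gt]]].
  have /choice[r Hr] : forall i, exists r : 'I_N -> R, forall s, G i s = \sum_k r k * F k s.
    by move=> i; exact: Cspan.
  pose A : 'M[R]_(n, N) := \matrix_(i, k) r i k.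
  pose B : 'M[R]_(N, n) := \matrix_(k, j) F k (t j).
  have AB : A *m B = 1%:M.
    by apply/matrixP => i j; rewrite !mxE -Gt Hr; apply: eq_bigr => k _; rewrite !mxE.
  have := mxrankM_maxl A B; rewrite AB mxrank1 => /leq_trans; apply.
  exact: rank_leq_col.
have ok0 : exists n, `[< ok n >].
  have f0 : 'I_0 -> S by case.
  by exists 0%N; apply/asboolP; exists (fun=> fun=> 0), f0; split; case.
have bnd n : `[< ok n >] -> (n <= N)%N by move=> /asboolP; exact: bound.
case: (ex_maxnP ok0 bnd) => n /asboolP[G [t [CG Gt]]] nmax.
exists n, G, t; split=> // v Cv s; apply/eqP; rewrite -subr_eq0; apply/negPn/negP => ns.
have Csum (k : nat) (c : 'I_k -> R) (H : 'I_k -> S -> R) w : C w -> (forall i, C (H i)) ->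
    C (fun s => \sum_j c j * H j s + w s).
  elim: k c H w => [|k IH] c H w Cw CH.
    by have -> : (fun s => \sum_(j < 0) c j * H j s + w s) = w
      by apply/funext => z; rewrite big_ord0 add0r.
  have -> : (fun s => \sum_j c j * H j s + w s) =
      (fun s => \sum_j c (lift ord0 j) * H (lift ord0 j) s + (c ord0 * H ord0 s + w s)).
    by apply/funext => z; rewrite big_ord_recl -addrA addrCA.
  by apply: IH => //; exact: Clin.
(* The part of [v] missed by the system: it vanishes at every [t j] but not at [s]. *)
pose w s := \sum_j (- v (t j)) * G j s + v s.
have Cw : C w by exact: Csum.
have ws : w s != 0.
  apply: contraNneq ns => ws0; apply/eqP; rewrite -[RHS]ws0 addrC.
  by congr (_ + _); rewrite -sumrN; apply: eq_bigr => j _; rewrite mulNr.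
have wt j : w (t j) = 0.
  rewrite /w (bigD1 j) //= Gt eqxx mulr1 big1 ?addr0 ?addNr // => i ij.
  by rewrite Gt (negbTE ij) mulr0.
pose w1 z := (w s)^-1 * w z + 0 * w z.
have Cw1 : C w1.
  have := Clin 0 w w Cw Cw => C0.
  have := Clin ((w s)^-1 - 1) w w Cw Cw; congr C; apply/funext => z.
  by rewrite /w1; ring.
have w1s : w1 s = 1 by rewrite /w1 mul0r addr0 mulVf.
have w1t j : w1 (t j) = 0 by rewrite /w1 wt !mulr0 addr0.
(* The old functionals are corrected by a multiple of [w1] so that they vanish at the new point [s];
   [w1] is the new functional. *)
pose G' (i : 'I_n.+1) := if unlift ord_max i is Some j
  then fun z => (- G j s) * w1 z + G j z else w1.
pose t' (i : 'I_n.+1) := if unlift ord_max i is Some j then t j else s.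
suff : ok n.+1 by move=> /asboolP /nmax; rewrite ltnn.
exists G', t'; split=> [i|i j]; rewrite /G' ?/t'.
  by case: unliftP => [j _|_] //; exact: Clin.
case: unliftP => [i' ->|->]; case: unliftP => [j' ->|->].
- by rewrite w1t mulr0 add0r Gt (inj_eq (@lift_inj _ _)).
- by rewrite w1s mulr1 addNr eq_sym (negbTE (neq_lift _ _)).
- by rewrite w1t (negbTE (neq_lift _ _)).
- by rewrite w1s eqxx.
Qed.

End Reproducing.

Section LieGroup.
Variables (R : realType) (G : groupType) (P : plots R G).
Hypotheses (dP : diffeology P)
  (mulS : smooth_map (prod_plots P P) P (fun x => (x.1 * x.2)%g))
  (invS : smooth_map P P (fun x => x^-1%g)).
Local Notation T1 := (tangent P 1%g).

Lemma smooth2_mul phi : smooth_fun P phi -> smooth2 P P (fun x y => phi (x * y)%g).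
Proof.
move=> s n U p pp; have := s _ _ _ (mulS pp (fun _ _ => I)).
exact.
Qed.

Lemma smooth_lmul phi g : smooth_fun P phi -> smooth_fun P (fun x => phi (g * x)%g).
Proof. by move=> s; exact: (smooth2_right dP dP g (smooth2_mul s)). Qed.

Lemma smooth_rmul phi g : smooth_fun P phi -> smooth_fun P (fun x => phi (x * g)%g).
Proof. by move=> s; exact: (smooth2_left dP dP g (smooth2_mul s)). Qed.

Lemma plot_mul n U p q : @P n U p -> @P n U q -> @P n U (fun x => (p x * q x)%g).
Proof. by move=> pp pq; exact: (@mulS n U (fun x => (p x, q x)) (conj pp pq) (fun _ _ => I)). Qed.

Lemma plot_inv n U p : @P n U p -> @P n U (fun x => (p x)^-1%g).
Proof. by move=> pp; exact: (@invS n U p pp (fun _ _ => I)). Qed.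

(** The curve u |-> c(a u) d(u) has velocity a s + t. The group product makes the tangent space
    linear with no recourse to charts. *)
Lemma T1_lin a s t : T1 s -> T1 t -> T1 (fun phi => a * s phi + t phi).
Proof.
move=> [c [sc c0 Es]] [d [sd d0 Et]].
have sca : smooth_curve P (fun u => c (a * u)).
  have := plot_comp dP sc (@openT _) (q := fun x => a *: x) _ (fun _ _ => I).
  have -> : (fun x : 'rV[R]_1 => c ((a *: x) 0 0)) = (fun x => c (a * x 0 0)).
    by apply/funext => x; rewrite mxE.
  apply=> i; have -> : (fun x : 'rV[R]_1 => (a *: x) 0 i) = (fun x => a * x 0 i).
    by apply/funext => x; rewrite mxE.
  by apply: (Cinf_mul (@openT _)); [exact: Cinf_cst|exact: Cinf_coord].
exists (fun u : R => (c (a * u)%R * d u)%g); split.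
- exact: plot_mul sca sd.
- by rewrite mulr0 c0 d0 mulg1.
- apply/funext => phi; rewrite [RHS]/velocity; case: asboolP => sphi; last first.
    by rewrite Es Et /velocity asboolF // mulr0 addr0.
  rewrite (tan_pair dP dP (smooth2_mul sphi) sca sd) mulr0 c0 d0.
  have -> : (fun x => phi (x * 1)%g) = phi by apply/funext => x; rewrite mulg1.
  have -> : (fun x => phi (1 * x)%g) = phi by apply/funext => x; rewrite mul1g.
  rewrite -Et; congr (_ + _).
  have da : is_derive (0 : R) (1 : R) (fun t : R => a * t) a.
    have H := is_deriveZ a (is_derive_id (0 : R) (1 : R)).
    by apply: (is_derive_eq H); rewrite [LHS]mulr1.
  have lc := smooth_curve_local sc.
  rewrite Es velocityE // /velocity asboolT // derive1E.
  by have [_ ->] := local_curve_chain lc sphi (mulr0 a) da; rewrite mulrC.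
Qed.

Lemma tan_diag (F : G -> G -> R) x s : tangent P x s -> smooth2 P P F ->
  s (fun y => F y y) = s (fun y => F y x) + s (F x).
Proof.
move=> [c [sc c0 ->]] sF; have := tan_pair dP dP sF sc sc; rewrite c0 => <-.
have sd : smooth_fun P (fun y => F y y).
  by move=> n U p pp; exact: (sF n U (fun x => (p x, p x)) (conj pp pp)).
by rewrite /velocity asboolT.
Qed.

(** Differentiate the constant function y |-> phi(y y^-1) along the diagonal. *)
Lemma tan_inv s phi : T1 s -> smooth_fun P phi -> s (fun x => phi x^-1%g) = - s phi.
Proof.
move=> ts sphi.
have sF : smooth2 P P (fun x y => phi (x * y^-1)%g).
  move=> n U p [p1 p2]; have := plot_mul p1 (plot_inv p2).
  exact: sphi.
have := tan_diag ts sF; rewrite invg1.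
have -> : (fun y => phi (y * y^-1)%g) = (fun=> phi 1%g).
  by apply/funext => y; rewrite mulgV.
have -> : (fun y => phi (y * 1)%g) = phi by apply/funext => y; rewrite mulg1.
have -> : (fun y => phi (1 * y^-1)%g) = (fun y => phi y^-1%g) by apply/funext => y; rewrite mul1g.
by rewrite (tan_cst _ ts) => /eqP; rewrite eq_sym addrC addr_eq0 => /eqP.
Qed.

Lemma lie_bracketE s t phi : T1 s -> T1 t -> smooth_fun P phi ->
  lie_bracket P s t phi = s (fun y => t (fun x => phi (y * x)%g)) -
                          t (fun y => s (fun x => phi (y * x)%g)).
Proof.
move=> ts tt sphi; rewrite /lie_bracket /field_bracket asboolT // /differential.
have E (w : (G -> R) -> R) : (fun y => if `[< smooth_fun P phi >] then w (fun x => phi (y * x)%g) else 0)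
   = (fun y => w (fun x => phi (y * x)%g)) by rewrite asboolT.
have sm := smooth2_mul sphi.
have sms : smooth_fun P (fun y => s (fun x => phi (y * x)%g)) := tan_param dP dP ts sm.
have smt : smooth_fun P (fun y => t (fun x => phi (y * x)%g)) := tan_param dP dP tt sm.
rewrite !E !asboolT //.
by congr (s _ - t _); apply/funext => y; rewrite mul1g.
Qed.

Lemma AdE h s phi : smooth_fun P phi -> Ad P h s phi = s (fun x => phi (h * x * h^-1)%g).
Proof. by move=> sphi; rewrite /Ad /differential asboolT. Qed.

Lemma T1_Ad h s : T1 s -> T1 (Ad P h s).
Proof.
move=> [c [sc c0 ->]]; exists (fun t => h * c t * h^-1)%g.
have cs g : @P 1 setT (fun=> g) by exact: (plot_cst dP g (@openT _)).
split.
- exact: (plot_mul (plot_mul (cs h) sc) (cs h^-1%g)).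
- by rewrite c0 mulg1 mulgV.
- apply/funext => phi; rewrite /Ad /differential /velocity; case: asboolP => // sphi.
  rewrite asboolT //; have := smooth_lmul h (smooth_rmul h^-1%g sphi).
  exact.
Qed.

Lemma smooth2_conj phi : smooth_fun P phi ->
  smooth2 P P (fun h x => phi (h * x * h^-1)%g).
Proof.
move=> s n U p [p1 p2]; exact: s (plot_mul (plot_mul p1 p2) (plot_inv p1)).
Qed.

(** After exchanging the two derivations, the derivative of h x h^-1 in h splits into the left
    factor and the inverse on the right, and [tan_inv] turns the latter into the negative term of
    the commutator. *)
Lemma lie_Ad s t phi : T1 s -> T1 t -> smooth_fun P phi ->
  s (fun h => Ad P h t phi) = lie_bracket P s t phi.
Proof.
move=> ts tt sphi.
have -> : (fun h => Ad P h t phi) = (fun h => t (fun x => phi (h * x * h^-1)%g)).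
  by apply/funext => h; rewrite AdE.
rewrite (tan_swap dP dP ts tt (smooth2_conj sphi)) lie_bracketE //.
have inner x : s (fun h => phi (h * x * h^-1)%g) =
    s (fun h => phi (h * x)%g) - s (fun h => phi (x * h)%g).
  have sF : smooth2 P P (fun h k => phi (h * x * k^-1)%g).
    move=> n U p [p1 p2]; have cx := plot_cst dP x (plot_open dP p1).
    exact: sphi (plot_mul (plot_mul p1 cx) (plot_inv p2)).
  rewrite (tan_diag ts sF) invg1; congr (_ + _).
    by congr s; apply/funext => h; rewrite mulg1.
  rewrite -(tan_inv ts (smooth_lmul x sphi)).
  by congr s; apply/funext => h; rewrite mul1g.
have -> : (fun x => s (fun h => phi (h * x * h^-1)%g)) =
   (fun x => s (fun h => phi (h * x)%g) - s (fun h => phi (x * h)%g)).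
  by apply/funext => x; exact: inner.
have sm2 := smooth2_mul sphi.
rewrite (tan_sub dP tt); first 1 last.
- exact: (tan_param dP dP ts (smooth2_swap sm2)).
- exact: (tan_param dP dP ts sm2).
by rewrite (tan_swap dP dP ts tt sm2).
Qed.

Lemma lie_bracket0 s t phi : ~ smooth_fun P phi -> lie_bracket P s t phi = 0.
Proof. by move=> ns; rewrite /lie_bracket /field_bracket asboolF. Qed.

Lemma lie_antisym s t phi : T1 s -> T1 t ->
  lie_bracket P s t phi = - lie_bracket P t s phi.
Proof.
move=> ts tt; have [sphi|ns] := pselect (smooth_fun P phi).
  by rewrite !lie_bracketE // opprB.
by rewrite !lie_bracket0 // oppr0.
Qed.

(** Right invariant fields have the opposite bracket. The vectors beta h in the frame of [Q] are of
    this kind. *)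
Lemma lie_right s t phi : T1 s -> T1 t -> smooth_fun P phi ->
  s (fun x => t (fun y => phi (y * x)%g)) - t (fun y => s (fun x => phi (x * y)%g)) =
  - lie_bracket P s t phi.
Proof.
move=> ts tt sphi; have sm := smooth2_mul sphi.
by rewrite lie_bracketE // (tan_swap dP dP ts tt sm) (tan_swap dP dP ts tt (smooth2_swap sm)) opprB.
Qed.

Variables (N : nat) (F : 'I_N -> (G -> R) -> R).
Hypothesis T1_span : forall v, T1 v -> exists r : 'I_N -> R, forall s, v s = \sum_i r i * F i s.

Lemma T1_dual : exists n (B : 'I_n -> (G -> R) -> R) (t : 'I_n -> G -> R),
  [/\ forall i, T1 (B i), forall i, smooth_fun P (t i),
      forall i j, B i (t j) = (i == j)%:R &
      forall v, T1 v -> forall phi, v phi = \sum_j v (t j) * B j phi].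
Proof.
have [n [B [t [TB Bt Brep]]]] := dual_basis T1_lin T1_span.
exists n, B, t; split=> // i.
(* Tangent vectors are 0 on functions that are not smooth, whereas [B i] is 1 on [t i]. *)
apply/not_notP => ns; have := Bt i i; rewrite (tangent0 (TB i) ns) eqxx => /eqP.
by rewrite eq_sym oner_eq0.
Qed.

Lemma T1_sum n (c : 'I_n -> R) (B : 'I_n -> (G -> R) -> R) : (forall i, T1 (B i)) ->
  T1 (fun phi => \sum_j c j * B j phi).
Proof.
elim: n c B => [|n IH] c B TB.
  have -> : (fun phi => \sum_(j < 0) c j * B j phi) = (fun=> 0).
    by apply/funext => phi; rewrite big_ord0.
  exact: tangent_zero.
have -> : (fun phi => \sum_j c j * B j phi) =
    (fun phi => c ord0 * B ord0 phi + \sum_j c (lift ord0 j) * B (lift ord0 j) phi).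
  by apply/funext => phi; rewrite big_ord_recl.
by apply: T1_lin => //; exact: IH.
Qed.

Lemma Ad_coeff_smooth t phi : T1 t -> smooth_fun P phi -> smooth_fun P (fun h => Ad P h t phi).
Proof.
move=> tt sphi.
have -> : (fun h => Ad P h t phi) = (fun h => t (fun x => phi (h * x * h^-1)%g)).
  by apply/funext => h; rewrite AdE.
exact: (tan_param dP dP tt (smooth2_conj sphi)).
Qed.

Lemma tan_sum x v n (c : 'I_n -> R) (f : 'I_n -> G -> R) : tangent P x v ->
  (forall i, smooth_fun P (f i)) ->
  v (fun h => \sum_j c j * f j h) = \sum_j c j * v (f j).
Proof.
move=> tv; elim: n c f => [|n IH] c f sf.
  have -> : (fun h => \sum_(j < 0) c j * f j h) = (fun=> 0).
    by apply/funext => phi; rewrite big_ord0.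
  by rewrite big_ord0 (tan_cst _ tv).
rewrite big_ord_recl -(IH _ (fun j => f (lift ord0 j))) //.
rewrite -(tan_lin dP _ tv) //.
  by congr v; apply/funext => h; rewrite big_ord_recl.
apply: smooth_sum => // i; apply: smooth_mul => //; exact: smooth_cst.
Qed.

(* The bracket [lie s t] is the derivative of [Ad h t] along [s], so an
   [Ad]-equivariant real-linear map passes through it. *)
Lemma lie_linear_of_Ad (I : ((G -> R) -> R) -> (G -> R) -> R) s t :
  (forall v, T1 v -> T1 (I v)) ->
  (forall a v w, T1 v -> T1 w -> I (fun phi => a * v phi + w phi) =
     (fun phi => a * I v phi + I w phi)) ->
  (forall h v, T1 v -> I (Ad P h v) = Ad P h (I v)) ->
  T1 s -> T1 t ->
  T1 (lie_bracket P s t) /\ lie_bracket P s (I t) = I (lie_bracket P s t).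
Proof.
move=> TI Ilin IAd ts tt.
have [n [B [p [TB sp Bp Brep]]]] := T1_dual.
have I0 : I (fun=> 0) = (fun=> 0).
  have := Ilin (-1) _ _ (tangent_zero dP 1%g) (tangent_zero dP 1%g).
  have -> : (fun phi : G -> R => -1 * 0 + 0 : R) = (fun=> 0).
    by apply/funext => phi; rewrite mulr0 addr0.
  by move=> E; apply/funext => phi; have := congr1 (fun f => f phi) E; rewrite mulN1r addNr.
have Isum k (c : 'I_k -> R) (H : 'I_k -> (G -> R) -> R) : (forall i, T1 (H i)) ->
    I (fun phi => \sum_j c j * H j phi) = (fun phi => \sum_j c j * I (H j) phi).
  elim: k c H => [|k IH] c H TH.
    have E (f : 'I_0 -> (G -> R) -> R) : (fun phi => \sum_(j < 0) c j * f j phi) = (fun=> 0).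
      by apply/funext => phi; rewrite big_ord0.
    by rewrite !E.
  have E (f : 'I_k.+1 -> (G -> R) -> R) : (fun phi => \sum_j c j * f j phi) =
    (fun phi => c ord0 * f ord0 phi + \sum_j c (lift ord0 j) * f (lift ord0 j) phi).
    by apply/funext => phi; rewrite big_ord_recl.
  rewrite !E Ilin //; last exact: T1_sum.
  by rewrite (IH _ (fun j => H (lift ord0 j))).
have expand v : T1 v -> v = (fun phi => \sum_j v (p j) * B j phi).
  by move=> tv; apply/funext => phi; exact: Brep.
have lieE v : T1 v -> (forall phi, smooth_fun P phi ->
    lie_bracket P s v phi = \sum_j lie_bracket P s v (p j) * B j phi).
  move=> tv phi sphi; rewrite -lie_Ad //.
  have -> : (fun h => Ad P h v phi) = (fun h => \sum_j B j phi * Ad P h v (p j)).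
    apply/funext => h; rewrite (Brep _ (T1_Ad h tv)).
    by apply: eq_bigr => j _; rewrite mulrC.
  rewrite (tan_sum _ ts); last by move=> j; exact: Ad_coeff_smooth.
  by apply: eq_bigr => j _; rewrite lie_Ad // mulrC.
have lieEE v : T1 v -> lie_bracket P s v = (fun phi => \sum_j lie_bracket P s v (p j) * B j phi).
  move=> tv; apply/funext => phi; have [sphi|ns] := pselect (smooth_fun P phi).
    exact: lieE.
  rewrite lie_bracket0 // big1 // => j _.
  by rewrite (tangent0 (TB j) ns) mulr0.
split; first by rewrite lieEE //; exact: T1_sum.
rewrite [in RHS]lieEE // Isum //.
apply/funext => phi; have [sphi|ns] := pselect (smooth_fun P phi); last first.
  rewrite lie_bracket0 // big1 // => j _.
  by rewrite (tangent0 (TI _ (TB j)) ns) mulr0.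
rewrite -lie_Ad //; last exact: TI.
(* Equivariance puts [I] on the fixed basis vectors; only the scalar coefficients of Ad(h) t are
   then differentiated. *)
have -> : (fun h => Ad P h (I t) phi) = (fun h => \sum_j I (B j) phi * Ad P h t (p j)).
  apply/funext => h; rewrite -IAd // {1}(expand _ (T1_Ad h tt)) Isum //.
  by apply: eq_bigr => j _; rewrite mulrC.
rewrite (tan_sum _ ts); last by move=> j; exact: Ad_coeff_smooth.
by apply: eq_bigr => j _; rewrite lie_Ad // mulrC.
Qed.

(** The case [I] = id: the bracket is a combination of basis vectors of the tangent space, which is
    not evident from its definition as a commutator. *)
Lemma T1_lie s t : T1 s -> T1 t -> T1 (lie_bracket P s t).
Proof. by move=> ts tt; have [] := @lie_linear_of_Ad id s t. Qed.

End LieGroup.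

(** * Coordinates and charts *)

Section ComplexCoordinates.
Variables (R : realType) (V : vectType R[i]).
Local Notation n := (\dim {:V}).
Local Notation b := (vbasis {:V}).

Definition cto (z : V) : 'rV[R]_(n + n) :=
  row_mx (\row_i complex.Re (coord b i z)) (\row_i complex.Im (coord b i z)).
Definition cof (w : 'rV[R]_(n + n)) : V :=
  \sum_i (w 0 (lshift n i) +i* w 0 (rshift n i)) *: b`_i.

Lemma coord_cof w i : coord b i (cof w) = (w 0 (lshift n i) +i* w 0 (rshift n i)).
Proof. by rewrite /cof coord_sum_free // (basis_free (vbasisP _)). Qed.

Lemma cofK : cancel cof cto.
Proof.
move=> w; apply/rowP => j; rewrite /cto; case: (split_ordP j) => i ->.
  by rewrite row_mxEl mxE coord_cof.
by rewrite row_mxEr mxE coord_cof.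
Qed.

Lemma ctoK : cancel cto cof.
Proof.
move=> z; rewrite [RHS](coord_vbasis (memvf z)) /cof; apply: eq_bigr => i _.
rewrite /cto row_mxEl row_mxEr !mxE; congr (_ *: _).
by case: (coord _ _ _).
Qed.

Lemma Re_coord i z : complex.Re (coord b i z) = cto z 0 (lshift n i).
Proof. by rewrite /cto row_mxEl mxE. Qed.
Lemma Im_coord i z : complex.Im (coord b i z) = cto z 0 (rshift n i).
Proof. by rewrite /cto row_mxEr mxE. Qed.

Lemma cto_lin (t : R) z u : cto (z + t%:C *: u) = cto z + t *: cto u.
Proof.
apply/rowP => j; rewrite [RHS]mxE [X in _ = _ + X]mxE.
case: (split_ordP j) => i ->.
  rewrite -!Re_coord linearD linearZ /=.
  by case: (coord _ _ z) => ??; case: (coord _ _ u) => ??; rewrite /= mul0r subr0.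
rewrite -!Im_coord linearD linearZ /=.
by case: (coord _ _ z) => ??; case: (coord _ _ u) => ??; rewrite /= mul0r addr0.
Qed.

Lemma cto0 : cto 0 = 0.
Proof.
apply/rowP => j; rewrite [RHS]mxE; case: (split_ordP j) => i ->.
  by rewrite -Re_coord linear0.
by rewrite -Im_coord linear0.
Qed.

Lemma cof_lin t w v : cof (w + t *: v) = cof w + t%:C *: cof v.
Proof. by apply: (can_inj ctoK); rewrite cto_lin !cofK. Qed.

Lemma Re_sum I (r : seq I) (F : I -> R[i]) :
  complex.Re (\sum_(i <- r) F i) = \sum_(i <- r) complex.Re (F i).
Proof. by elim/big_rec2: _ => //= i x y _ <-; case: (F i) => ??; case: y. Qed.

Lemma Re_mul (x y : R[i]) : complex.Re (x * y) =
  complex.Re x * complex.Re y - complex.Im x * complex.Im y.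
Proof. by case: x => ??; case: y. Qed.

Lemma Im_mul (x y : R[i]) : complex.Im (x * y) =
  complex.Re x * complex.Im y + complex.Im x * complex.Re y.
Proof. by case: x => a c; case: y => d e /=. Qed.

Lemma Re_linear_cto (l : {linear V -> R[i]^o}) z : complex.Re (l z) =
  \sum_i (cto z 0 (lshift n i) * complex.Re (l b`_i) -
          cto z 0 (rshift n i) * complex.Im (l b`_i)).
Proof.
rewrite {1}(coord_vbasis (memvf z)) linear_sum Re_sum; apply: eq_bigr => i _.
by rewrite linearZ /= Re_mul Re_coord Im_coord.
Qed.

Lemma cplotsP m (U : set 'rV[R]_m) p :
  cplots U p <-> open U /\ forall j, Cinf U (fun x => cto (p x) 0 j).
Proof.
split=> [[oU H]|[oU H]]; split=> //.
  move=> j; case: (split_ordP j) => i ->.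
    have := H (coord b i); congr Cinf; apply/funext => x.
    by rewrite -Re_coord.
  (* Plots are tested on real parts only, and Re(-i c) = Im c. *)
  have := H ((- 'i%C) \*: (coord b i : {linear V -> R[i]^o})).
  congr Cinf; apply/funext => x /=.
  by rewrite -Im_coord; case: (coord _ _ _) => x1 x2 /=; ring.
move=> l; have -> : (fun x => complex.Re (l (p x))) = (fun x =>
    \sum_i (cto (p x) 0 (lshift n i) * complex.Re (l b`_i) -
            cto (p x) 0 (rshift n i) * complex.Im (l b`_i))).
  by apply/funext => x; rewrite Re_linear_cto.
apply: Cinf_sum => // i; apply: Cinf_add => //.
  by apply: Cinf_mul => //; exact: Cinf_cst.
by apply: Cinf_opp => //; apply: Cinf_mul => //; exact: Cinf_cst.
Qed.

End ComplexCoordinates.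

Section RealCoordinates.
Variables (R : realType) (E : vectType R).
Local Notation n := (\dim {:E}).
Local Notation b := (vbasis {:E}).

Lemma rplotsP m (U : set 'rV[R]_m) (p : _ -> E) :
  rplots U p <-> open U /\ forall j, Cinf U (fun x => rVof b (p x) 0 j).
Proof.
split=> [[oU H]|[oU H]]; split=> //.
  move=> j; have := H (coord b j); congr Cinf; apply/funext => x.
  by rewrite mxE.
move=> l; have -> : (fun x => l (p x)) = (fun x => \sum_i rVof b (p x) 0 i * l b`_i).
  apply/funext => x; rewrite {1}(coord_vbasis (memvf (p x))) linear_sum.
  by apply: eq_bigr => i _; rewrite linearZ /= mxE.
by apply: Cinf_sum => // i; apply: Cinf_mul => //; exact: Cinf_cst.
Qed.

End RealCoordinates.

(** * Atlases over a model space with linear coordinates, real or complex *)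

Section Model.
Variables (R : realType) (V : Type) (PV : plots R V) (N : nat).
Variables (to : V -> 'rV[R]_N) (fr : 'rV[R]_N -> V).
Hypotheses (toK : cancel to fr) (frK : cancel fr to).
Hypothesis PVP : forall m (U : set 'rV[R]_m) p,
  PV U p <-> open U /\ forall j, Cinf U (fun x => to (p x) 0 j).

Lemma model_diffeology : diffeology PV.
Proof.
split.
- by move=> n U p /PVP[].
- move=> n m U p W q /PVP[oU cp] oW cq WU; apply/PVP; split=> // j.
  exact: Cinf_comp (cp j).
- move=> n U p oU H; apply/PVP; split=> // j; apply: Cinf_local => x /H[W Wx /PVP[_ cW]].
  by exists W.
- move=> n U p p' /PVP[oU cp] E; apply/PVP; split=> // j.
  by apply: (Cinf_eq oU _ (cp j)) => x /E ->.
- by move=> n U x oU; apply/PVP; split=> // j; exact: Cinf_cst.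
Qed.

Lemma model_fr : PV setT fr.
Proof.
apply/PVP; split=> [|j]; first exact: openT.
have -> : (fun x => to (fr x) 0 j) = (fun x => x 0 j) by apply/funext => x; rewrite frK.
exact: Cinf_coord.
Qed.

Section Chart.
Variables (X : Type) (A : set (chart V X)).
Local Notation P := (aplots PV A).

Lemma chart_open c : Dopen PV c.1 -> open [set w : 'rV[R]_N | (c : chart V X).1 (fr w)].
Proof.
move=> oc; have := oc N setT fr model_fr; congr open.
by apply/seteqP; split=> w // [].
Qed.

Lemma chart_plot c : A c -> Dopen PV c.1 ->
  P [set w : 'rV[R]_N | c.1 (fr w)] (fun w => c.2 (fr w)).
Proof.
move=> Ac oc; have ow := chart_open oc; split=> // w cw.
exists c, [set w | c.1 (fr w)], fr; split=> //.
apply/PVP; split=> // j; have /PVP[_ /(_ j) co] := model_fr.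
exact: Cinf_sub co _.
Qed.

Lemma chart_derive c phi (T : R -> V) (z : V) : A c -> Dopen PV c.1 -> c.1 z ->
  smooth_fun P phi -> T 0 = z ->
  (forall j, derivable (fun t => to (T t) 0 j) 0 1) ->
  is_derive (0 : R) (1 : R) (fun t : R => phi (c.2 (T t)))
    ('D_(\row_j 'D_1 (fun t => to (T t) 0 j) 0) (fun w => phi (c.2 (fr w))) (to z)).
Proof.
move=> Ac oc cz sphi T0 dT.
have cPhi := sphi _ _ _ (chart_plot Ac oc).
have dPhi : differentiable (fun w => phi (c.2 (fr w))) (to z).
  by apply: (Cinf_differentiable cPhi); rewrite /= toK.
have := @derive1_chain _ N (fun w => phi (c.2 (fr w))) (fun t => to (T t))
  (fun j => 'D_1 (fun t => to (T t) 0 j) 0).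
rewrite T0 => /(_ dPhi) H; have {H} := H (fun j => derivableP (dT j)).
have -> : (fun t => phi (c.2 (fr (to (T t))))) = (fun t => phi (c.2 (T t))).
  by apply/funext => t; rewrite toK.
move=> H2; apply: (is_derive_eq H2); rewrite derive_row //; apply: eq_bigr => j _.
by rewrite mxE mulrC.
Qed.

Lemma plot1_derivable n (W : set 'rV[R]_1) (s : 'rV[R]_1 -> 'rV[R]_n) j : W 0 ->
  Cinf W (fun x => s x 0 j) -> derivable (fun t : R => s (line1 t) 0 j) (0 : R) (1 : R).
Proof.
move=> W0 cs; have ds := Cinf_differentiable cs W0.
have := @line_is_derive R _ (fun x : 'rV[R]_1 => s x 0 j) 0 (const_mx (1 : R)) 0.
rewrite scale0r addr0 => /(_ ds) [+ _]; congr (derivable _ (0 : R) (1 : R)).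
apply/funext => t; congr (s _ 0 j); apply/rowP => i.
by rewrite !mxE add0r mulr1.
Qed.

Lemma tangent_chart x v : diffeology P -> (forall c, A c -> Dopen PV c.1) ->
  tangent P x v -> exists c z u, [/\ A c, c.1 z, c.2 z = x &
    forall phi, smooth_fun P phi -> v phi = 'D_u (fun w => phi (c.2 (fr w))) (to z)].
Proof.
move=> dP oA [c [[oT Hc] c0 ->]].
have [ch [W [s [Ach oW W0 ps Hs]]]] := Hc 0 I.
have [ch0 cE] := Hs 0 W0.
exists ch, (s 0), (\row_j 'D_1 (fun t => to (s (line1 t)) 0 j) 0); split=> //.
  by rewrite -cE mxE c0.
move=> phi sphi; rewrite /velocity asboolT //.
have l0 : line1 0 = 0 :> 'rV[R]_1 by apply/rowP => i; rewrite !mxE.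
have /PVP[_ cs] := ps.
have := @chart_derive ch phi (fun t => s (line1 t)) (s 0) Ach (oA _ Ach) ch0 sphi.
rewrite l0 => /(_ erefl) H.
have {H} [_ <-] := H (fun j => plot1_derivable W0 (cs j)).
rewrite derive1E; apply: near_eq_derive.
have [r r0 rW] := open_normP oW W0.
apply/nbhs_normP; exists r => // t; rewrite /ball_ /= sub0r normrN => tr.
have Wt : W (line1 t).
  rewrite -[line1 t]add0r; apply: rW; apply: le_lt_trans tr.
  by apply/rV_normP => // i; rewrite mxE.
by have [_] := Hs _ Wt; rewrite mxE => ->.
Qed.

(** The spanning functionals are the coordinate derivatives in one fixed chart at x. A curve given
    in another chart is moved to the fixed one by a transition map, which is smooth by hypothesis
    and, the charts being injective, sends the initial point to the right place. *)
Lemma manifold_span x : is_manifold PV A -> exists F : 'I_N -> (X -> R) -> R,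
  forall v, tangent P x v -> exists r : 'I_N -> R, forall phi, v phi = \sum_i r i * F i phi.
Proof.
move=> [cov _ oA trans].
have cov' y : exists c z, [/\ A c, c.1 z & c.2 z = y].
  have [e [Ae /(_ y)[i [z ez zy]]]] := cov; by exists (e i), z.
have oA' c : A c -> Dopen PV c.1 by move=> /oA[].
have dP := aplots_diffeology model_diffeology cov'.
have [c0 [z0 [Ac0 cz0 c0E]]] := cov' x.
exists (fun i phi => if `[< smooth_fun P phi >] then
  'D_(delta_mx 0 i) (fun w => phi (c0.2 (fr w))) (to z0) else 0) => v tv.
have tv' := tv; move: tv' => [c [[oT Hc] cx Ev]].
have [ch [W [s [Ach oW W0 ps Hs]]]] := Hc 0 I.
have [ch0 cE] := Hs 0 W0.
have l0 : line1 0 = 0 :> 'rV[R]_1 by apply/rowP => i; rewrite !mxE.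
have [oov Htr] := trans _ _ Ach Ac0.
have /choice[tr Htr'] : forall z, exists z', overlap ch c0 z -> c0.1 z' /\ c0.2 z' = ch.2 z.
  move=> z; have [[_ [z' h1 h2]]|nz] := pselect (overlap ch c0 z); first by exists z'.
  by exists z0.
have trT : transition ch c0 tr by move=> z /Htr'.
pose W' := W `&` s @^-1` (overlap ch c0).
have oW' : open W' by exact: oov ps.
have ov0 : overlap ch c0 (s 0).
  by split=> //; exists z0 => //; rewrite -cE mxE cx.
have W'0 : W' 0 by [].
have ps' : PV W' s.
  have /PVP[_ cs] := ps; apply/PVP; split=> // j.
  by apply: (Cinf_sub (cs j)) => y [].
have pts : PV W' (fun y => tr (s y)) by apply: (Htr _ trT) => // y [].
have [tr0 trE] := trT _ ov0.
have trz : tr (s 0) = z0.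
  by have [_] := oA _ Ac0; apply=> //; rewrite trE -cE mxE cx.
have /PVP[_ cts] := pts.
exists (fun j => 'D_1 (fun t => to (tr (s (line1 t))) 0 j) 0) => phi.
have [sphi|ns] := pselect (smooth_fun P phi); last first.
  by rewrite (tangent0 tv ns) big1 // => i _; rewrite asboolF // mulr0.
rewrite Ev /velocity asboolT // derive1E.
have := @chart_derive c0 phi (fun t => tr (s (line1 t))) z0 Ac0 (oA' _ Ac0) cz0 sphi.
rewrite l0 => /(_ trz) H.
have {H} H := H (fun j => plot1_derivable (s := fun y => to (tr (s y))) W'0 (cts j)).
transitivity ('D_1 (fun t => phi (c0.2 (tr (s (line1 t))))) 0).
  apply: near_eq_derive.
  have [r r0 rW] := open_normP oW' W'0.
  apply/nbhs_normP; exists r => // t; rewrite /ball_ /= sub0r normrN => tr'.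
  have [Wt ovt] : W' (line1 t).
    rewrite -[line1 t]add0r; apply: rW; apply: le_lt_trans tr'.
    by apply/rV_normP => // i; rewrite mxE.
  have [_ ->] := trT _ ovt.
  by have [_] := Hs _ Wt; rewrite mxE => ->.
have [_ ->] := H; rewrite derive_row.
  by apply: eq_bigr => j _; rewrite mxE.
have cPhi := sphi _ _ _ (chart_plot Ac0 (oA' _ Ac0)).
by apply: (Cinf_differentiable cPhi); rewrite /= toK.
Qed.

End Chart.
End Model.

(** * The manifold M *)

Section ComplexSmooth.
Variables (R : realType) (n : nat) (U : set 'rV[R]_n).
Hypothesis oU : open U.

Definition CinfC (f : 'rV[R]_n -> R[i]) : Prop :=
  Cinf U (fun x => complex.Re (f x)) /\ Cinf U (fun x => complex.Im (f x)).

Lemma CinfC_cst c : CinfC (fun=> c).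
Proof. by split; exact: Cinf_cst. Qed.

Lemma CinfC_add f g : CinfC f -> CinfC g -> CinfC (fun x => f x + g x).
Proof.
move=> [f1 f2] [g1 g2]; split.
  have := Cinf_add oU f1 g1; congr Cinf; apply/funext => x.
  by case: (f x) (g x) => ?? [].
have := Cinf_add oU f2 g2; congr Cinf; apply/funext => x.
by case: (f x) (g x) => ?? [].
Qed.

Lemma CinfC_mul f g : CinfC f -> CinfC g -> CinfC (fun x => f x * g x).
Proof.
move=> [f1 f2] [g1 g2]; split.
  have := Cinf_add oU (Cinf_mul oU f1 g1) (Cinf_opp oU (Cinf_mul oU f2 g2)).
  by congr Cinf; apply/funext => x; rewrite Re_mul.
have := Cinf_add oU (Cinf_mul oU f1 g2) (Cinf_mul oU f2 g1).
by congr Cinf; apply/funext => x; rewrite Im_mul.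
Qed.

Lemma CinfC_conj f : CinfC f -> CinfC (fun x => (f x)^*).
Proof.
move=> [f1 f2]; split.
  by have := f1; congr Cinf; apply/funext => x; case: (f x).
by have := Cinf_opp oU f2; congr Cinf; apply/funext => x; case: (f x).
Qed.

Lemma CinfC_sqr f : CinfC f ->
  Cinf U (fun x => complex.Re (f x) ^+ 2 + complex.Im (f x) ^+ 2).
Proof.
move=> [f1 f2]; have := Cinf_add oU (Cinf_mul oU f1 f1) (Cinf_mul oU f2 f2).
by congr Cinf; apply/funext => x; rewrite !expr2.
Qed.

Lemma sqr_complex_eq0 (c : R[i]) :
  (complex.Re c ^+ 2 + complex.Im c ^+ 2 == 0) = (c == 0).
Proof.
case: c => a b /=; rewrite paddr_eq0 ?sqr_ge0 // !sqrf_eq0 eq_complex /=.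
by [].
Qed.

Lemma CinfC_inv f : (forall x, U x -> f x != 0) -> CinfC f -> CinfC (fun x => (f x)^-1).
Proof.
move=> f0 cf; have [f1 f2] := cf.
have cI : Cinf U (fun x => (complex.Re (f x) ^+ 2 + complex.Im (f x) ^+ 2)^-1).
  apply: Cinf_inv => //; last exact: CinfC_sqr.
  by move=> x Ux; rewrite sqr_complex_eq0; exact: f0.
split.
  have := Cinf_mul oU f1 cI; congr Cinf; apply/funext => x.
  by case: (f x).
have := Cinf_mul oU (Cinf_opp oU f2) cI; congr Cinf; apply/funext => x.
by case: (f x) => a b /=; rewrite mulNr.
Qed.

Lemma CinfC_sum I (r : seq I) (F : I -> 'rV[R]_n -> R[i]) :
  (forall i, CinfC (F i)) -> CinfC (fun x => \sum_(i <- r) F i x).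
Proof. by move=> H; apply: (alg_sum CinfC_cst CinfC_add CinfC_mul). Qed.

Lemma CinfC_nonzero f : CinfC f -> open [set x | U x /\ f x != 0].
Proof.
move=> cf; have := CinfC_sqr cf.
set g := (fun _ => _) => cg.
have := @open_preim R n 1 U [set v : 'rV[R]_1 | v 0 0 != 0] (fun x => line1 (g x)) oU.
have -> : [set x | U x /\ [set v : 'rV[R]_1 | v 0 0 != 0] (line1 (g x))] =
    [set x | U x /\ f x != 0].
  by apply/seteqP; split=> x /= [Ux]; rewrite mxE /g sqr_complex_eq0.
apply.
  have -> : [set v : 'rV[R]_1 | v 0 0 != 0] = (fun v => v 0 0) @^-1` [set~ 0].
    by apply/seteqP; split=> v /=; [move=> /eqP|move=> h; apply/eqP].
  apply: open_comp; last by apply: closed_openC; exact: closed_eq.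
  by move=> v _; exact: coord_continuous.
move=> i; have -> : (fun x => line1 (g x) 0 i) = g by apply/funext => x; rewrite mxE.
exact: cg.
Qed.

End ComplexSmooth.

Section VectorSmooth.
Variables (R : realType) (V : vectType R[i]).
Local Notation b := (vbasis {:V}).

Lemma cplots_coordP n (U : set 'rV[R]_n) (p : _ -> V) :
  cplots U p <-> open U /\ forall i, CinfC U (fun x => coord b i (p x)).
Proof.
rewrite cplotsP; split=> [[oU H]|[oU H]]; split=> //.
  move=> i; split.
    have := H (lshift _ i); congr Cinf; apply/funext => x; by rewrite -Re_coord.
  have := H (rshift _ i); congr Cinf; apply/funext => x; by rewrite -Im_coord.
move=> j; case: (split_ordP j) => i ->; have [h1 h2] := H i.
  by have := h1; congr Cinf; apply/funext => x; rewrite -Re_coord.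
by have := h2; congr Cinf; apply/funext => x; rewrite -Im_coord.
Qed.

Lemma cplots_diffeology : diffeology (@cplots R V).
Proof. exact: (model_diffeology (@cplotsP R V)). Qed.

Lemma cplots_add n (U : set 'rV[R]_n) (p q : _ -> V) :
  cplots U p -> cplots U q -> cplots U (fun x => p x + q x).
Proof.
move=> /cplots_coordP[oU H] /cplots_coordP[_ H']; apply/cplots_coordP; split=> // i.
have := CinfC_add oU (H i) (H' i); congr CinfC; apply/funext => x.
by rewrite linearD.
Qed.

Lemma cplots_scale n (U : set 'rV[R]_n) f (p : _ -> V) :
  CinfC U f -> cplots U p -> cplots U (fun x => f x *: p x).
Proof.
move=> cf /cplots_coordP[oU H]; apply/cplots_coordP; split=> // i.
have := CinfC_mul oU cf (H i); congr CinfC; apply/funext => x.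
by rewrite linearZ.
Qed.

Lemma cplots_opp n (U : set 'rV[R]_n) (p : _ -> V) :
  cplots U p -> cplots U (fun x => - p x).
Proof.
move=> pp; have := cplots_scale (CinfC_cst U (-1)) pp; congr cplots.
by apply/funext => x; rewrite scaleN1r.
Qed.

Lemma cplots_cst n (U : set 'rV[R]_n) (z : V) : open U -> cplots U (fun=> z).
Proof. by move=> oU; exact: (plot_cst cplots_diffeology z oU). Qed.

End VectorSmooth.

Section JordanSmooth.
Variables (R : realType) (Z : vectType R[i]) (T : hermitian_jordan_triple Z).
Local Notation d := (\dim {:Z}).
Local Notation b := (vbasis {:Z}).

Lemma tp_sumr u v I (r : seq I) (c : I -> R[i]) (w : I -> Z) :
  tp T u v (\sum_(i <- r) c i *: w i) = \sum_(i <- r) c i *: tp T u v (w i).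
Proof. by elim/big_rec2: _ => [|i y x _ <-]; rewrite ?tp0r // tpDr tpZr. Qed.

Lemma tp_summ u v I (r : seq I) (c : I -> R[i]) (w : I -> Z) :
  tp T u (\sum_(i <- r) c i *: w i) v = \sum_(i <- r) (c i)^* *: tp T u (w i) v.
Proof. by elim/big_rec2: _ => [|i y x _ <-]; rewrite ?tp0m // tpDm' tpZm. Qed.

Lemma cplots_tp n (U : set 'rV[R]_n) (p q r : _ -> Z) :
  cplots U p -> cplots U q -> cplots U r -> cplots U (fun x => tp T (p x) (q x) (r x)).
Proof.
move=> /cplots_coordP[oU Hp] /cplots_coordP[_ Hq] /cplots_coordP[_ Hr].
apply/cplots_coordP; split=> // m.
have -> : (fun x => coord b m (tp T (p x) (q x) (r x))) = (fun x =>
    \sum_i \sum_j \sum_k coord b i (p x) * (coord b j (q x))^* * coord b k (r x) *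
      coord b m (tp T b`_i b`_j b`_k)).
  apply/funext => x; rewrite [in LHS]tpC {1}(coord_vbasis (memvf (p x))) tp_sumr linear_sum.
  apply: eq_bigr => i _; rewrite linearZ /= {1}(coord_vbasis (memvf (q x))) tp_summ linear_sum.
  rewrite mulr_sumr; apply: eq_bigr => j _; rewrite linearZ /= tpC.
  rewrite {1}(coord_vbasis (memvf (r x))) tp_sumr linear_sum !mulr_sumr.
  by apply: eq_bigr => k _; rewrite linearZ /= !mulrA.
do 3 (apply: CinfC_sum => // ?).
apply: CinfC_mul => //; last exact: CinfC_cst.
by do 2 (apply: CinfC_mul => //); exact: CinfC_conj.
Qed.

Lemma cplots_B0 n (U : set 'rV[R]_n) (p q r : _ -> Z) :
  cplots U p -> cplots U q -> cplots U r -> cplots U (fun x => B0 T (q x) (p x) (r x)).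
Proof.
move=> pp pq pr; rewrite /B0.
have p1 := cplots_tp pp pq pr; have p2 := cplots_tp pq pr pq.
exact: (cplots_add (cplots_add pr (cplots_opp (cplots_add p1 p1))) (cplots_tp pp p2 pp)).
Qed.

Lemma end_mxE (h : 'End(Z)) i j : end_mx h i j = coord b j (h b`_i).
Proof.
rewrite /end_mx /mxof !mxE /=; congr (coord _ _ (h _)).
exact: vecof_delta.
Qed.

Lemma det_bergman_smooth n (U : set 'rV[R]_n) (p q : _ -> Z) :
  cplots U p -> cplots U q -> CinfC U (fun x => \det (end_mx (bergman T (p x) (q x)))).
Proof.
move=> pp pq; have [oU _] := (cplots_coordP _ _).1 pp.
apply: (alg_det (@CinfC_cst R n U) (CinfC_add oU) (CinfC_mul oU)) => i j.
have /cplots_coordP[_ /(_ j)] := cplots_B0 pp pq (cplots_cst b`_i oU).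
congr CinfC; apply/funext => x; by rewrite end_mxE bergmanE.
Qed.

Lemma bergman_inv_open n (U : set 'rV[R]_n) (p q : _ -> Z) :
  cplots U p -> cplots U q -> open [set x | U x /\ bergman_inv T (p x) (q x)].
Proof.
move=> pp pq; have [oU _] := (cplots_coordP _ _).1 pp.
have := CinfC_nonzero oU (det_bergman_smooth pp pq); congr open.
by apply/seteqP; split=> x /= [Ux] /eqP.
Qed.

(** The quasi-inverse solves a linear system whose matrix B(p,q) and right-hand side depend smoothly
    on the parameter; Cramer's rule gives a smooth solution, and injectivity of B identifies it. *)
Lemma quasi_smooth n (U : set 'rV[R]_n) (p q : _ -> Z) :
  cplots U p -> cplots U q -> (forall x, U x -> bergman_inv T (p x) (q x)) ->
  cplots U (fun x => quasi_inverse T (p x) (q x)).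
Proof.
move=> pp pq inv; have [oU _] := (cplots_coordP _ _).1 pp.
pose v x := p x - tp T (p x) (q x) (p x).
have pv : cplots U v by apply: cplots_add => //; apply: cplots_opp; exact: cplots_tp.
pose Mx x := end_mx (bergman T (p x) (q x)).
pose w x := \sum_j (\sum_k coord b k (v x) * cramer (Mx x) k j) *: b`_j.
have pw : cplots U w.
  apply/cplots_coordP; split=> // i.
  have -> : (fun x => coord b i (w x)) = (fun x => \sum_k coord b k (v x) * cramer (Mx x) k i).
    by apply/funext => x; rewrite coord_sum_free // (basis_free (vbasisP _)).
  apply: CinfC_sum => // k; apply: CinfC_mul => //.
    by have /cplots_coordP[_ /(_ k)] := pv.
  apply: (alg_cramer (@CinfC_cst R n U) (CinfC_add oU) (CinfC_mul oU)).
    move=> a c; have /cplots_coordP[_ /(_ c)] := cplots_B0 pp pq (cplots_cst b`_a oU).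
    by congr CinfC; apply/funext => x; rewrite end_mxE bergmanE.
  apply: CinfC_inv => //; last exact: det_bergman_smooth.
  by move=> x Ux; apply/eqP; exact: inv.
apply: (plot_eq (@cplots_diffeology R Z) pw) => x Ux.
apply: (B0_inj (inv _ Ux)); rewrite bergman_quasi; last exact: inv.
rewrite -bergmanE.
rewrite [RHS](coord_vbasis (memvf _)) [LHS](coord_vbasis (memvf _)).
apply: eq_bigr => m _; congr (_ *: _).
rewrite /w linear_sum linear_sum.
pose rv : 'rV[R[i]]_d := \row_k coord b k (v x).
have E : rv *m cramer (Mx x) *m Mx x = rv.
  by rewrite -mulmxA cramerVK ?mulmx1 //; apply/eqP; exact: inv.
have E2 : coord b m (v x) = rv 0 m by rewrite mxE.
rewrite E2 -E mxE.
apply: eq_bigr => j _; rewrite !linearZ /= end_mxE; congr (_ * _).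
have mulE (A : 'rV[R[i]]_d) (Q : 'M[R[i]]_d) :
    (A *m Q) 0 j = \sum_k A 0 k * Q k j by rewrite mxE.
rewrite scalemxAr mulE.
by apply: eq_bigr => k _; congr (_ * _); rewrite mxE.
Qed.

End JordanSmooth.

(** * Connected subsets of spaces with plots *)

Section Connectedness.
Variables (R : realType) (X : Type) (P : plots R X).
Hypothesis dP : diffeology P.

Lemma plot_sub n (U W : set 'rV[R]_n) p : @P n U p -> open W -> W `<=` U -> @P n W p.
Proof.
move=> pp oW WU; apply: (plot_comp dP pp oW (q := id)) => // i.
exact: Cinf_coord.
Qed.

Lemma Dconnected_union (C D : set X) x : Dconnected P C -> Dconnected P D ->
  C x -> D x -> Dconnected P (C `|` D).
Proof.
move=> cC cD Cx Dx A B oA oB sub [a [CDa Aa]] [b [CDb Bb]].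
have subC : C `<=` A `|` B by move=> y Cy; apply: sub; left.
have subD : D `<=` A `|` B by move=> y Dy; apply: sub; right.
have key : forall E, E `<=` C `|` D -> Dconnected P E -> E `<=` A `|` B ->
    E `&` A !=set0 -> E `&` B !=set0 -> (C `|` D) `&` (A `&` B) !=set0.
  by move=> E EC cE sE hA hB; have [y [Ey yAB]] := cE A B oA oB sE hA hB; exists y; split=> //; exact: EC.
have kC := key C (fun y h => or_introl h) cC subC.
have kD := key D (fun y h => or_intror h) cD subD.
have [Ax|Bx] := subC x Cx.
  case: CDb => [Cb|Db]; [apply: kC; [exists x|exists b]|apply: kD; [exists x|exists b]]; by [].
case: CDa => [Ca|Da]; [apply: kC; [exists a|exists x]|apply: kD; [exists a|exists x]]; by [].
Qed.

Lemma segment_Dconnected (g : R -> X) : @P 1 setT (fun x => g (x 0 0)) ->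
  Dconnected P [set g t | t in `[0, 1]].
Proof.
move=> pg A B oA oB sub [_ [[a Ia <-] Aa]] [_ [[b Ib <-] Bb]].
have og E : Dopen P E -> open [set t | E (g t)].
  move=> oE; have := oE 1 _ _ pg.
  have cl := @line1_continuous R.
  move=> H; have := open_comp (f := @line1 R) (fun x _ => cl x) H.
  congr open; apply/seteqP; split=> t /=; rewrite mxE; first by case.
  by [].
apply: contrapT => nAB.
have no t : `[0, 1]%classic t -> A (g t) -> B (g t) -> False.
  by move=> It At Bt; apply: nAB; exists (g t); split=> //; exists t.
pose S := `[(0 : R), 1] `&` [set t | A (g t)].
have SE : S = `[(0 : R), 1]%classic.
  apply: (@segment_connected R 0 1).
  - by exists a.
  - by exists [set t | A (g t)]; [exact: og|].
  - exists (~` [set t | B (g t)]); first exact/open_closedC/og.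
    apply/seteqP; split=> t [It At]; split=> //=; first by move=> Bt; exact: (no t).
    by have [//|Bt] : (A `|` B) (g t); [apply: sub; exists t|case: At].
have : S b by rewrite SE.
by move=> [_ Ab]; exact: (no b).
Qed.

End Connectedness.

Section ManifoldM.
Variables (R : realType) (Z : vectType R[i]) (T : hermitian_jordan_triple Z) (eps : int).
Local Notation M := (Mpt T eps).
Local Notation MP := (@Mplots R Z T eps).
Local Notation N := (\dim {:Z} + \dim {:Z})%N.
Local Notation to := (@cto R Z).
Local Notation fr := (@cof R Z).

Lemma cplots_cof : cplots setT (fr : 'rV[R]_N -> Z).
Proof. exact: (model_fr (@cofK R Z) (@cplotsP R Z)). Qed.

(** A nearby point is joined to [fr w] by a segment inside the open set where det B(z,z) is nonzero;
    adding the segment to the connected set that links 0 to [fr w] keeps it connected. *)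
Lemma bounded_domain_open : open [set w : 'rV[R]_N | bounded_domain T (fr w)].
Proof.
have oB := @bergman_inv_open R Z T _ _ _ _ cplots_cof cplots_cof.
apply: normP_open => w [C [CS cC C0 Cw]].
have [r r0 Hr] := open_normP oB (conj I (CS _ Cw)).
exists r => // v vr.
pose g t := fr (w + t *: v).
have pg : cplots setT (fun x : 'rV[R]_1 => g (x 0 0)).
  have q i : Cinf [set: 'rV[R]_1] (fun x => (w + x 0 0 *: v) 0 i).
    have -> : (fun x : 'rV[R]_1 => (w + x 0 0 *: v) 0 i) = (fun x => w 0 i + x 0 0 * v 0 i).
      by apply/funext => x; rewrite !mxE.
    apply: (Cinf_add (@openT _)); first exact: Cinf_cst.
    by apply: (Cinf_mul (@openT _)); [exact: Cinf_coord|exact: Cinf_cst].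
  exact: (plot_comp (@cplots_diffeology R Z) cplots_cof (@openT _) q (fun _ _ => Logic.I)).
exists (C `|` [set g t | t in `[0, 1]]); split.
- move=> z [/CS //|[t It <-]] /=.
  suff tr : `|t *: v| < r by have [_] := Hr _ tr.
  move: It; rewrite /= in_itv /= => /andP[t0 t1].
  rewrite normrZ ger0_norm //; apply: le_lt_trans vr.
  by rewrite ler_piMl.
- apply: (Dconnected_union (x := fr w)) => //; first exact: segment_Dconnected.
  by exists 0; rewrite /= ?in_itv /= ?lexx ?ler01 // /g scale0r addr0.
- by left.
- by right; exists 1; rewrite /= ?in_itv /= ?lexx ?ler01 // /g scale1r.
Qed.

Lemma in_M_open : open [set w : 'rV[R]_N | in_M T eps (fr w)].
Proof.
rewrite /in_M /Mset; case: (eps == 1).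
  have -> : [set w | exists z a, dual_class T (fr w) 0 = dual_class T z a] = [set: 'rV[R]_N].
    by apply/seteqP; split=> w // _; exists (fr w), 0.
  exact: openT.
case: (eps == 0).
  have -> : [set w | exists z, dual_class T (fr w) 0 = dual_class T z 0] = [set: 'rV[R]_N].
    by apply/seteqP; split=> w // _; exists (fr w).
  exact: openT.
have := bounded_domain_open; congr open; apply/seteqP; split=> w /=.
  by move=> h; exists (fr w).
by move=> [z hz /dual_class_inj ->].
Qed.

Lemma in_M0 : in_M T eps 0.
Proof. exact: base_in_M. Qed.

Lemma in_M_plot_open n (U : set 'rV[R]_n) (s : _ -> Z) : cplots U s ->
  open [set x | U x /\ in_M T eps (s x)].
Proof.
move=> /cplotsP[oU cs]; have := @open_preim R n N U _ (fun x => to (s x)) oU in_M_open cs.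
congr open; apply/seteqP; split=> x /= [Ux]; by rewrite ctoK.
Qed.

Lemma sval_pt z a : Mset T eps (dual_class T z a) -> sval (pt T eps z a) = dual_class T z a.
Proof. by move=> h; rewrite /pt; case: pselect. Qed.

Lemma M_inj (x y : M) : sval x = sval y -> x = y.
Proof. by case: x y => [x hx] [y hy] /= E; subst y; congr exist; exact: Prop_irrelevance. Qed.

Lemma M_cover (x : M) : exists z a, [/\ Mset T eps (dual_class T z a),
  pt T eps z a = x & sval x = dual_class T z a].
Proof.
case: x => x hx; have [z [a xE]] : exists z a, x = dual_class T z a.
  move: hx; rewrite /Mset; case: ifP => _ //; case: ifP => _ [z h]; first by exists z, 0.
  by move=> ->; exists z, 0.
exists z, a; have h : Mset T eps (dual_class T z a) by rewrite -xE.
by split=> //; apply: M_inj; rewrite sval_pt.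
Qed.

Lemma M_diffeology : diffeology MP.
Proof.
apply: aplots_diffeology; first exact: cplots_diffeology.
move=> x; have [z [a [h hx _]]] := M_cover x.
by exists ([set z | Mset T eps (dual_class T z a)], pt T eps ^~ a), z; split=> //; exists a.
Qed.

Lemma Zpt_plot n (U : set 'rV[R]_n) (s : _ -> Z) : cplots U s ->
  (forall x, U x -> in_M T eps (s x)) -> MP U (fun x => Zpt T eps (s x)).
Proof.
move=> ps sM; have [oU _] := (cplots_coordP _ _).1 ps; split=> // x Ux.
exists ([set z | Mset T eps (dual_class T z 0)], pt T eps ^~ 0), U, s.
by split=> //; [exists 0|move=> y Uy; split=> //; exact: sM].
Qed.

(** The domain of the chart z |-> [z,0]; [zc] is its coordinate, well defined because a class has at
    most one member with second entry 0. *)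
Definition zdom (x : M) : Prop := exists z, sval x (z, 0).
Definition zc (x : M) : Z := xget 0 [set z | sval x (z, 0)].

Lemma zcP x : zdom x -> sval x (zc x, 0).
Proof. by move=> [z hz]; exact: (@xgetPex _ 0 [set z | sval x (z, 0)] (ex_intro _ z hz)). Qed.

Lemma zdom_Zpt z : in_M T eps z -> zdom (Zpt T eps z).
Proof. by move=> h; exists z; rewrite /Zpt sval_pt //; exact: mem_dual_class. Qed.

Lemma zc_uniq x z : sval x (z, 0) -> zc x = z.
Proof.
move=> hz; have h : sval x (zc x, 0) by apply: zcP; exists z.
have [z0 [a [_ _ E]]] := M_cover x; move: hz h; rewrite E /dual_class /=.
by move=> [_ ->] [_ ->].
Qed.

Lemma zc_Zpt z : in_M T eps z -> zc (Zpt T eps z) = z.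
Proof. by move=> h; apply: zc_uniq; rewrite /Zpt sval_pt //; exact: mem_dual_class. Qed.

Lemma zdomE x : zdom x -> in_M T eps (zc x) /\ x = Zpt T eps (zc x).
Proof.
move=> dx; have h := zcP dx; have [z [a [hM _ E]]] := M_cover x.
have E2 : dual_class T z a = dual_class T (zc x) 0.
  move: h; rewrite E /dual_class /= subr0 => -[Bza ->].
  by rewrite -[X in _ = dual_class T _ X](subrr a); exact: dual_class_shift.
have inM : in_M T eps (zc x) by rewrite /in_M -E2.
by split=> //; apply: M_inj; rewrite /Zpt sval_pt // E.
Qed.

Lemma M_plot_local n (U : set 'rV[R]_n) p y0 : MP U p -> U y0 -> exists a W s,
  [/\ open W, W y0, W `<=` U, cplots W s &
      forall y, W y -> Mset T eps (dual_class T (s y) a) /\ sval (p y) = dual_class T (s y) a].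
Proof.
move=> pp Uy; have [oU Hp] := pp; have [c [W [s [[a ->] oW Wy ps Hs]]]] := Hp _ Uy.
have oWU : open (W `&` U) by exact: openI.
have ps' : cplots (W `&` U) s.
  exact: (plot_sub (@cplots_diffeology R Z) ps oWU (@subIsetl _ W U)).
exists a, (W `&` U), s; split=> //.
by move=> y [/Hs[h ->] _]; split=> //; rewrite sval_pt.
Qed.

(** In the chart with parameter a the coordinate is s^a, on the open set where B(s,a) is
    invertible. *)
Lemma zc_plot n (U : set 'rV[R]_n) p y0 : MP U p -> U y0 -> zdom (p y0) ->
  exists W, [/\ open W, W y0, W `<=` U, cplots W (fun y => zc (p y)) &
    forall y, W y -> zdom (p y)].
Proof.
move=> pp Uy [z0 hz0]; have [a [W [s [oW Wy WU ps Hs]]]] := M_plot_local pp Uy.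
have [hM E] := Hs _ Wy.
have Bz : bergman_inv T (s y0) a.
  by move: hz0; rewrite E /dual_class /= subr0 => -[].
have pa := cplots_cst a oW.
have oW' := @bergman_inv_open R Z T _ _ _ _ ps pa.
pose W' := [set y | W y /\ bergman_inv T (s y) a]; rewrite -/W' in oW'.
have zE y : W' y -> sval (p y) (quasi_inverse T (s y) a, 0).
  move=> [Wyy By]; have [_ ->] := Hs _ Wyy.
  by rewrite /dual_class /= subr0.
have sub : W' `<=` W by move=> y [].
exists W'; split=> //.
- by move=> y /sub /WU.
- have dZ := @cplots_diffeology R Z.
  have ps' := plot_sub dZ ps oW' sub.
  have pa' := plot_sub dZ pa oW' sub.
  have pq := quasi_smooth ps' pa' (fun y (h : W' y) => h.2).
  by apply: (plot_eq dZ pq) => y /zE /zc_uniq.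
- by move=> y /zE h; exists (quasi_inverse T (s y) a).
Qed.

(* Near a point outside the chart [Zpt] the coordinate is the quasi-inverse
   s^a with det B(s,a) close to 0; it is large because B(s,a) B(s^a,-a) = 1. *)
Lemma zc_proper n (U : set 'rV[R]_n) p y0 r : MP U p -> U y0 -> ~ zdom (p y0) ->
  exists W, [/\ open W, W y0, W `<=` U &
    forall y, W y -> zdom (p y) -> r < `|to (zc (p y))|].
Proof.
have aux (A F B : R) : 0 <= A -> 0 <= F -> 0 <= B -> A <= B -> F < (B + 1)^-1 -> A * F = 1 -> False.
  move=> A0 F0 B0 AB FB AF; have : A * F <= B * (B + 1)^-1 by apply: ler_pM => //; exact: ltW.
  by rewrite AF leNgt => /negP; apply; rewrite ltr_pdivrMr ?ltr_wpDl // mul1r ltrDl.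
move=> pp Uy nz; have [a [W [s [oW Wy WU ps Hs]]]] := M_plot_local pp Uy.
have [_ E0] := Hs _ Wy.
have pa := cplots_cst a oW.
have Bz0 : \det (end_mx (bergman T (s y0) a)) = 0.
  apply: contrapT => h; apply: nz; exists (quasi_inverse T (s y0) a).
  by rewrite E0 /dual_class /= subr0.
pose sq (c : R[i]) := complex.Re c ^+ 2 + complex.Im c ^+ 2.
have sqM c e : sq (c * e) = sq c * sq e.
  by rewrite /sq Re_mul Im_mul; ring.
pose D (w : 'rV[R]_N) := sq (\det (end_mx (bergman T (fr w) (- a)))).
have cD : Cinf setT D.
  apply: (CinfC_sqr (@openT _)).
  by apply: (@det_bergman_smooth R Z T N setT fr (fun=> - a)); [exact: cplots_cof|exact: (cplots_cst _ (@openT _))].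
pose K := [set w : 'rV[R]_N | `|w| <= `|r|].
have cK : compact K.
  apply: bounded_closed_compact.
    exists `|r|; split; first exact: num_real.
    by move=> x rx y /= yr; apply: le_trans yr (ltW rx).
  have -> : K = (fun w : 'rV[R]_N => `|w|) @^-1` [set x | x <= `|r|] by [].
  by apply: preimage_closed; [move=> x _; exact: norm_continuous|exact: (@closed_le R)].
have K0 : K 0 by rewrite /K /= normr0.
have [w0 _ maxD] : exists2 c, c \in K & forall t, t \in K -> D t <= D c.
  apply: EVT_max_rV => //; first by exists 0.
  apply: continuous_subspaceT => x; exact: (Cinf_continuous cD).
have D0 w : 0 <= D w by rewrite addr_ge0 // sqr_ge0.
pose f y := sq (\det (end_mx (bergman T (s y) a))).
have cf : Cinf W f by apply: (CinfC_sqr oW); exact: det_bergman_smooth.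
have f0 : f y0 = 0 by rewrite /f Bz0 /sq /= expr0n /= addr0.
(* With the coordinate inside the ball, D <= D w0 and D f = 1 would give f >= 1 / D w0 > e. The
   added 1 covers a vanishing maximum. *)
pose e := (D w0 + 1)^-1.
have e0 : 0 < e by rewrite invr_gt0 ltr_wpDl.
have oW' := @open_preim R n 1 W [set v : 'rV[R]_1 | v 0 0 < e] (fun x => line1 (f x)) oW.
exists [set x | W x /\ [set v : 'rV[R]_1 | v 0 0 < e] (line1 (f x))]; split.
- apply: oW'.
    have -> : [set v : 'rV[R]_1 | v 0 0 < e] = (fun v : 'rV[R]_1 => v 0 0) @^-1` [set x | x < e] by [].
    by apply: open_comp; [move=> v _; exact: coord_continuous|exact: open_lt].
  move=> i; have -> : (fun x => line1 (f x) 0 i) = f by apply/funext => x; rewrite mxE.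
  exact: cf.
- by split=> //=; rewrite mxE f0.
- by move=> y [/WU].
move=> y [Wyy] /=; rewrite mxE => fy dy; rewrite ltNge; apply/negP => zr.
have [_ Ey] := Hs _ Wyy; have := zcP dy; rewrite Ey /dual_class /= subr0 => -[By zE].
have KD : to (zc (p y)) \in K.
  by rewrite inE /K /=; apply: le_trans zr (ler_norm _).
have := maxD _ KD; rewrite {1}/D ctoK => DD.
have detE := bergman_det By (- a); rewrite subrr bergman0r det_id -zE in detE.
have : sq (\det (end_mx (bergman T (zc (p y)) (- a)))) * f y = 1.
  by rewrite -sqM -detE /sq /= expr1n expr0n /= addr0.
set X := sq _ in DD * => XE.
have fy0 : 0 <= f y by rewrite addr_ge0 // sqr_ge0.
by apply: (aux _ _ _ _ fy0 _ DD fy XE); rewrite addr_ge0 // sqr_ge0.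
Qed.

End ManifoldM.

(** * Tangent vectors of M and cut-off coordinates *)

Section ManifoldTangent.
Variables (R : realType) (Z : vectType R[i]) (T : hermitian_jordan_triple Z) (eps : int).
Local Notation M := (Mpt T eps).
Local Notation MP := (@Mplots R Z T eps).
Local Notation N := (\dim {:Z} + \dim {:Z})%N.
Local Notation to := (@cto R Z).
Local Notation fr := (@cof R Z).
Local Notation Mat := (@Matlas R Z T eps).
Local Notation Zv := (@Zvec R Z T eps).
Local Notation dZ := (@cplots_diffeology R Z).
Local Notation dM := (@M_diffeology R Z T eps).

(** For eps = 1 the chart domain is all of [Z]. Otherwise a class of M has a member (z',0), so the
    domain consists of the z with B(z,a) invertible and z^a in M. *)
Lemma M_chart_Dopen c : Mat c -> Dopen (@cplots R Z) c.1.
Proof.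
move=> [a ->] n U p pp /=; have [oU _] := (cplots_coordP U p).1 pp.
case E : (eps == 1).
  have -> : U `&` p @^-1` [set z | Mset T eps (dual_class T z a)] = U; last exact: oU.
  apply/seteqP; split=> [x [] //|x Ux]; split=> //=.
  by rewrite /Mset E; exists (p x), a.
have pa := cplots_cst a oU.
have oB := @bergman_inv_open R Z T _ _ _ _ pp pa.
pose W := [set y | U y /\ bergman_inv T (p y) a]; rewrite -/W in oB.
have sW : W `<=` U by move=> y [].
have pq := quasi_smooth (plot_sub dZ pp oB sW) (plot_sub dZ pa oB sW) (fun y (h : W y) => h.2).
have := @in_M_plot_open R Z T eps _ _ _ pq; congr open; apply/seteqP; split=> x /=.
  move=> [[Ux Bx] h]; split=> //; move: h.
  by rewrite /in_M -[X in dual_class T _ X](subrr a) -dual_class_shift.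
move=> [Ux h]; have [z' E'] : exists z', dual_class T (p x) a = dual_class T z' 0.
  by move: h; rewrite /Mset E; case: ifP => _ [z']; exists z'.
have := mem_dual_class T z' 0; rewrite -E' /dual_class /= subr0 => -[Bx z'E].
by split=> //; rewrite -z'E /in_M -E'.
Qed.

Section ChartVector.
Variable a : Z.
Local Notation psi := (fun z => pt T eps z a).

Lemma chart_curve phi (c : R -> Z) u : Mset T eps (dual_class T (c 0) a) ->
  smooth_fun MP phi ->
  (forall j, is_derive (0 : R) (1 : R) (fun t => to (c t) 0 j) (to u 0 j)) ->
  is_derive (0 : R) (1 : R) (fun t : R => phi (psi (c t)))
    ('D_(to u) (fun w => phi (psi (fr w))) (to (c 0))).
Proof.
move=> h sphi dc; have Ac : Mat ([set z | Mset T eps (dual_class T z a)], psi) by exists a.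
have := @chart_derive R Z (@cplots R Z) N to fr (@ctoK R Z) (@cofK R Z) (@cplotsP R Z)
  _ _ _ phi c _ Ac (M_chart_Dopen Ac) h sphi erefl.
rewrite (_ : (\row_j 'D_1 (fun t => to (c t) 0 j) 0) = to u); first by apply=> j; exact: ex_derive.
by apply/rowP => j; rewrite mxE; exact: derive_val.
Qed.

Lemma line_coord (z u : Z) j :
  is_derive (0 : R) (1 : R) (fun t : R => to (z + t%:C *: u) 0 j) (to u 0 j).
Proof.
have -> : (fun t : R => to (z + t%:C *: u) 0 j) = (fun t => to z 0 j + t * to u 0 j).
  by apply/funext => t; rewrite cto_lin !mxE.
by apply: is_derive_eq; rewrite add0r mul1r scale0r add0r /GRing.scale /= mulr1.
Qed.

Lemma chart_vectorE phi z u : Mset T eps (dual_class T z a) -> smooth_fun MP phi ->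
  chart_vector Mat psi z u phi = 'D_(to u) (fun w => phi (psi (fr w))) (to z).
Proof.
move=> h sphi; rewrite /chart_vector /velocity; case: asboolP => // _.
have E0 : z + (0 : R)%:C *: u = z by rewrite scale0r addr0.
have := @chart_curve phi (fun t => z + t%:C *: u) u.
rewrite /= E0 => /(_ h sphi (line_coord z u)) H.
by rewrite derive1E; exact: derive_val.
Qed.
End ChartVector.

Lemma Zvec_curve phi (c : R -> Z) u : in_M T eps (c 0) -> smooth_fun MP phi ->
  (forall j, is_derive (0 : R) (1 : R) (fun t => to (c t) 0 j) (to u 0 j)) ->
  is_derive (0 : R) (1 : R) (fun t : R => phi (Zpt T eps (c t))) (Zv (c 0) u phi).
Proof. by move=> h sphi dc; rewrite /Zvec chart_vectorE //; exact: chart_curve. Qed.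

Lemma Zvec0 z u phi : ~ smooth_fun MP phi -> Zv z u phi = 0.
Proof. by move=> h; rewrite /Zvec /chart_vector /velocity; case: asboolP. Qed.

Lemma Zpt_smooth phi : smooth_fun MP phi ->
  Cinf [set w | in_M T eps (fr w)] (fun w => phi (Zpt T eps (fr w))).
Proof.
move=> sphi; apply: (sphi _ _ (fun w => Zpt T eps (fr w))); apply: Zpt_plot => //.
by apply: (plot_sub dZ (cplots_cof Z)); first exact: in_M_open.
Qed.

Lemma ctoD (u v : Z) : to (u + v) = to u + to v.
Proof. by have := cto_lin 1 u v; rewrite !scale1r. Qed.

Lemma ctoZ (t : R) (u : Z) : to (t%:C *: u) = t *: to u.
Proof. by have := cto_lin t 0 u; rewrite cto0 !add0r. Qed.

Lemma Zvec_lin z (t : R) u v phi : in_M T eps z ->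
  Zv z (t%:C *: u + v) phi = t * Zv z u phi + Zv z v phi.
Proof.
move=> h; have [sphi|nphi] := pselect (smooth_fun MP phi); last by rewrite !Zvec0 // mulr0 addr0.
have df : differentiable (fun w => phi (Zpt T eps (fr w))) (to z).
  by apply: (Cinf_differentiable (Zpt_smooth sphi)); rewrite /= ctoK.
rewrite /Zvec !chart_vectorE // ctoD ctoZ.
by rewrite !deriveE // linearD linearZ.
Qed.

Lemma is_derive_tmul (h : R -> R) : derivable h 0 1 ->
  is_derive (0 : R) (1 : R) (fun t : R => t * h t) (h 0).
Proof.
move=> dh; have dh' : is_derive (0 : R) (1 : R) h ('D_1 h 0) by exact/derivableP.
by apply: is_derive_eq; rewrite scale0r add0r /GRing.scale /= mulr1.
Qed.

(** The bump exp(-1/(r^2 - |w|^2)) in the Euclidean norm. Since that norm dominates the maximum norm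
    of rows, the bump vanishes where the latter exceeds r. *)
Definition cutoff (r : R) (w : 'rV[R]_N) : R := flat 0 (r ^+ 2 - \sum_k w 0 k ^+ 2).

Lemma cutoff_smooth r : Cinf setT (cutoff r).
Proof.
have H := @flat_Cinf R 0.
have -> : cutoff r = (fun w => (fun x : 'rV[R]_1 => flat 0 (x 0 0)) (line1 (r ^+ 2 - \sum_k w 0 k ^+ 2))).
  by apply/funext => w; rewrite mxE.
apply: (Cinf_comp (@openT _) _ _ H) => // i.
have -> : (fun w : 'rV[R]_N => line1 (r ^+ 2 - \sum_k w 0 k ^+ 2) 0 i) =
    (fun w => r ^+ 2 + - \sum_k w 0 k * w 0 k).
  by apply/funext => w; rewrite mxE; congr (_ - _); apply: eq_bigr => k _; rewrite expr2.
apply: (Cinf_add (@openT _)); first exact: Cinf_cst.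
apply: (Cinf_opp (@openT _)); apply: (Cinf_sum _ (@openT _)) => k.
by apply: (Cinf_mul (@openT _)); exact: Cinf_coord.
Qed.

Lemma cutoff_out r w : 0 < r -> r < `|w| -> cutoff r w = 0.
Proof.
move=> r0 rw; rewrite /cutoff /flat ltNge; case: ifPn => // /negP; case.
rewrite subr_le0; have [k rk] : exists k, r < `|w 0 k|.
  apply: contrapT => nk; move: rw; rewrite ltNge => /negP; apply.
  apply/(rV_normP w (ltW r0)) => i; rewrite leNgt; apply/negP => ri; apply: nk.
  by exists i.
rewrite (bigD1 k) //= -[leLHS]addr0 lerD // ?sumr_ge0 //; last by move=> i _; exact: sqr_ge0.
by rewrite -(real_normK (num_real (w 0 k))) lerXn2r ?nnegrE // ltW.
Qed.

Lemma cutoff0 r : 0 < r -> 0 < cutoff r 0.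
Proof.
move=> r0; rewrite /cutoff big1 ?subr0 => [|k _]; last by rewrite mxE expr0n.
by rewrite /flat exprn_gt0 // expr0 mul1r expR_gt0.
Qed.

Definition zext (X : Type) (F : X -> M) r (g : X -> R) : X -> R := fun x =>
  if `[< zdom (F x) >] then cutoff r (to (zc (F x))) * g x else 0.

(** Three cases at a point of a plot: outside the chart [zc_proper] makes the function vanish
    nearby; where the coordinate exceeds r the cutoff does; elsewhere it is a product of smooth
    functions. Thus [g] need be smooth only over the closed ball of radius r. *)
Lemma zext_smooth (X : Type) (P : plots R X) (F : X -> M) r (g : X -> R) :
  diffeology P -> smooth_map P MP F -> 0 < r ->
  (forall n (U : set 'rV[R]_n) p y, P n U p -> U y -> zdom (F (p y)) ->
    `|to (zc (F (p y)))| <= r -> exists2 W, open W /\ W y & Cinf W (fun x => g (p x))) ->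
  smooth_fun P (zext F r g).
Proof.
move=> dP sF r0 Hg n U p pp; apply: Cinf_local => y Uy.
have pF : MP U (fun x => F (p x)) by exact: (sF _ _ _ pp).
have [dy|ndy] := pselect (zdom (F (p y))); last first.
  have [W [oW Wy WU HW]] := zc_proper r pF Uy ndy.
  exists W => //; apply: (Cinf_eq oW (f := fun=> 0)); last exact: Cinf_cst.
  move=> x Wx; rewrite /zext; case: asboolP => // dx.
  by rewrite cutoff_out ?mul0r //; exact: HW.
have [W [oW Wy WU pz Wd]] := zc_plot pF Uy dy.
have [_ cz] := (cplotsP _ _).1 pz.
have [small|big] := leP `|to (zc (F (p y)))| r.
  have [W' [oW' W'y] cg] := Hg _ _ _ _ pp Uy dy small.
  exists (W `&` W'); first by split.
  have oI := openI oW oW'.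
  apply: (Cinf_eq oI (f := fun x => cutoff r (to (zc (F (p x)))) * g (p x))).
    by move=> x [Wx _]; rewrite /zext; case: asboolP => // /(_ (Wd _ Wx)).
  apply: (Cinf_mul oI); last by apply: (Cinf_sub cg) => x [].
  apply: (Cinf_comp oI _ _ (cutoff_smooth r)) => // i.
  by apply: (Cinf_sub (cz i)) => x [].
have oV : open [set w : 'rV[R]_N | r < `|w|].
  have -> : [set w : 'rV[R]_N | r < `|w|] = (fun w : 'rV[R]_N => `|w|) @^-1` [set x | r < x] by [].
  by apply: open_comp; [move=> v _; exact: norm_continuous|exact: (@open_gt R)].
have oW' := open_preim oW oV cz.
exists [set x | W x /\ r < `|to (zc (F (p x)))|]; first by split.
apply: (Cinf_eq oW' (f := fun=> 0)); last exact: Cinf_cst.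
move=> x [Wx rx]; rewrite /zext; case: asboolP => // _.
by rewrite cutoff_out ?mul0r.
Qed.

Lemma zcoord_smooth r j : 0 < r ->
  smooth_fun MP (zext id r (fun x : M => to (zc x) 0 j)).
Proof.
move=> r0; apply: zext_smooth => //; first exact: dM.
move=> n U p y pp Uy dy _; have [W [oW Wy _ pz _]] := zc_plot pp Uy dy.
by exists W => //; have [_ cz] := (cplotsP _ _).1 pz; exact: cz.
Qed.

Lemma in_M_line (z w : Z) : in_M T eps z ->
  \forall t \near (0 : R), in_M T eps (z + t%:C *: w).
Proof.
move=> hz; have : \forall t \near (0 : R), [set w | in_M T eps (fr w)] (to z + t *: to w).
  apply: (@affine_continuous R _ (to z) (to w) 0); apply: open_nbhs_nbhs.
  by split; [exact: in_M_open|rewrite /= scale0r addr0 ctoK].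
by apply: filterS => t /=; rewrite -cto_lin ctoK.
Qed.

(** The coordinate vanishes at the origin, so only the value of the cutoff there enters the
    derivative of the product. That value is nonzero, which makes cut-off coordinates separate
    tangent vectors. *)
Lemma Zvec_coord v j : Zv 0 v (zext id 1 (fun x : M => to (zc x) 0 j)) = cutoff 1 0 * to v 0 j.
Proof.
have sphi := zcoord_smooth j (ltr01 : (0 : R) < 1).
set phi := zext _ _ _ in sphi *.
have i0 := in_M0 T eps.
have df : differentiable (fun w => phi (Zpt T eps (fr w))) (to 0).
  by apply: (Cinf_differentiable (Zpt_smooth sphi)); rewrite /= ctoK.
rewrite /Zvec chart_vectorE //= -(derive1_line _ df).
pose h (t : R) := cutoff 1 (to 0 + t *: to v) * to v 0 j.
have nE : \forall t \near (0 : R), t * h t = phi (Zpt T eps (fr (to 0 + t *: to v))).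
  have : \forall t \near (0 : R), in_M T eps (fr (to 0 + t *: to v)).
    by have := in_M_line v i0; apply: filterS => t; rewrite -cto_lin ctoK.
  apply: filterS => t ht; rewrite /phi /zext /=; case: asboolP; last first.
    by case; exact: zdom_Zpt.
  have E : (to 0 + t *: to v) 0 j = t * to v 0 j by rewrite cto0 add0r mxE.
  by rewrite zc_Zpt // cofK /h E => _; rewrite mulrCA.
have dh : derivable h 0 1.
  have dl := line_is_derive (f := cutoff 1) (x := to 0) (v := to v) (t := 0).
  have dC w : differentiable (cutoff 1) w by exact: (Cinf_differentiable (cutoff_smooth 1)).
  have d1 := dl (dC _).
  by apply: ex_derive.
have hd := is_derive_tmul dh.
have hE : h 0 = cutoff 1 0 * to v 0 j by rewrite /h scale0r addr0 cto0.
rewrite derive1E -(near_eq_derive (1 : R) nE) -hE.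
exact: derive_val.
Qed.

Lemma Zvec_inj u u' : Zv 0 u = Zv 0 u' -> u = u'.
Proof.
move=> E; rewrite -[u]ctoK -[u']ctoK; congr (fr _); apply/rowP => j.
have := Zvec_coord u j; rewrite E Zvec_coord => H2; apply/esym/(mulfI _ H2).
by rewrite gt_eqF // cutoff0.
Qed.

Lemma quasi_scale (t : R) u a : bergman_inv T u (t%:C *: a) ->
  bergman_inv T (t%:C *: u) a /\
  quasi_inverse T (t%:C *: u) a = t%:C *: quasi_inverse T u (t%:C *: a).
Proof.
have tc : Num.conj (t%:C : R[i]) = t%:C by apply/eqP; rewrite eq_complex /= oppr0 !eqxx.
have E : bergman T (t%:C *: u) a = bergman T u (t%:C *: a).
  apply/lfunP => x; rewrite !bergmanE /B0 !(tpZl, tpZm, tpZr) tc.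
  by rewrite scalerA.
move=> h; split; first by rewrite /bergman_inv E.
rewrite /quasi_inverse E -linearZ /= scalerBr !(tpZl, tpZm, tpZr) tc.
by rewrite scalerA.
Qed.

(* (t u)^a = t u^(t a), whose derivative at t = 0 is u. *)
Lemma chart_vector_origin a u : Mset T eps (dual_class T 0 a) ->
  chart_vector Mat (pt T eps ^~ a) 0 u = Zv 0 u.
Proof.
move=> h0; apply/funext => phi.
have [sphi|nphi] := pselect (smooth_fun MP phi); last first.
  by rewrite /Zvec /chart_vector /velocity; case: asboolP.
have oT := @openT 'rV[R]_1.
have pta : cplots setT (fun x : 'rV[R]_1 => (x 0 0)%:C *: a).
  apply: cplots_scale; last exact: cplots_cst.
  by split; [exact: Cinf_coord|exact: Cinf_cst].
have ptu : cplots setT (fun x : 'rV[R]_1 => (x 0 0)%:C *: u).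
  apply: cplots_scale; last exact: cplots_cst.
  by split; [exact: Cinf_coord|exact: Cinf_cst].
have pu := cplots_cst u oT.
have oB := @bergman_inv_open R Z T _ _ _ _ pu pta.
set W := [set x | _] in oB.
have oD := @M_chart_Dopen _ (ex_intro _ a erefl) _ _ _ ptu.
have W0 : W 0 by split=> //; rewrite mxE scale0r; exact: bergman_inv0r.
have sW : W `<=` setT by [].
have pq := quasi_smooth (plot_sub dZ pu oB sW) (plot_sub dZ pta oB sW) (fun y (h : W y) => h.2).
pose q (t : R) := quasi_inverse T u (t%:C *: a).
have q0 : q 0 = u by rewrite /q scale0r quasi0r.
have [_ cq] := (cplotsP _ _).1 pq.
have dq j : derivable (fun t : R => to (q t) 0 j) 0 1.
  have E1 : (fun t : R => to (q t) 0 j) =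
      (fun t : R => (fun x : 'rV[R]_1 => to (quasi_inverse T u ((x 0 0)%:C *: a))) (line1 t) 0 j).
    by apply/funext => t; rewrite /q [line1 t 0 0]mxE.
  by rewrite E1; exact: (plot1_derivable W0 (cq j)).
have E0 : (0 : R)%:C *: q 0 = 0 by rewrite scale0r.
have := @Zvec_curve phi (fun t => t%:C *: q t) u; rewrite /= E0 => /(_ (in_M0 T eps) sphi) H.
have {}H : is_derive (0 : R) (1 : R) (fun t : R => phi (Zpt T eps (t%:C *: q t))) (Zv 0 u phi).
  apply: H => j; have -> : (fun t : R => to (t%:C *: q t) 0 j) = (fun t => t * to (q t) 0 j).
    by apply/funext => t; rewrite ctoZ mxE.
  by have := is_derive_tmul (dq j); rewrite q0.
rewrite /chart_vector /velocity; case: asboolP => // _; rewrite derive1E -[RHS](@derive_val _ _ _ _ _ _ _ H).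
apply: near_eq_derive.
have cl := @line1_continuous R 0.
have l0 : line1 (0 : R) = 0 by apply/rowP => i; rewrite !mxE.
have n1 : \forall t \near (0 : R), W (line1 t).
  by apply: (cl W); apply: open_nbhs_nbhs; rewrite l0.
have n2 : \forall t \near (0 : R), Mset T eps (dual_class T ((t : R)%:C *: u) a).
  have : \forall t \near (0 : R), (setT `&` (fun x : 'rV[R]_1 => (x 0 0)%:C *: u) @^-1` [set z | Mset T eps (dual_class T z a)]) (line1 t).
    by apply: cl; apply: open_nbhs_nbhs; split=> //; rewrite l0; split=> //=; rewrite mxE scale0r.
  by apply: filterS => t [_] /=; rewrite mxE.
apply: filterS2 n1 n2 => t [_]; rewrite mxE => Bt Mt; congr phi; apply: M_inj.
rewrite add0r sval_pt //; have [B E] := quasi_scale Bt.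
have ED : dual_class T (t%:C *: u) a = dual_class T (t%:C *: q t) 0.
  by rewrite (dual_class_shift _ B) subrr E.
by rewrite ED /Zpt sval_pt // -ED.
Qed.

(** [jrel] may use any chart through the origin. Since (z,a) is a member of the class of (0,0), z =
    0^(-a) = 0, and by [chart_vector_origin] all these charts have the same vectors; [Zvec_inj] then
    recovers u. *)
Lemma jrel_origin u w : jrel Mat (base_point T eps) (Zv 0 u) w ->
  w = Zv 0 ('i%C *: u).
Proof.
move=> [c [z [u1 [[a ->] /= hz E Ev ->]]]].
have z0 : z = 0.
  have := mem_dual_class T z a; have := congr1 sval E; rewrite sval_pt // => ->.
  by rewrite /= /dual_class /= => -[_ ->]; rewrite quasi0l.
subst z; rewrite chart_vector_origin // in Ev; rewrite chart_vector_origin //.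
by rewrite (Zvec_inj Ev).
Qed.

End ManifoldTangent.

(** * The groups K and G *)

Section LinearPlots.
Variable R : realType.

Lemma cplots_linear (V W : vectType R[i]) (F : V -> W) n (U : set 'rV[R]_n) p :
  linear F -> cplots U p -> cplots U (fun x => F (p x)).
Proof.
move=> linF [oU Hp]; split=> // l.
pose F' : {linear V -> W} := HB.pack F (GRing.isLinear.Build _ _ _ _ F linF).
exact: (Hp (l \o F' : {linear V -> R[i]^o})).
Qed.

Lemma cplots_sum (V : vectType R[i]) n (U : set 'rV[R]_n) I (r : seq I) (p : I -> 'rV[R]_n -> V) :
  open U -> (forall i, cplots U (p i)) -> cplots U (fun x => \sum_(i <- r) p i x).
Proof.
move=> oU Hp; elim: r => [|i r IH].
  apply: (plot_eq (@cplots_diffeology R V) (cplots_cst 0 oU)) => x _.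
  by rewrite big_nil.
apply: (plot_eq (@cplots_diffeology R V) (cplots_add (Hp i) IH)) => x _.
by rewrite big_cons.
Qed.

Lemma cplots_pair (V W : vectType R[i]) n (U : set 'rV[R]_n) p q :
  @cplots R V n U p -> @cplots R W n U q -> @cplots R (V * W)%type n U (fun x => (p x, q x)).
Proof.
move=> pp pq.
have p1 := cplots_linear (F := fun v : V => (v, 0) : V * W) _ pp.
have p2 := cplots_linear (F := fun w : W => (0, w) : V * W) _ pq.
apply: (plot_eq (@cplots_diffeology R _) (cplots_add (p1 _) (p2 _))).
- by move=> a u v; rewrite (_ : a *: _ + _ = (a *: u + v, a *: 0 + 0)) // scaler0 addr0.
- by move=> a u v; rewrite (_ : a *: _ + _ = (a *: 0 + 0, a *: u + v)) // scaler0 addr0.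
- by move=> x _; rewrite (_ : _ + _ = (p x + 0, 0 + q x)) // addr0 add0r.
Qed.

Variable Z : vectType R[i].
Local Notation b := (vbasis {:Z}).

Lemma cplots_end n (U : set 'rV[R]_n) (k : _ -> 'End(Z)) : open U ->
  (forall i, cplots U (fun x => k x b`_i)) -> cplots U k.
Proof.
move=> oU Hk; pose El i (z : Z) : 'End(Z) := linfun (fun x : Z => coord b i x *: z).
have ElE i z x : El i z x = coord b i x *: z.
  have L : linear (fun x : Z => coord b i x *: z).
    by move=> a u v; rewrite linearP scalerDl scalerA.
  pose F : {linear Z -> Z} := HB.pack (fun x : Z => coord b i x *: z) (GRing.isLinear.Build _ _ _ _ (fun x : Z => coord b i x *: z) L).
  exact: (lfunE F x).
have linE i : linear (El i).
  move=> a u v; apply/lfunP => x; rewrite add_lfunE scale_lfunE !ElE scalerDr.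
  by rewrite !scalerA mulrC.
have : cplots U (fun x => \sum_i El i (k x b`_i)).
  by apply: cplots_sum => // i; apply: cplots_linear (linE i) (Hk i).
move=> H; apply: (plot_eq (@cplots_diffeology R _) H) => x _; apply/lfunP => z.
rewrite sum_lfunE {2}(coord_vbasis (memvf z)) linear_sum /=.
by apply: eq_bigr => i _; rewrite ElE linearZ.
Qed.

End LinearPlots.

Section ConnectedImage.
Variables (R : realType) (X Y : Type) (P : plots R X) (P' : plots R Y).

Lemma Dconnected_image (F : X -> Y) (C : set X) : diffeology P -> smooth_map P P' F ->
  Dconnected P C -> Dconnected P' (F @` C).
Proof.
move=> dP sF cC A B oA oB sub [_ [[a Ca <-] Aa]] [_ [[b Cb <-] Bb]].
have pre E : Dopen P' E -> Dopen P (F @^-1` E).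
  by move=> oE n U p pp; exact: (oE _ _ _ (sF _ _ _ pp (fun _ _ => Logic.I))).
have [|||x [Cx ABx]] := cC _ _ (pre _ oA) (pre _ oB).
- by move=> x Cx; apply: sub; exists x.
- by exists a.
- by exists b.
- by exists (F x); split=> //; exists x.
Qed.
End ConnectedImage.

Section KGroup.
Variables (R : realType) (Z : vectType R[i]) (T : hermitian_jordan_triple Z).
Local Notation aut := (triple_automorphism T).
Local Notation K := (Kset T).

Lemma aut1 : aut \1%VF.
Proof.
split=> [|u v w]; last by rewrite !id_lfunE.
by apply/lker0P => x y; rewrite !id_lfunE.
Qed.

Lemma aut_comp k l : aut k -> aut l -> aut (k \o l)%VF.
Proof.
move=> [k0 Hk] [l0 Hl]; split; last by move=> u v w; rewrite !comp_lfunE Hl Hk.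
apply/lker0P => x y; rewrite !comp_lfunE => /(lker0P k0) /(lker0P l0) //.
Qed.

Lemma aut_inv k : aut k -> aut (k^-1)%VF.
Proof.
move=> [k0 Hk]; have inj : injective (k^-1)%VF.
  by move=> x y E; rewrite -[x](lker0_lfunVK k0) E lker0_lfunVK.
split; first exact/lker0P.
move=> u v w; apply/(lker0P k0); rewrite Hk.
by rewrite !(lker0_lfunVK k0).
Qed.

Lemma Kset_aut k : K k -> aut k.
Proof. by move=> [C [CS _ _ /CS]]. Qed.

Lemma Kset1 : K \1%VF.
Proof.
exists [set \1%VF]; split=> //; first by move=> _ ->; exact: aut1.
by move=> A B _ _ _ [_ [-> A1]] [_ [-> B1]]; exists \1%VF.
Qed.

Lemma lcomp_smooth (k : 'End(Z)) : smooth_map (@cplots R _) (@cplots R _) (fun c : 'End(Z) => (k \o c)%VF).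
Proof.
move=> n U p pp _; apply: cplots_linear pp => a u v.
by rewrite comp_lfunDr comp_lfunZr.
Qed.

(** The translate of a connected set from id to l by k runs from k to k l and meets the connected
    set from id to k. *)
Lemma Kset_comp k l : K k -> K l -> K (k \o l)%VF.
Proof.
move=> [C [CS cC C1 Ck]] [D [DS cD D1 Dl]].
have ak := CS _ Ck.
exists (C `|` [set (k \o d)%VF | d in D]); split.
- by move=> x [/CS //|[d /DS ad <-]]; exact: aut_comp.
- apply: (Dconnected_union (x := k)) => //.
    exact: (Dconnected_image (@cplots_diffeology R _) (lcomp_smooth k)).
  by exists \1%VF => //; rewrite comp_lfun1r.
- by left.
- by right; exists l.
Qed.

Lemma Kset_inv k : K k -> K (k^-1)%VF.
Proof.
move=> [C [CS cC C1 Ck]]; have ak := CS _ Ck.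
exists [set (k^-1 \o c)%VF | c in C]; split.
- by move=> _ [c /CS ac <-]; apply: aut_comp => //; exact: aut_inv.
- exact: (Dconnected_image (@cplots_diffeology R _) (lcomp_smooth _)).
- by exists k => //; rewrite lker0_compVf //; case: ak.
- by exists \1%VF => //; rewrite comp_lfun1r.
Qed.

Lemma Kset_compV k : K k -> (k \o k^-1)%VF = \1%VF.
Proof. by move=> /Kset_aut[k0 _]; exact: lker0_compfV. Qed.

(** Every direction has a nonzero multiple inside M, so a linear map is determined by its effect on
    points of M. *)
Lemma in_M_small eps (z : Z) : exists2 t : R, t != 0 & in_M T eps (t%:C *: z).
Proof.
have h0 : [set w | in_M T eps (cof w)] 0 by rewrite /= -(cto0 Z) ctoK; exact: in_M0.
have [r r0 Hr] := open_normP (@in_M_open R Z T eps) h0.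
pose t := r / 2 / (1 + `|cto z|); have d0 : 0 < 1 + `|cto z| by rewrite ltr_wpDr.
have t0 : 0 < t by rewrite !divr_gt0.
exists t; first by rewrite gt_eqF.
have /Hr : `|t *: cto z| < r.
  rewrite normrZ gtr0_norm // /t.
  have : r / 2 / (1 + `|cto z|) * `|cto z| <= r / 2.
    rewrite -mulrA ger_pMr ?divr_gt0 // mulrC ler_pdivrMr // mul1r.
    by rewrite lerDr.
  by move/le_lt_trans; apply; lra.
by rewrite add0r /= -ctoZ ctoK.
Qed.

End KGroup.

(** * The action of G and its Lie algebra *)

Section GroupAction.
Variables (R : realType) (Z : vectType R[i]) (T : hermitian_jordan_triple Z).
Variables (eps : int) (E : vectType R) (G : groupType) (AG : set (chart E G)).
Variables (act : G -> Mpt T eps -> Mpt T eps) (incK : 'End(Z) -> G).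
Hypothesis hG : is_Geps AG act incK.
Local Notation M := (Mpt T eps).
Local Notation MP := (@Mplots R Z T eps).
Local Notation GP := (Gplots AG).
Local Notation to := (@cto R Z).
Local Notation fr := (@cof R Z).
Local Notation Zv := (@Zvec R Z T eps).
Local Notation K := (Kset T).
Local Notation T1 := (tangent GP 1%g).
Local Notation dM := (@M_diffeology R Z T eps).
Local Notation dZ := (@cplots_diffeology R Z).

Lemma rplots_model : (cancel (rVof (vbasis {:E})) (vecof (vbasis {:E})) *
  cancel (vecof (vbasis {:E})) (rVof (vbasis {:E})))%type.
Proof.
by split; [exact: (rVofK (vbasisP _))|exact: (vecofK (vbasisP _))].
Qed.

Lemma G_diffeology : diffeology GP.
Proof.
apply: aplots_diffeology.
  exact: (model_diffeology (@rplotsP R E)).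
have [[[e [Ae He]] _ _ _] _ _] := Geps_lie hG.
by move=> x; have [j [z h1 h2]] := He x; exists (e j), z.
Qed.

Lemma G_mul : smooth_map (prod_plots GP GP) GP (fun x => (x.1 * x.2)%g).
Proof. by have [] := Geps_lie hG. Qed.

Lemma G_inv : smooth_map GP GP (fun x => x^-1%g).
Proof. by have [] := Geps_lie hG. Qed.

Lemma G_span : exists F : 'I_(\dim {:E}) -> (G -> R) -> R, forall v, T1 v ->
  exists r : 'I_(\dim {:E}) -> R, forall phi, v phi = \sum_i r i * F i phi.
Proof.
have [mG _ _] := Geps_lie hG.
exact: (manifold_span rplots_model.1 rplots_model.2 (@rplotsP R E) 1%g mG).
Qed.

Lemma act_inj g g' : act g =1 act g' -> g = g'.
Proof.
move=> H; have : (g'^-1 * g)%g = 1%g.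
  apply: (Geps_effective hG) => x; rewrite (Geps_actM hG) H -(Geps_actM hG).
  by rewrite mulVg (Geps_act1 hG).
by move/(congr1 (fun x => g' * x)%g); rewrite mulVKg mulg1.
Qed.

Lemma K_action_uniq (k : 'End(Z)) (g g' : M -> M) : K_action k g -> K_action k g' -> g =1 g'.
Proof.
move=> Hg Hg' x; have [z [a [_ _ hx]]] := M_cover x.
by apply: M_inj; rewrite (Hg _ _ _ hx) (Hg' _ _ _ hx).
Qed.

Lemma incK_comp k l : K k -> K l -> incK (k \o l)%VF = (incK k * incK l)%g.
Proof.
move=> hk hl; apply: act_inj.
apply: (K_action_uniq (k := (k \o l)%VF)); first exact/(Geps_incK hG)/Kset_comp.
move=> x z a hx; rewrite (Geps_actM hG) !comp_lfunE.
by apply: (Geps_incK hG hk); exact: (Geps_incK hG hl).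
Qed.

Lemma incK1 : incK \1%VF = 1%g.
Proof.
have := incK_comp (Kset1 T) (Kset1 T); rewrite comp_lfun1l.
by move/(congr1 (fun x => (incK \1%VF)^-1 * x)%g); rewrite mulVg mulKg.
Qed.

Lemma incK_inv k : K k -> incK (k^-1)%VF = (incK k)^-1%g.
Proof.
move=> hk; have := incK_comp hk (Kset_inv hk); rewrite (Kset_compV hk) incK1.
by move/(congr1 (fun x => (incK k)^-1 * x)%g); rewrite mulKg mulg1.
Qed.

Lemma act_Zpt k z : K k -> in_M T eps z ->
  in_M T eps (k z) /\ act (incK k) (Zpt T eps z) = Zpt T eps (k z).
Proof.
move=> hk hz; have := Geps_incK hG hk (x := Zpt T eps z) (z := z) (a := 0).
rewrite sval_pt // linear0 => /(_ erefl) H.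
have h : in_M T eps (k z) by rewrite /in_M -H; exact: (svalP (act (incK k) (Zpt T eps z))).
by split=> //; apply: M_inj; rewrite H sval_pt.
Qed.

Lemma incK_inj k l : K k -> K l -> incK k = incK l -> k = l.
Proof.
move=> hk hl E0; apply/lfunP => z; have [t t0 tz] := in_M_small T eps z.
have [h1 e1] := act_Zpt hk tz; have [h2 e2] := act_Zpt hl tz.
move: e1; rewrite E0 e2 => /(congr1 (@zc R Z T eps)); rewrite !zc_Zpt // !linearZ /=.
have t1 : t%:C != 0 :> R[i] by apply: contra t0; rewrite eq_complex /= => /andP[].
by move/(scalerI t1).
Qed.

Lemma smooth2_act psi : smooth_fun MP psi -> smooth2 GP MP (fun g x => psi (act g x)).
Proof.
by move=> sp n U p pp; apply: (sp _ _ (fun x => act (p x).1 (p x).2)); exact: (Geps_smooth hG pp).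
Qed.

Lemma generatesE tau xi psi z : generates act tau xi -> in_M T eps z -> smooth_fun MP psi ->
  tau (fun g => psi (act g (Zpt T eps z))) = Zv z (xi z) psi.
Proof.
move=> H hz sp; have := congr1 (fun F => F psi) (H z hz).
by rewrite /differential; case: asboolP.
Qed.

Lemma generatesP tau xi : (forall z psi, in_M T eps z -> smooth_fun MP psi ->
  tau (fun g => psi (act g (Zpt T eps z))) = Zv z (xi z) psi) -> generates act tau xi.
Proof.
move=> H z hz; apply/funext => psi; rewrite /differential.
by case: asboolP => sp; [exact: H|rewrite Zvec0].
Qed.

Lemma Zvec_tangent z u : in_M T eps z -> tangent MP (Zpt T eps z) (Zv z u).
Proof.
move=> hz; have := @local_tangent R M MP dM (fun t : R => Zpt T eps (z + t%:C *: u)).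
rewrite scale0r addr0; apply.
have pl : cplots setT (fun x : 'rV[R]_1 => z + (x 0 0)%:C *: u).
  apply: cplots_add; first exact: (cplots_cst _ (@openT _)).
  apply: cplots_scale; last exact: (cplots_cst _ (@openT _)).
  by split; [exact: Cinf_coord|exact: Cinf_cst].
have oW := @in_M_plot_open R Z T eps _ _ _ pl.
exists [set x : 'rV[R]_1 | setT x /\ in_M T eps (z + (x 0 0)%:C *: u)].
  by split=> //=; rewrite mxE scale0r addr0.
by apply: Zpt_plot; [apply: (plot_sub dZ pl oW)|move=> x []].
Qed.

Lemma k_algebra0 : k_algebra T 0.
Proof.
exists (fun=> \1%VF); split=> //.
- exact: (cplots_cst _ (@openT _)).
- by move=> t; exact: Kset1.
- by move=> l; rewrite linear0 /=; exact: is_derive_cst.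
Qed.

Lemma k_curve (c : R -> 'End(Z)) : smooth_curve (@cplots R _) c -> c 0 = \1%VF ->
  (forall t, K (c t)) -> smooth_curve GP (fun t => incK (c t)) /\ T1 (velocity GP (fun t => incK (c t))).
Proof.
move=> sc c0 cK; have s : smooth_curve GP (fun t => incK (c t)).
  by apply: (Geps_incK_smooth hG sc) => x _; exact: cK.
by split=> //; have := tangent_vel s; rewrite c0 incK1.
Qed.

Lemma k_generates (c : R -> 'End(Z)) kappa : smooth_curve (@cplots R _) c -> c 0 = \1%VF ->
  (forall t, K (c t)) ->
  (forall l : {linear 'End(Z) -> R[i]^o},
    is_derive (0 : R) (1 : R) (fun t : R => complex.Re (l (c t))) (complex.Re (l kappa))) ->
  generates act (velocity GP (fun t => incK (c t))) (fun z => kappa z).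
Proof.
move=> sc c0 cK dc; have [s _] := k_curve sc c0 cK.
apply: generatesP => z psi hz sp.
have sphi : smooth_fun GP (fun g => psi (act g (Zpt T eps z))).
  exact: (smooth2_left G_diffeology dM (Zpt T eps z) (smooth2_act sp)).
have := velocity_is_derive (smooth_curve_local s) sphi.
have -> : (fun t => psi (act (incK (c t)) (Zpt T eps z))) = (fun t => psi (Zpt T eps (c t z))).
  by apply/funext => t; have [_ ->] := act_Zpt (cK t) hz.
move=> H; have := @Zvec_curve R Z T eps psi (fun t => c t z) (kappa z).
rewrite /= c0 id_lfunE => /(_ hz sp) H2.
rewrite -(@derive_val _ _ _ _ _ _ _ H); apply: derive_val; apply: H2 => j.
pose ev (x : 'End(Z)) := x z.
have Lev : linear ev by move=> a u v; rewrite /ev add_lfunE scale_lfunE.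
case: (split_ordP j) => i ->.
  pose F (x : 'End(Z)) : R[i]^o := coord (vbasis {:Z}) i (ev x).
  have LF : linear F by move=> a u v; rewrite /F Lev linearP.
  pose F' : {linear 'End(Z) -> R[i]^o} := HB.pack F (GRing.isLinear.Build _ _ _ _ F LF).
  have := dc F'; rewrite /= /F /ev Re_coord; congr is_derive.
  by apply/funext => t; rewrite Re_coord.
pose F (x : 'End(Z)) : R[i]^o := - 'i%C * coord (vbasis {:Z}) i (ev x).
have LF : linear F.
  by move=> a u v; rewrite /F Lev linearP mulrDr /= {1}/GRing.scale /= mulrCA.
pose F' : {linear 'End(Z) -> R[i]^o} := HB.pack F (GRing.isLinear.Build _ _ _ _ F LF).
have FE x : complex.Re (F x) = to (ev x) 0 (rshift _ i).
  by rewrite /F Re_mul /= -Im_coord oppr0 mul0r sub0r mulN1r opprK.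
have := dc F'; rewrite /= FE; congr is_derive.
by apply/funext => t; rewrite FE.
Qed.

Lemma generates_uniq tau tau' v kappa : k_algebra T kappa -> T1 tau -> T1 tau' ->
  generates act tau (fun z => p_field T eps v z + kappa z) ->
  generates act tau' (fun z => p_field T eps v z + kappa z) -> tau = tau'.
Proof.
move=> hk t1 t2 g1 g2; have [x [_ H]] := Geps_algebra_unique hG v hk.
by rewrite -(H tau) // (H tau').
Qed.

(** On M, [Geps_algebra] brings the field of tau to the form p_field v + kappa, for which uniqueness
    of the generator is available. *)
Lemma generates_inj tau tau' xi : T1 tau -> T1 tau' ->
  generates act tau xi -> generates act tau' xi -> tau = tau'.
Proof.
move=> t1 t2 g1 g2; have [v [kappa [hk g3]]] := Geps_algebra hG t1.
apply: (generates_uniq hk t1 t2 g3) => z hz.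
by rewrite (g2 z hz) -(g1 z hz) (g3 z hz).
Qed.

(* The element of [T_1 G] that generates the field [v^eps]. *)
Definition tau_p (v : Z) : (G -> R) -> R :=
  if pselect (exists tau, T1 tau /\ generates act tau (p_field T eps v)) is left h
  then projT1 (cid h) else fun=> 0.

Lemma tau_pP v : T1 (tau_p v) /\ generates act (tau_p v) (p_field T eps v).
Proof.
rewrite /tau_p; case: pselect => [h|[]]; first by case: (cid h).
have [tau [[t1 g1] _]] := Geps_algebra_unique hG v k_algebra0.
exists tau; split=> //; move: g1; congr (generates act tau).
by apply/funext => z; rewrite zero_lfunE addr0.
Qed.

Lemma tau_p_uniq v tau : T1 tau -> generates act tau (p_field T eps v) -> tau = tau_p v.
Proof. by move=> t1 g1; have [t2 g2] := tau_pP v; exact: generates_inj g1 g2. Qed.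

Lemma p_spaceP tau : p_space AG act tau <-> exists v, tau = tau_p v.
Proof.
split=> [[t1 [v gv]]|[v ->]]; first by exists v; exact: tau_p_uniq.
by have [t1 g1] := tau_pP v; split=> //; exists v.
Qed.

Lemma p_field_lin (t : R) u v z : p_field T eps (t%:C *: u + v) z =
  t%:C *: p_field T eps u z + p_field T eps v z.
Proof.
have tc : Num.conj (t%:C : R[i]) = t%:C by apply/eqP; rewrite eq_complex /= oppr0 !eqxx.
by rewrite /p_field tpDm' tpZm tc !scalerDr !scalerA mulrC addrACA.
Qed.

Lemma generates_lin (t : R) s s' xi xi' : generates act s xi -> generates act s' xi' ->
  generates act (fun phi => t * s phi + s' phi) (fun z => t%:C *: xi z + xi' z).
Proof.
move=> g1 g2; apply: generatesP => z psi hz sp.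
by rewrite (generatesE g1 hz sp) (generatesE g2 hz sp) Zvec_lin.
Qed.

Lemma tau_p_lin (t : R) u v : tau_p (t%:C *: u + v) = (fun phi => t * tau_p u phi + tau_p v phi).
Proof.
have [t1 g1] := tau_pP u; have [t2 g2] := tau_pP v.
apply/esym/tau_p_uniq; first exact: (T1_lin G_diffeology G_mul).
have := generates_lin t g1 g2; congr (generates act _).
by apply/funext => z; rewrite p_field_lin.
Qed.

(** The decomposition into p and k. The k-part is kept as the velocity of an explicit curve in K,
    because such a curve can be carried over to [H] by f. *)
Lemma T1_split tau : T1 tau -> exists v (c : R -> 'End(Z)), [/\
  smooth_curve (@cplots R _) c, c 0 = \1%VF, forall t, K (c t) &
  tau = (fun phi => tau_p v phi + velocity GP (fun t => incK (c t)) phi)].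
Proof.
move=> t1; have [v [kappa [hk g1]]] := Geps_algebra hG t1.
have [c [sc c0 cK dc]] := hk; have [_ t2] := k_curve sc c0 cK.
have g2 := k_generates sc c0 cK dc; have [t3 g3] := tau_pP v.
exists v, c; split=> //; apply: (generates_inj t1 _ g1).
  have := T1_lin G_diffeology G_mul 1 t3 t2; congr (tangent _ _ _).
  by apply/funext => phi; rewrite mul1r.
have := generates_lin 1 g3 g2; congr (generates act _ _).
  by apply/funext => phi; rewrite mul1r.
by apply/funext => z; rewrite scale1r.
Qed.

End GroupAction.

(** * The bracket of two elements of p *)

Section GroupBracket.
Variables (R : realType) (Z : vectType R[i]) (T : hermitian_jordan_triple Z).
Variables (eps : int) (E : vectType R) (G : groupType) (AG : set (chart E G)).
Variables (act : G -> Mpt T eps -> Mpt T eps) (incK : 'End(Z) -> G).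
Hypothesis hG : is_Geps AG act incK.
Local Notation M := (Mpt T eps).
Local Notation MP := (@Mplots R Z T eps).
Local Notation GP := (Gplots AG).
Local Notation to := (@cto R Z).
Local Notation fr := (@cof R Z).
Local Notation Zv := (@Zvec R Z T eps).
Local Notation T1 := (tangent GP 1%g).
Local Notation dM := (@M_diffeology R Z T eps).
Local Notation dG := (G_diffeology hG).
Local Notation mulG := (G_mul hG).
Local Notation tau_p := (tau_p AG act).

Lemma ZvecE z u psi : in_M T eps z -> smooth_fun MP psi ->
  Zv z u psi = 'D_(to u) (fun y => psi (Zpt T eps (fr y))) (to z).
Proof. by move=> h sp; exact: (chart_vectorE u h sp). Qed.

Definition hess (psi : M -> R) (z u w : Z) : R :=
  'D_(to w) (fun y => 'D_(to u) (fun y' => psi (Zpt T eps (fr y'))) y) (to z).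

Lemma hessC psi z u w : in_M T eps z -> smooth_fun MP psi -> hess psi z u w = hess psi z w u.
Proof.
move=> hz sp; have hz' : [set w | in_M T eps (fr w)] (to z) by rewrite /= ctoK.
exact: (schwarz (to w) (to u) (@in_M_open R Z T eps) hz' (Zpt_smooth sp)).
Qed.

(** A field that equals u + t q1 + t^2 q2 at z + t w is differentiated at t = 0: the coefficient
    contributes q1, the base point contributes the second derivative of psi. *)
Lemma Zvec_second psi z w u q1 q2 : smooth_fun MP psi -> in_M T eps z ->
  is_derive (0 : R) (1 : R)
    (fun t : R => Zv (z + t%:C *: w) (t%:C *: (t%:C *: q2 + q1) + u) psi)
    (Zv z q1 psi + hess psi z u w).
Proof.
move=> sp hz; rewrite /hess; set Psi := fun y' => psi (Zpt T eps (fr y')).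
have cP := Zpt_smooth sp; rewrite -/Psi in cP.
pose A v (t : R) := 'D_(to v) Psi (to z + t *: to w).
have hz' : [set w | in_M T eps (fr w)] (to z + 0 *: to w) by rewrite /= scale0r addr0 ctoK.
have E0 : to z + (0 : R) *: to w = to z by rewrite scale0r addr0.
have dA v : is_derive (0 : R) (1 : R) (A v) ('D_(to w) (fun y => 'D_(to v) Psi y) (to z)).
  have := line_is_derive (Cinf_differentiable (Cinf_derive (to v) cP) hz').
  by rewrite E0.
have dA2 : is_derive (0 : R) (1 : R) (fun t => t * A q2 t + A q1 t)
   (A q2 0 + 'D_(to w) (fun y => 'D_(to q1) Psi y) (to z)).
  by apply: is_deriveD; exact: is_derive_tmul.
have dA3 : is_derive (0 : R) (1 : R) (fun t => t * (t * A q2 t + A q1 t))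
   (0 * A q2 0 + A q1 0).
  exact: (is_derive_tmul (h := fun t => t * A q2 t + A q1 t)).
have dA4 := is_deriveD dA3 (dA u).
have A0 : A q1 0 = Zv z q1 psi by rewrite /A E0 (ZvecE q1 hz sp).
rewrite mul0r add0r A0 in dA4.
apply: near_eq_is_derive dA4 => //.
have := in_M_line w hz; apply: filterS => t ht.
have ZE v : Zv (z + t%:C *: w) v psi = A v t by rewrite (ZvecE v ht sp) cto_lin.
by rewrite !Zvec_lin // !ZE.
Qed.

(** The inner vector acts at z through the value w of its field. After [tan_swap] the outer field is
    differentiated along the line z + t w, on which it is quadratic in t. *)
Lemma generates_twice s t u v psi z : T1 s -> T1 t ->
  generates act s (p_field T eps u) -> generates act t (p_field T eps v) ->
  in_M T eps z -> smooth_fun MP psi ->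
  s (fun y => t (fun x => psi (act (y * x)%g (Zpt T eps z)))) =
  Zv z (eps%:~R *: (tp T (p_field T eps v z) u z + tp T z u (p_field T eps v z))) psi +
  hess psi z (p_field T eps u z) (p_field T eps v z).
Proof.
move=> t1 t2 g1 g2 hz sp; set w := p_field T eps v z.
have sF := smooth2_act hG sp.
have -> : (fun y => t (fun x => psi (act (y * x)%g (Zpt T eps z)))) =
    (fun y => Zv z w (fun x => psi (act y x))).
  apply/funext => y.
  have -> : (fun x => psi (act (y * x)%g (Zpt T eps z))) = (fun x => psi (act y (act x (Zpt T eps z)))).
    by apply/funext => x; rewrite (Geps_actM hG).
  exact: (generatesE (psi := fun x => psi (act y x)) g2 hz (smooth2_right dG dM y sF)).
rewrite (tan_swap dG dM t1 (Zvec_tangent w hz) sF).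
set phi := fun y => s _.
have sphi : smooth_fun MP phi by exact: (tan_param dM dG t1 (smooth2_swap sF)).
have := @Zvec_curve R Z T eps phi (fun t : R => z + t%:C *: w) w; rewrite /= scale0r addr0.
move=> /(_ hz sphi (line_coord z w)) H1.
set q1 := eps%:~R *: _.
have H2 := Zvec_second w (p_field T eps u z) q1 (eps%:~R *: tp T w u w) sp hz.
rewrite -(@derive_val _ _ _ _ _ _ _ H1) -(@derive_val _ _ _ _ _ _ _ H2).
apply: near_eq_derive; have := in_M_line w hz; apply: filterS => r hr.
rewrite /phi (generatesE g1 hr sp); congr (Zv _ _ psi).
have pE x : p_field T eps u x = u + eps%:~R *: tp T x u x by [].
rewrite /q1 !pE; move: (w) => w'; rewrite !(tpDr, tpDl', tpZr, tpZl) !scalerDr !scalerA.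
rewrite ![_%:C * eps%:~R]mulrC; set a := (eps%:~R : R[i]); set b := (r%:C : R[i]).
apply: additive_sep => l lD lN; rewrite !(lD, lN).
by rewrite [a * (b * b)]mulrC; lra.
Qed.

(** The symmetric second derivatives cancel, and so do the cubic terms, by [jordan_swap']. The
    remaining field is linear in z and sesquilinear in (u,v). *)
Lemma lie_generates u v : generates act (lie_bracket GP (tau_p u) (tau_p v))
  (fun z => (eps%:~R *: (tp T v u z - tp T u v z)) *+ 2).
Proof.
have [t1 g1] := tau_pP hG u; have [t2 g2] := tau_pP hG v.
apply: generatesP => z psi hz sp.
have sphi : smooth_fun GP (fun g => psi (act g (Zpt T eps z))).
  exact: (smooth2_left dG dM (Zpt T eps z) (smooth2_act hG sp)).
rewrite (lie_bracketE dG mulG t1 t2 sphi).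
rewrite (generates_twice t1 t2 g1 g2 hz sp) (generates_twice t2 t1 g2 g1 hz sp).
rewrite (hessC _ _ hz sp).
rewrite opprD addrACA subrr addr0.
have ZB a b : Zv z a psi - Zv z b psi = Zv z (a - b) psi.
  have -> : a - b = (-1 : R)%:C *: b + a by rewrite rmorphN1 scaleN1r addrC.
  by rewrite Zvec_lin // mulN1r addrC.
rewrite ZB; congr (Zv _ _ _).
rewrite -scalerBr scalerMnr; congr (_ *: _).
rewrite /p_field !(tpDr, tpDl', tpZr, tpZl).
rewrite (tpC T z u v) (tpC T z v u) (tpC T (tp T z v z) u z) (tpC T (tp T z u z) v z).
rewrite (jordan_swap' T z u v) (tpC T v u z) (tpC T u v z).
set a := eps%:~R *: _.
by apply: additive_sep => l lD lN; rewrite !(lD, lN, mulr2n); lra.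
Qed.

End GroupBracket.

(** * The bundle Q *)

Section ComplexCharts.
Variables (R : realType) (V : vectType R[i]) (X : Type) (A : set (chart V X)).
Hypothesis mA : is_manifold (@cplots R V) A.
Local Notation P := (caplots A).
Local Notation to := (@cto R V).
Local Notation fr := (@cof R V).

Lemma manifold_diffeology : diffeology P.
Proof.
apply: aplots_diffeology; first exact: cplots_diffeology.
have [[e [Ae He]] _ _ _] := mA.
by move=> x; have [j [z h1 h2]] := He x; exists (e j), z.
Qed.

Lemma chart_line c z w : A c -> c.1 z -> local_curve P (fun t : R => c.2 (z + t%:C *: w)) /\
  forall phi, smooth_fun P phi ->
    chart_vector A c.2 z w phi = 'D_(to w) (fun y => phi (c.2 (fr y))) (to z).
Proof.
move=> Ac cz; have [_ _ /(_ c Ac)[oc _] _] := mA.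
have pc := chart_plot (@cofK R V) (@cplotsP R V) Ac oc.
have oC := chart_open (@cofK R V) (@cplotsP R V) oc.
have q i : Cinf [set: 'rV[R]_1] (fun x => (to z + x 0 0 *: to w) 0 i).
  have -> : (fun x : 'rV[R]_1 => (to z + x 0 0 *: to w) 0 i) = (fun x => to z 0 i + x 0 0 * to w 0 i).
    by apply/funext => x; rewrite !mxE.
  apply: (Cinf_add (@openT _)); first exact: Cinf_cst.
  by apply: (Cinf_mul (@openT _)); [exact: Cinf_coord|exact: Cinf_cst].
have oW := @open_preim R 1 _ setT _ (fun x => to z + x 0 0 *: to w) (@openT _) oC q.
have lc : local_curve P (fun t : R => c.2 (z + t%:C *: w)).
  set W := [set x | _] in oW; exists W.
    by split=> //=; rewrite mxE scale0r addr0 ctoK.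
  have qW i : Cinf W (fun x => (to z + x 0 0 *: to w) 0 i) by apply: (Cinf_sub (q i)).
  have := plot_comp manifold_diffeology pc oW qW (fun x (h : W x) => h.2).
  move/(plot_eq manifold_diffeology); apply => x _.
  by rewrite cof_lin !ctoK.
split=> // phi sphi.
have dphi : differentiable (fun y => phi (c.2 (fr y))) (to z).
  by apply: (Cinf_differentiable (sphi _ _ _ pc)); rewrite /= ctoK.
have E : (fun t : R => phi (c.2 (z + t%:C *: w))) = (fun t => phi (c.2 (fr (to z + t *: to w)))).
  by apply/funext => t; rewrite cof_lin !ctoK.
rewrite /chart_vector -(@derive_val _ _ _ _ _ _ _ (velocity_is_derive lc sphi)) E.
by rewrite -(derive1_line _ dphi) derive1E.
Qed.

Lemma jrel_exists x v : tangent P x v -> exists2 w, tangent P x w & jrel A x v w.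
Proof.
move=> tv; have dA := manifold_diffeology.
have [_ _ ch _] := mA.
have [c [z [u [Ac cz <- Hv]]]] := tangent_chart (@ctoK R V) (@cofK R V) (@cplotsP R V)
  dA (fun c Ac => (ch c Ac).1) tv.
have [lc _] := chart_line ('i%C *: fr u) Ac cz.
exists (chart_vector A c.2 z ('i%C *: fr u)).
  by have := local_tangent dA lc; rewrite scale0r addr0.
exists c, z, (fr u); split=> //.
have [_ Hu] := chart_line (fr u) Ac cz.
apply/funext => phi; have [sp|np] := pselect (smooth_fun P phi).
  by rewrite Hu // cofK Hv.
by rewrite (tangent0 tv np) /chart_vector /velocity; case: asboolP.
Qed.

End ComplexCharts.

Section ComplexLieGroup.
Variables (R : realType) (V : vectType R[i]) (H : groupType) (AH : set (chart V H)).
Hypothesis hH : is_complex_lie_group AH.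
Local Notation HP := (Hplots AH).

Lemma H_manifold : is_manifold (@cplots R V) AH.
Proof. by have [[]] := hH. Qed.

Lemma H_diffeology : diffeology HP.
Proof. exact: (manifold_diffeology H_manifold). Qed.

(** The hypothesis is about the product atlas; a pair of plots is locally a plot through a product
    chart. *)
Lemma H_mul : smooth_map (prod_plots HP HP) HP (fun x => (x.1 * x.2)%g).
Proof.
have [_ [sm _] _] := hH; move=> n U p [p1 p2] _.
apply: (sm _ _ p) => //; have [oU H1] := p1; have [_ H2] := p2; split=> // x Ux.
have [a [W1 [s1 [Aa oW1 W1x ps1 E1]]]] := H1 x Ux.
have [b [W2 [s2 [Ab oW2 W2x ps2 E2]]]] := H2 x Ux.
have oW := openI oW1 oW2.
exists (a.1 `*` b.1, fun z => (a.2 z.1, b.2 z.2)), (W1 `&` W2), (fun x => (s1 x, s2 x)).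
have dV := @cplots_diffeology R V.
split=> //; first by exists a, b.
  apply: cplots_pair.
    exact: (plot_sub dV ps1 oW (@subIsetl _ W1 W2)).
  exact: (plot_sub dV ps2 oW (@subIsetr _ W1 W2)).
move=> y [/E1[h1 e1] /E2[h2 e2]]; split=> //=.
by rewrite -e1 -e2; case: (p y).
Qed.

Lemma H_inv : smooth_map HP HP (fun x => x^-1%g).
Proof. by have [_ _ []] := hH. Qed.

Lemma H_span : exists F : 'I_(\dim {:V} + \dim {:V}) -> (H -> R) -> R,
  forall v, tangent HP 1%g v ->
  exists r : 'I_(\dim {:V} + \dim {:V}) -> R, forall phi, v phi = \sum_i r i * F i phi.
Proof.
exact: (manifold_span (@ctoK R V) (@cofK R V) (@cplotsP R V) 1%g H_manifold).
Qed.

End ComplexLieGroup.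

Section BundleBasics.
Variables (R : realType) (Z : vectType R[i]) (T : hermitian_jordan_triple Z).
Variables (eps : int) (E : vectType R) (G : groupType) (AG : set (chart E G)).
Variables (act : G -> Mpt T eps -> Mpt T eps) (incK : 'End(Z) -> G).
Hypothesis hG : is_Geps AG act incK.
Variables (V : vectType R[i]) (H : groupType) (AH : set (chart V H)).
Hypothesis hH : is_complex_lie_group AH.
Variable f : 'End(Z) -> H.
Hypothesis hf : K_homomorphism T AH f.
Local Notation GP := (Gplots AG).
Local Notation HP := (Hplots AH).
Local Notation Q := (bundle T incK f).
Local Notation QP := (@bplots R Z T E G AG incK V H AH f).
Local Notation MP := (@Mplots R Z T eps).
Local Notation K := (Kset T).
Local Notation bpt := (bpt T incK f).
Local Notation dG := (G_diffeology hG).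
Local Notation dH := (H_diffeology hH).
Local Notation mulG := (G_mul hG).
Local Notation mulH := (H_mul hH).
Local Notation o := (base_point T eps).

Lemma f_comp k l : K k -> K l -> f (k \o l)%VF = (f k * f l)%g.
Proof. by case: hf => _; apply. Qed.

Lemma f1 : f \1%VF = 1%g.
Proof.
have := f_comp (Kset1 T) (Kset1 T); rewrite comp_lfun1l.
by move/(congr1 (fun x => (f \1%VF)^-1 * x)%g); rewrite mulVg mulKg.
Qed.

Lemma f_inv k : K k -> f (k^-1)%VF = (f k)^-1%g.
Proof.
move=> hk; have := f_comp hk (Kset_inv hk); rewrite (Kset_compV hk) f1.
by move/(congr1 (fun x => (f k)^-1 * x)%g); rewrite mulKg mulg1.
Qed.

Lemma bundle_inj (q q' : Q) : sval q = sval q' -> q = q'.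
Proof. by case: q q' => [A hA] [B hB] /= E0; subst B; congr exist; exact: Prop_irrelevance. Qed.

Lemma bptK g h k : K k -> bpt (g * (incK k)^-1)%g (f k * h)%g = bpt g h.
Proof.
move=> hk; apply: bundle_inj; apply/seteqP; split=> _ [l hl ->].
  exists (l \o k)%VF; first exact: Kset_comp.
  by rewrite (incK_comp hG hl hk) f_comp // invgM !mulgA.
exists (l \o k^-1)%VF; first by apply: Kset_comp => //; exact: Kset_inv.
rewrite (incK_comp hG hl (Kset_inv hk)) f_comp //; last exact: Kset_inv.
by rewrite (incK_inv hG hk) f_inv // invgM invgK mulgA mulgVK mulgA mulgVK.
Qed.

Lemma bptP g h g' h' : bpt g h = bpt g' h' ->
  exists2 k, K k & g' = (g * (incK k)^-1)%g /\ h' = (f k * h)%g.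
Proof.
move=> /(congr1 sval) /= E0; have : bundle_class T incK f g' h' (g', h').
  by exists \1%VF; [exact: Kset1|rewrite (incK1 hG) f1 invg1 mulg1 mul1g].
by rewrite -E0 => -[k hk [-> ->]]; exists k.
Qed.

Lemma bptM g h k : K k -> bpt (g * incK k)%g h = bpt g (f k * h)%g.
Proof. by move=> hk; rewrite -(bptK (g * incK k)%g h hk) mulgK. Qed.

Lemma brepK (q : Q) : bpt (brep q).1 (brep q).2 = q.
Proof.
by apply: bundle_inj; exact: (esym (projT2 (cid (projT2 (cid (proj2_sig q)))))).
Qed.

Lemma bact_bpt a g h c : bact a (bpt g h) c = bpt (a * g)%g (h * c)%g.
Proof.
rewrite /bact; have /bptP[k hk [-> ->]] := esym (brepK (bpt g h)).
by rewrite mulgA -[(f k * h * c)%g]mulgA bptK.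
Qed.

Lemma base_Zpt : o = Zpt T eps 0.
Proof. by apply: M_inj; rewrite /Zpt sval_pt //; exact: in_M0. Qed.

Lemma incK_base k : K k -> act (incK k) o = o.
Proof. by move=> hk; rewrite base_Zpt; have [_ ->] := act_Zpt hG hk (in_M0 T eps); rewrite linear0. Qed.

Lemma bproj_bpt g h : bproj act (bpt g h) = act g o.
Proof.
rewrite /bproj; have /bptP[k hk [-> _]] := esym (brepK (bpt g h)).
rewrite (Geps_actM hG) -(incK_inv hG hk) incK_base //; exact: Kset_inv.
Qed.

Lemma bpt_smooth : smooth_map (prod_plots GP HP) QP (fun x => bpt x.1 x.2).
Proof.
move=> n U p pp _; have dP := prod_diffeology dG dH.
by split=> [|x Ux]; [exact: (plot_open dP pp)|exists U, p; split=> //; exact: (plot_open dP pp)].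
Qed.

Lemma smooth_bundleP (phi : Q -> R) : smooth_fun QP phi <-> smooth2 GP HP (fun g h => phi (bpt g h)).
Proof.
split=> [sp n U p pp|sp n U p [oU H0]].
  by apply: (sp _ _ (fun x => bpt (p x).1 (p x).2)); exact: bpt_smooth.
apply: Cinf_local => x Ux; have [W [s [oW Wx ps Hs]]] := H0 x Ux.
exists W => //; have := sp _ _ _ ps; apply: (Cinf_eq oW) => y Wy.
by rewrite Hs.
Qed.

(* The image of [(d L_g s, d R_h t)] in the tangent space at [<g|h>]. *)
Definition push g h s t : (Q -> R) -> R := fun phi =>
  if `[< smooth_fun QP phi >] then
    s (fun x => phi (bpt (g * x)%g h)) + t (fun y => phi (bpt g (y * h)%g)) else 0.

Lemma pushE g h s t phi : smooth_fun QP phi ->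
  push g h s t phi = s (fun x => phi (bpt (g * x)%g h)) + t (fun y => phi (bpt g (y * h)%g)).
Proof. by rewrite /push; case: asboolP. Qed.

Lemma push0 g h s t phi : ~ smooth_fun QP phi -> push g h s t phi = 0.
Proof. by rewrite /push; case: asboolP. Qed.

Lemma smooth2_shift phi g h : smooth_fun QP phi ->
  smooth2 GP HP (fun x y => phi (bpt (g * x)%g (y * h)%g)).
Proof.
move=> /smooth_bundleP sp n U p [p1 p2].
apply: (sp _ _ (fun x => (g * (p x).1, (p x).2 * h)%g)).
have oU := plot_open dG p1; split.
  by apply: (plot_mul mulG) => //; exact: (plot_cst dG).
by apply: (plot_mul mulH) => //; exact: (plot_cst dH).
Qed.

Lemma push_tangent g h s t : tangent GP 1%g s -> tangent HP 1%g t ->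
  tangent QP (bpt g h) (push g h s t).
Proof.
move=> [c [sc c0 ->]] [d [sd d0 ->]].
have sq : smooth_curve QP (fun r => bpt (g * c r)%g (d r * h)%g).
  apply: (bpt_smooth (p := fun x => (g * c (x 0 0), d (x 0 0) * h)%g)) => //; split.
    by apply: (plot_mul mulG) => //; exact: (plot_cst dG _ (@openT _)).
  by apply: (plot_mul mulH) => //; exact: (plot_cst dH _ (@openT _)).
exists (fun r => bpt (g * c r)%g (d r * h)%g); split=> //.
  by rewrite c0 d0 mulg1 mul1g.
apply/funext => phi; have [sp|np] := pselect (smooth_fun QP phi); last first.
  by rewrite push0 // /velocity; case: asboolP.
rewrite pushE // [RHS]/velocity; case: asboolP => // _.
have := tan_pair dG dH (smooth2_shift g h sp) sc sd; rewrite c0 d0 mulg1.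
move=> ->; congr (velocity _ _ _ + _).
by apply/funext => x; rewrite mul1g.
Qed.

(** A plot of [Q] lifts locally to [G * H] by definition. The lift may start at another
    representative of <g|h> and exists only near 0; an element of K corrects the first defect and
    [local_tangent] the second. *)
Lemma tangent_push g h X : tangent QP (bpt g h) X ->
  exists s t, [/\ tangent GP 1%g s, tangent HP 1%g t & X = push g h s t].
Proof.
move=> [c [[_ sc] c0 ->]]; have [W [s [oW W0 [ps1 ps2] Hs]]] := sc 0 Logic.I.
have c00 : bpt (s 0).1 (s 0).2 = bpt g h by rewrite -Hs // mxE.
have [k hk [gE hE]] := bptP c00.
(* The lift, moved to the representative (g,h) by k and read in the frame, so that it starts at
   (1,1). *)
pose u (r : R) := (g^-1 * (s (line1 r)).1 * (incK k)^-1, f k * (s (line1 r)).2 * h^-1)%g.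
have l0 : line1 (0 : R) = 0 by apply/rowP => i; rewrite !mxE.
have lK (x : 'rV[R]_1) : line1 (x 0 0) = x.
  by apply/rowP => i; rewrite mxE (ord1 i).
have u0 : u 0 = (1, 1)%g.
  by rewrite /u l0 -mulgA -gE -hE mulVg mulgV.
have lu : local_curve (prod_plots GP HP) u.
  exists W => //; split.
    apply: (plot_eq dG (p := fun x => (g^-1 * (s x).1 * (incK k)^-1)%g)).
      by do 2! (apply: (plot_mul mulG) => //; try exact: (plot_cst dG _ oW)).
    by move=> x _; rewrite /u /= lK.
  apply: (plot_eq dH (p := fun x => (f k * (s x).2 * h^-1)%g)).
    by do 2! (apply: (plot_mul mulH) => //; try exact: (plot_cst dH _ oW)).
  by move=> x _; rewrite /u /= lK.
have [d [[sd1 sd2] d0 dE]] := local_tangent (prod_diffeology dG dH) lu.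
rewrite u0 in d0; exists (velocity GP (fun r => (d r).1)), (velocity HP (fun r => (d r).2)).
split.
- by have := tangent_vel (sd1 : smooth_curve GP (fun r => (d r).1)); rewrite d0.
- by have := tangent_vel (sd2 : smooth_curve HP (fun r => (d r).2)); rewrite d0.
apply/funext => phi; have [sp|np] := pselect (smooth_fun QP phi); last first.
  by rewrite push0 // /velocity; case: asboolP.
rewrite pushE // [LHS]/velocity; case: asboolP => // _.
have sF := smooth2_shift g h sp.
have := tan_pair dG dH sF (sd1 : smooth_curve GP (fun r => (d r).1)) (sd2 : smooth_curve HP (fun r => (d r).2)).
rewrite d0 /= mulg1 => E1.
have -> : (fun y => phi (bpt g (y * h)%g)) = (fun y => phi (bpt g (y * h)%g)) by [].
have E2 : (fun x => phi (bpt (g * x)%g h)) = (fun x => phi (bpt (g * x)%g (1 * h)%g)).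
  by apply/funext => x; rewrite mul1g.
rewrite E2 -E1.
have := congr1 (fun F => F (fun z => phi (bpt (g * z.1)%g (z.2 * h)%g))) dE.
rewrite /velocity; case: asboolP => // _ <-; rewrite !derive1E.
apply: near_eq_derive.
have cl := @line1_continuous R 0.
have : \forall r \near (0 : R), W (line1 r).
  by apply: (cl W); apply: open_nbhs_nbhs; rewrite l0.
apply: filterS => r Wr; have := Hs _ Wr; rewrite mxE => ->.
rewrite /u /= mulgVK -!mulgA mulVKg.
by rewrite bptK.
Qed.

End BundleBasics.

(** * Functions on Q with prescribed values on a fibre *)

Section VerticalInjectivity.
Variables (R : realType) (Z : vectType R[i]) (T : hermitian_jordan_triple Z).
Variables (eps : int) (E : vectType R) (G : groupType) (AG : set (chart E G)).
Variables (act : G -> Mpt T eps -> Mpt T eps) (incK : 'End(Z) -> G).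
Hypothesis hG : is_Geps AG act incK.
Variables (V : vectType R[i]) (H : groupType) (AH : set (chart V H)).
Hypothesis hH : is_complex_lie_group AH.
Variable f : 'End(Z) -> H.
Hypothesis hf : K_homomorphism T AH f.
Local Notation GP := (Gplots AG).
Local Notation HP := (Hplots AH).
Local Notation Q := (bundle T incK f).
Local Notation QP := (@bplots R Z T E G AG incK V H AH f).
Local Notation MP := (@Mplots R Z T eps).
Local Notation K := (Kset T).
Local Notation bpt := (bpt T incK f).
Local Notation dG := (G_diffeology hG).
Local Notation dH := (H_diffeology hH).
Local Notation dM := (@M_diffeology R Z T eps).
Local Notation mulG := (G_mul hG).
Local Notation mulH := (H_mul hH).
Local Notation o := (base_point T eps).
Local Notation N := (\dim {:Z} + \dim {:Z})%N.
Local Notation to := (@cto R Z).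
Local Notation fr := (@cof R Z).
Local Notation Zv := (@Zvec R Z T eps).

Lemma act_plot n (U : set 'rV[R]_n) g x : GP U g -> MP U (fun y => act (g y) x).
Proof.
move=> pg; apply: (Geps_smooth hG (p := fun y => (g y, x))) => //; split=> //.
exact: (plot_cst dM _ (plot_open dG pg)).
Qed.

Definition stab_elt (g : G) : 'End(Z) :=
  if pselect (exists2 k, K k & incK k = g) is left h then s2val (cid2 h) else 0.

Lemma stab_eltP g : act g o = o -> K (stab_elt g) /\ incK (stab_elt g) = g.
Proof.
move=> /(Geps_stabilizer hG) h; rewrite /stab_elt; case: pselect => // h'.
by split; [exact: (s2valP (cid2 h'))|exact: (s2valP' (cid2 h'))].
Qed.

Lemma stab_elt_incK k : K k -> stab_elt (incK k) = k.
Proof.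
move=> hk; have [h1 h2] := stab_eltP (incK_base hG hk).
exact: (incK_inj hG h1 hk h2).
Qed.

(** Smoothness is given for [incK], whereas here its inverse is needed. The linear map is recovered
    from the action: its value on a small multiple of a basis vector is the coordinate of a moved
    point of M. *)
Lemma stab_elt_plot n (U : set 'rV[R]_n) m : GP U m -> (forall y, U y -> act (m y) o = o) ->
  cplots U (fun y => stab_elt (m y)).
Proof.
move=> pm mo; have oU := plot_open dG pm; have dZ := @cplots_diffeology R Z.
apply: cplots_end => // j; set b := _`_j.
have [t t0 tb] := in_M_small T eps b.
have kE y : U y -> zdom (act (m y) (Zpt T eps (t%:C *: b))) /\
    stab_elt (m y) (t%:C *: b) = zc (act (m y) (Zpt T eps (t%:C *: b))).
  move=> Uy; have [h1 h2] := stab_eltP (mo _ Uy).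
  have [h3 h4] := act_Zpt hG h1 tb; rewrite -{1 3}h2 h4.
  by split; [exact: zdom_Zpt|rewrite zc_Zpt].
have t1 : t%:C != 0 :> R[i] by apply: contra t0; rewrite eq_complex /= => /andP[].
have pz : cplots U (fun y => zc (act (m y) (Zpt T eps (t%:C *: b)))).
  apply: (plot_local dZ) => // y Uy; have [dy _] := kE _ Uy.
  by have [W [oW Wy WU pW _]] := zc_plot (act_plot (Zpt T eps (t%:C *: b)) pm) Uy dy; exists W.
have := cplots_scale (CinfC_cst U (t%:C)^-1) pz.
move=> pz'; apply: (plot_eq dZ pz') => y Uy.
by have [_ <-] := kE _ Uy; rewrite linearZ /= scalerA mulVf // scale1r.
Qed.

(* Inverts x |-> g_1(x_1) ... g_N(x_N) o for curves g_j with velocities spanning T_o M. *)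
Lemma local_section : exists (W : set 'rV[R]_N) (sigma : 'rV[R]_N -> G),
  [/\ GP W sigma, W 0, sigma 0 = 1%g &
      forall w, W w -> act (sigma w) o = Zpt T eps (fr w)].
Proof.
have : forall j : 'I_N, exists c, [/\ smooth_curve GP c, c 0 = 1%g &
    tau_p AG act (fr (delta_mx 0 j)) = velocity GP c].
  by move=> j; have [[c [h1 h2 h3]] _] := tau_pP hG (fr (delta_mx 0 j)); exists c.
move=> /choice[c Hc].
(* The ordered product over a list of indices, general enough for induction; the list of all indices
   gives [g]. *)
pose Gam (l : seq 'I_N) (x : 'rV[R]_N) := foldr (fun j g => (c j (x 0 j) * g)%g) 1%g l.
have pGam l : GP setT (Gam l).
  elim: l => [|j l IH] /=; first exact: (plot_cst dG _ (@openT _)).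
  apply: (plot_mul mulG) => //; have [sc _ _] := Hc j.
  apply: (plot_eq dG (p := fun x => (fun y : 'rV[R]_1 => c j (y 0 0)) (line1 (x 0 j)))).
    apply: (plot_comp dG sc) => // [|i]; first exact: openT.
    have -> : (fun x : 'rV[R]_N => line1 (x 0 j) 0 i) = (fun x => x 0 j).
      by apply/funext => x; rewrite mxE.
    exact: Cinf_coord.
  by move=> x _; rewrite mxE.
pose g := Gam (enum 'I_N); have pg : GP setT g by exact: pGam.
have c0 j : c j 0 = 1%g by have [] := Hc j.
have g0 : g 0 = 1%g.
  rewrite /g; elim: (enum 'I_N) => [//|j l IH] /=.
  by rewrite mxE c0 IH mulg1.
(* On the j-th axis all factors but c_j are 1, so the order of the product does not affect the
   partial derivatives at 0. *)
have gi j (t : R) : g (t *: delta_mx 0 j) = c j t.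
  have H1 l : j \notin l -> Gam l (t *: delta_mx 0 j) = 1%g.
    elim: l => [//|i l IH] /=; rewrite in_cons negb_or => /andP[ji jl].
    by rewrite !mxE [i == j]eq_sym (negbTE ji) andbF mulr0 c0 IH // mulg1.
  have H2 l : uniq l -> j \in l -> Gam l (t *: delta_mx 0 j) = c j t.
    elim: l => [//|i l IH] /= /andP[il ul]; rewrite in_cons => /orP[/eqP ji|jl].
      by subst i; rewrite H1 // mulg1 !mxE !eqxx mulr1.
    rewrite IH // !mxE eqxx /=; case: eqP => [ij|_]; last by rewrite mulr0 c0 mul1g.
    by rewrite ij jl in il.
  by apply: H2; [exact: enum_uniq|rewrite mem_enum].
have pa := act_plot o pg.
have ao : act (g 0) o = Zpt T eps 0 by rewrite g0 (Geps_act1 hG) base_Zpt.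
have d0 : zdom (act (g 0) o) by rewrite ao; apply: zdom_Zpt; exact: in_M0.
have [U [oU U0 _ pz Ud]] := zc_plot pa Logic.I d0.
pose F x := to (zc (act (g x) o)).
have [_ cF'] := (cplotsP _ _).1 pz.
have cF j : Cinf U (fun x => F x 0 j) by exact: cF'.
have F0 : F 0 = 0 by rewrite /F ao zc_Zpt ?cto0 //; exact: in_M0.
(* Generators act only on globally smooth functions, so the j-th coordinate is differentiated
   together with the cutoff. Since F 0 = 0 the product rule leaves the nonzero factor [cutoff 1 0]
   on both sides, and it cancels. *)
have dF i j : 'D_(delta_mx 0 i) (fun x => F x 0 j) 0 = (i == j)%:R.
  have cC : Cinf U (fun x => cutoff 1 (F x)).
    exact: (@Cinf_comp R N N U setT F (@cutoff R Z 1) oU cF (fun _ _ => Logic.I) (@cutoff_smooth R Z 1)).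
  have := Zvec_coord T eps (fr (delta_mx 0 i)) j; rewrite cofK.
  set phi := zext _ _ _.
  have sphi : smooth_fun MP phi by exact: zcoord_smooth.
  have [_ g1] := tau_pP hG (fr (delta_mx 0 i)).
  have [sc _ tE] := Hc i.
  have := generatesE g1 (in_M0 T eps) sphi; rewrite {1}tE /p_field tp0r scaler0 addr0 => <-.
  rewrite -base_Zpt.
  have sact : smooth_fun GP (fun g => phi (act g o)).
    exact: (smooth2_left dG dM o (smooth2_act hG sphi)).
  rewrite -(@derive_val _ _ _ _ _ _ _ (velocity_is_derive (smooth_curve_local sc) sact)).
  have dC : differentiable (fun x => cutoff 1 (F x)) 0 by exact: (Cinf_differentiable cC U0).
  have dFj : differentiable (fun x => F x 0 j) 0 by exact: (Cinf_differentiable (cF j) U0).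
  have E1 : 'D_1 (fun t : R => phi (act (c i t) o)) (0 : R) =
     'D_(delta_mx 0 i) (fun x => cutoff 1 (F x) * F x 0 j) 0.
    have dP : differentiable (fun x => cutoff 1 (F x) * F x 0 j) 0.
      exact: (Cinf_differentiable (Cinf_mul oU cC (cF j)) U0).
    rewrite -(derive1_line _ dP) derive1E; apply: near_eq_derive.
    have : \forall t \near (0 : R), U (0 + t *: delta_mx 0 i).
      apply: (@affine_continuous R N 0 (delta_mx 0 i) 0).
      by apply: open_nbhs_nbhs; rewrite scale0r addr0.
    apply: filterS => t; rewrite add0r => Ut; rewrite -gi /phi /zext.
    by case: asboolP => // /(_ (Ud _ Ut)).
  rewrite E1 deriveM; try exact: diff_derivable.
  rewrite F0 mxE scale0r addr0 => /(mulfI _) E2.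
  rewrite E2; first by rewrite mxE eqxx /= eq_sym.
  by rewrite gt_eqF // cutoff0.
have [W [S [oW W0 S0 HS cS]]] := local_inverse oU U0 F0 cF dF.
exists W, (fun w => g (S w)); split=> //.
- by apply: (plot_comp dG pg oW cS) => w _.
- by rewrite S0.
- move=> w Ww; have [USw FS] := HS _ Ww.
  have [_ E0] := zdomE (Ud _ USw); rewrite E0; congr (Zpt T eps _).
  by rewrite -[LHS]ctoK -/(F (S w)) FS.
Qed.

(* [phi <sigma(z) k | h> = theta(z) psi(f(k) h)] for a local section [sigma] and a cutoff [theta]. *)
Lemma bundle_extension (psi : H -> R) : smooth_fun HP psi ->
  exists phi : Q -> R, smooth_fun QP phi /\
    exists2 c : R, c != 0 & forall h, phi (bpt 1%g h) = c * psi h.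
Proof.
move=> spsi; have [W [sigma [psig W0 sig0 Hsig]]] := local_section.
have oW := plot_open dG psig.
have [r0 r0_gt Hr0] := open_normP oW W0.
pose r := r0 / 2; have r_gt : 0 < r by rewrite divr_gt0.
have Hr w : `|w| <= r -> W w.
  move=> wr; rewrite -[w]add0r; apply: Hr0; apply: le_lt_trans wr _.
  by rewrite /r ltr_pdivrMr // ltr_pMr // ltr1n.
pose F (x : G * H) := act x.1 o.
pose m (x : G * H) := ((sigma (to (zc (F x))))^-1 * x.1)%g.
pose Psi := zext F r (fun x => psi (f (stab_elt (m x)) * x.2)%g).
have dP := prod_diffeology dG dH.
have m_stab x : zdom (F x) -> W (to (zc (F x))) -> act (m x) o = o.
  move=> dx Wx; rewrite /m (Geps_actM hG).
  have -> : act x.1 o = act (sigma (to (zc (F x)))) o.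
    by rewrite Hsig // ctoK; have [_] := zdomE dx.
  by rewrite -(Geps_actM hG) mulVg (Geps_act1 hG).
have sPsi : smooth_fun (prod_plots GP HP) Psi.
  apply: (zext_smooth dP) => //.
    by move=> n U p [p1 _] _; exact: act_plot.
  move=> n U p y [p1 p2] Uy dy ry.
  have [U1 [oU1 U1y U1U pz Ud]] := zc_plot (act_plot o p1) Uy dy.
  have [_ cz] := (cplotsP _ _).1 pz.
  have oU2 := open_preim oU1 oW cz.
  set U2 := [set x | _] in oU2.
  exists U2; first by split=> //; split=> //; exact: Hr.
  have s21 : U2 `<=` U1 by move=> x [].
  have p1' := plot_sub dG p1 oU2 (subset_trans s21 U1U).
  have p2' := plot_sub dH p2 oU2 (subset_trans s21 U1U).
  have ps : GP U2 (fun x => sigma (to (zc (F (p x))))).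
    apply: (plot_comp dG psig oU2) => [i|x []//].
    by apply: (Cinf_sub (cz i)).
  have pm : GP U2 (fun x => m (p x)).
    by apply: (plot_mul mulG) => //; exact: (plot_inv (G_inv hG)).
  have mo x : U2 x -> act (m (p x)) o = o.
    by move=> [/Ud ? ?]; exact: m_stab.
  have pk := stab_elt_plot pm mo.
  have pf : HP U2 (fun x => f (stab_elt (m (p x)))).
    by apply: hf.1 pk _ => x /mo /stab_eltP[].
  exact: (spsi _ _ _ (plot_mul mulH pf p2')).
(* Another representative multiplies [m] on the right by the inverse of k, and f of that inverse
   cancels the f(k) before h; hence [Psi] descends to [Q]. *)
have inv g h k : K k -> Psi ((g * (incK k)^-1)%g, (f k * h)%g) = Psi (g, h).
  move=> hk; rewrite /Psi /zext.
  have FE : F ((g * (incK k)^-1)%g, (f k * h)%g) = F (g, h).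
    rewrite /F /= (Geps_actM hG) -(incK_inv hG hk) (incK_base hG) //; exact: Kset_inv.
  rewrite !FE; case: asboolP => // dx.
  (* Beyond radius r nothing is known about [sigma], but the cutoff makes both sides 0. *)
  have [small|big] := leP `|to (zc (F (g, h)))| r; last by rewrite !cutoff_out // !mul0r.
  congr (_ * psi _).
  have [h1 h2] := stab_eltP (m_stab _ dx (Hr _ small)).
  have -> : m ((g * (incK k)^-1)%g, (f k * h)%g) = incK (stab_elt (m (g, h)) \o k^-1)%VF.
    rewrite (incK_comp hG h1 (Kset_inv hk)) h2 /m FE /= (incK_inv hG hk).
    by rewrite mulgA.
  rewrite stab_elt_incK; last by apply: Kset_comp => //; exact: Kset_inv.
  rewrite (f_comp hf h1 (Kset_inv hk)) (f_inv hf hk) /=.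
  by rewrite mulgA mulgVK.
exists (fun q => Psi (brep q)).
have PsiE g h : Psi (brep (bpt g h)) = Psi (g, h).
  have /(bptP hG hf)[k hk [E1 E2]] := esym (brepK (bpt g h)).
  by rewrite [brep _]surjective_pairing E1 E2 inv.
split.
  apply/(smooth_bundleP hG hH) => n U p pp.
  have := sPsi _ _ _ pp; congr (Cinf _ _); apply/funext => x.
  by rewrite PsiE; case: (p x).
exists (cutoff r (0 : 'rV[R]_N)); first by rewrite gt_eqF // cutoff0.
move=> h; rewrite PsiE /Psi /zext.
have F1 : F (1%g, h) = Zpt T eps 0 by rewrite /F (Geps_act1 hG) base_Zpt.
have i0 := in_M0 T eps.
rewrite F1; case: asboolP => [_|[]]; last exact: zdom_Zpt.
rewrite zc_Zpt // cto0; congr (_ * psi _).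
rewrite /m F1 zc_Zpt // cto0 sig0 invg1 mul1g -(incK1 hG) stab_elt_incK ?(f1 hf) ?mul1g //.
exact: Kset1.
Qed.

Lemma vertical_inj beta beta' : tangent HP 1%g beta -> tangent HP 1%g beta' ->
  (forall phi, smooth_fun QP phi ->
    beta (fun y => phi (bpt 1%g y)) = beta' (fun y => phi (bpt 1%g y))) ->
  beta = beta'.
Proof.
move=> tb tb' eqb; apply/funext => psi.
have [spsi|npsi] := pselect (smooth_fun HP psi); last by rewrite (tangent0 tb npsi) (tangent0 tb' npsi).
have [phi [sphi [c c0 Hc]]] := bundle_extension spsi.
have := eqb _ sphi.
have -> : (fun y => phi (bpt 1%g y)) = (fun y => c * psi y) by apply/funext => y; rewrite Hc.
by rewrite (tan_scale dH c tb spsi) (tan_scale dH c tb' spsi); exact: mulfI.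
Qed.

End VerticalInjectivity.

(** * Complexions *)

Section Complexions.
Variables (R : realType) (Z : vectType R[i]) (T : hermitian_jordan_triple Z).
Variables (eps : int) (E : vectType R) (G : groupType) (AG : set (chart E G)).
Variables (act : G -> Mpt T eps -> Mpt T eps) (incK : 'End(Z) -> G).
Hypothesis hG : is_Geps AG act incK.
Variables (V : vectType R[i]) (H : groupType) (AH : set (chart V H)).
Hypothesis hH : is_complex_lie_group AH.
Variable f : 'End(Z) -> H.
Hypothesis hf : K_homomorphism T AH f.
Local Notation GP := (Gplots AG).
Local Notation HP := (Hplots AH).
Local Notation Q := (bundle T incK f).
Local Notation QP := (@bplots R Z T E G AG incK V H AH f).
Local Notation MP := (@Mplots R Z T eps).
Local Notation Mat := (@Matlas R Z T eps).
Local Notation K := (Kset T).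
Local Notation bpt := (bpt T incK f).
Local Notation dG := (G_diffeology hG).
Local Notation dH := (H_diffeology hH).
Local Notation dM := (@M_diffeology R Z T eps).
Local Notation mulG := (G_mul hG).
Local Notation mulH := (H_mul hH).
Local Notation o := (base_point T eps).
Local Notation Zv := (@Zvec R Z T eps).
Local Notation push := (@push R Z T E G AG incK V H AH f).
Local Notation TG := (tangent GP 1%g).
Local Notation TH := (tangent HP 1%g).
Local Notation tau_p := (tau_p AG act).
Local Notation AdH := (Ad HP).
Local Notation bproj' := (@bproj R Z T eps G act incK H f).

Lemma TG0 : TG (fun=> 0). Proof. exact: (tangent_zero dG). Qed.
Lemma TH0 : TH (fun=> 0). Proof. exact: (tangent_zero dH). Qed.

Lemma push_lin g h (a : R) s t s' t' : push g h (fun phi => a * s phi + s' phi)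
    (fun phi => a * t phi + t' phi) = a *: push g h s t + push g h s' t'.
Proof.
apply/funext => phi; rewrite fctE /= -[(a *: push g h s t) phi]/(a * push g h s t phi).
have [sp|np] := pselect (smooth_fun QP phi); last by rewrite !push0 // mulr0 addr0.
by rewrite !pushE // mulrDr addrACA.
Qed.

Lemma push_add g h s t s' t' : push g h (fun phi => s phi + s' phi)
    (fun phi => t phi + t' phi) = push g h s t + push g h s' t'.
Proof.
rewrite -[push g h s t]scale1r -push_lin; congr (push g h _ _);
  by apply/funext => phi; rewrite mul1r.
Qed.

Lemma push_split g h s t : push g h s t = push g h s (fun=> 0) + push g h (fun=> 0) t.
Proof.
by rewrite -push_add; congr (push g h _ _); apply/funext => phi; rewrite ?addr0 ?add0r.
Qed.

Lemma smooth_slice phi g h : smooth_fun QP phi -> smooth_fun HP (fun y => phi (bpt g (y * h)%g)).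
Proof.
move=> sp; have := smooth2_right dG dH 1%g (smooth2_shift hG hH g h sp).
by rewrite mulg1.
Qed.

Lemma Ad_comp a c beta : TH beta -> AdH a (AdH c beta) = AdH (a * c)%g beta.
Proof.
move=> tb; apply/funext => psi; have [sp|np] := pselect (smooth_fun HP psi); last first.
  by rewrite /Ad /differential; case: asboolP.
have sa := smooth2_right dH dH a (smooth2_conj mulH (H_inv hH) sp).
rewrite (AdE a _ sp) (AdE c beta sa) (AdE (a * c)%g beta sp).
congr beta; apply/funext => y.
by rewrite invgM !mulgA.
Qed.

Lemma Ad1 beta : TH beta -> AdH 1%g beta = beta.
Proof.
move=> tb; apply/funext => psi; have [sp|np] := pselect (smooth_fun HP psi); last first.
  by rewrite (tangent0 tb np) /Ad /differential; case: asboolP.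
by rewrite AdE //; congr beta; apply/funext => y; rewrite mul1g invg1 mulg1.
Qed.

(** <g|h> y = <g|(h y h^-1) h>: a vector to the right of h appears to its left as its image under
    Ad(h). *)
Lemma dL_push g h beta : TH beta ->
  differential QP (bact 1%g (bpt g h)) beta = push g h (fun=> 0) (AdH h beta).
Proof.
move=> tb; apply/funext => phi; have [sp|np] := pselect (smooth_fun QP phi); last first.
  by rewrite push0 // /differential; case: asboolP.
rewrite pushE // /differential; case: asboolP => // _.
rewrite add0r AdE; last exact: smooth_slice.
congr beta; apply/funext => y; rewrite (bact_bpt hG hf) mul1g.
by rewrite -mulgA mulVg mulg1.
Qed.

Lemma dR_push c g h s t : TG s -> TH t ->
  differential QP (fun q => bact 1%g q c) (push g h s t) = push g (h * c)%g s t.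
Proof.
move=> ts tt; apply/funext => phi; have [sp|np] := pselect (smooth_fun QP phi); last first.
  by rewrite push0 // /differential; case: asboolP.
rewrite (pushE _ _ _ _ sp) /differential; case: asboolP => // _.
have sc : smooth_fun QP (fun q => phi (bact 1%g q c)).
  apply/(smooth_bundleP hG hH) => n U p [p1 p2].
  have /(smooth_bundleP hG hH) sp' := sp.
  have -> : (fun x => phi (bact 1%g (bpt (p x).1 (p x).2) c)) =
     (fun x => phi (bpt (p x).1 ((p x).2 * c)%g)).
    by apply/funext => x; rewrite (bact_bpt hG hf) mul1g.
  apply: (sp' _ _ (fun x => ((p x).1, ((p x).2 * c)%g))); split=> //.
  by apply: (plot_mul mulH) => //; exact: (plot_cst dH _ (plot_open dG p1)).
rewrite pushE //; congr (s _ + t _); apply/funext => x;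
  by rewrite (bact_bpt hG hf) mul1g ?mulgA.
Qed.

(** Right translation by h^-1 moves the question to <1|1>, where [vertical_inj] decides it. *)
Lemma push_inj h t t' : TH t -> TH t' ->
  push 1%g h (fun=> 0) t = push 1%g h (fun=> 0) t' -> t = t'.
Proof.
move=> tt tt' /(congr1 (differential QP (fun q => bact 1%g q h^-1%g))).
rewrite !dR_push //; try exact: TG0.
rewrite mulgV => Epush; apply: (vertical_inj hG hH hf) => // phi sp.
have := congr1 (fun F => F phi) Epush; rewrite !pushE // !add0r.
have -> : (fun y => phi (bpt 1%g (y * 1)%g)) = (fun y => phi (bpt 1%g y)) => //.
by apply/funext => y; rewrite mulg1.
Qed.

Lemma bproj_smooth psi : smooth_fun MP psi -> smooth_fun QP (fun q => psi (bproj' q)).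
Proof.
move=> sp; apply/(smooth_bundleP hG hH) => n U p [p1 _].
have := sp _ _ _ (act_plot hG o p1); congr (Cinf _ _).
by apply/funext => x; rewrite (bproj_bpt hG hf).
Qed.

Lemma dproj_push g h s t xi : TG s -> TH t -> generates act s xi ->
  differential MP bproj' (push g h s t) = differential MP (act g) (Zv 0 (xi 0)).
Proof.
move=> ts tt gs; apply/funext => psi; rewrite /differential; case: asboolP => // sp.
rewrite pushE; last exact: bproj_smooth.
have -> : (fun y => psi (bproj' (bpt g (y * h)%g))) = (fun=> psi (act g o)).
  by apply/funext => y; rewrite (bproj_bpt hG hf).
rewrite (tan_cst _ tt) addr0.
have sg := smooth2_right dG dM g (smooth2_act hG sp).
rewrite -(generatesE gs (in_M0 T eps) sg) -base_Zpt.
by congr s; apply/funext => x; rewrite (bproj_bpt hG hf) (Geps_actM hG).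
Qed.

Lemma horizontalE g h (X : (Q -> R) -> R) :
  horizontal AG act AH g h X <-> exists v, X = push g h (tau_p v) (fun=> 0).
Proof.
have key v : differential QP (bpt^~ h) (differential GP (fun x => (g * x)%g) (tau_p v)) =
    push g h (tau_p v) (fun=> 0).
  apply/funext => phi; have [sp|np] := pselect (smooth_fun QP phi); last first.
    by rewrite push0 // /differential; case: asboolP.
  rewrite pushE // addr0 {1}/differential; case: asboolP => // _.
  rewrite /differential; case: asboolP => // ns; case: ns.
  have := smooth2_left dG dH 1%g (smooth2_shift hG hH 1%g h sp).
  by congr (smooth_fun _ _); apply/funext => x; rewrite !mul1g.
split=> [[tau /(p_spaceP hG)[v ->] ->]|[v ->]]; first by exists v.
by exists (tau_p v); [apply/(p_spaceP hG); exists v|rewrite key].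
Qed.

(** The k-part of the vector on [G] is the velocity of a curve c in K, and <g c(r)|h> = <g|f(c(r))
    h> moves it to [H]. *)
Lemma tangent_push_p g h X : tangent QP (bpt g h) X ->
  exists v beta, TH beta /\ X = push g h (tau_p v) beta.
Proof.
move=> /(tangent_push hG hH hf)[s [t [ts tt ->]]].
have [v [c [sc c0 cK ->]]] := T1_split hG ts.
have sfc : smooth_curve HP (fun r => f (c r)).
  by apply: (hf.1 _ _ _ sc) => x _; exact: cK.
have tfc : TH (velocity HP (fun r => f (c r))).
  by have := tangent_vel sfc; rewrite c0 (f1 hf).
exists v, (fun psi => t psi + velocity HP (fun r => f (c r)) psi); split.
  have := T1_lin dH mulH 1 tt tfc; congr (tangent _ _ _).
  by apply/funext => psi; rewrite mul1r.
apply/funext => phi; have [sp|np] := pselect (smooth_fun QP phi); last by rewrite !push0.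
rewrite !pushE // -addrA [X in _ + X]addrC; congr (_ + (_ + _)).
have sG : smooth_fun GP (fun x => phi (bpt (g * x)%g h)).
  have := smooth2_left dG dH 1%g (smooth2_shift hG hH g h sp).
  by congr (smooth_fun _ _); apply/funext => x; rewrite !mul1g.
rewrite /velocity; case: asboolP => // _; case: asboolP => [_|[]]; last exact: smooth_slice.
by congr (derive1 _ 0); apply/funext => r; rewrite (bptM hG hf).
Qed.

Section Tautological.
Variable J0 : Q -> ((Q -> R) -> R) -> ((Q -> R) -> R).
Hypothesis hJ0 : tautological_complexion AG act AH J0.

Lemma J0_lin q v w (a : R) : tangent QP q v -> tangent QP q w ->
  J0 q (a *: v + w) = a *: J0 q v + J0 q w.
Proof. by have [[[_ lin _ _] _ _ _] _] := hJ0; exact: lin. Qed.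

Lemma J0_add q v w : tangent QP q v -> tangent QP q w -> J0 q (v + w) = J0 q v + J0 q w.
Proof. by move=> tv tw; rewrite -[v in LHS]scale1r J0_lin // scale1r. Qed.

(** [J0] preserves the horizontal space, so the image comes from some v'. Projecting to M and
    applying the holomorphic g^-1 compares v' with i v at the origin, where [jrel] determines its
    second vector. *)
Lemma J0_horizontal g h v : J0 (bpt g h) (push g h (tau_p v) (fun=> 0)) =
  push g h (tau_p ('i%C *: v)) (fun=> 0).
Proof.
have [[_ Jj _ _] Jh] := hJ0.
have [tv gv] := tau_pP hG v.
have tX := push_tangent hG hH f g h tv TH0.
have /horizontalE[v' E'] := Jh g h _ ((horizontalE _ _ _).2 (ex_intro _ v erefl)).
have := Jj _ _ tX; rewrite E'.
have [tv' gv'] := tau_pP hG v'.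
rewrite (dproj_push _ _ tv TH0 gv) (dproj_push _ _ tv' TH0 gv').
have pf0 w : p_field T eps w 0 = w by rewrite /p_field tp0r scaler0 addr0.
rewrite !pf0 => /(Geps_holomorphic hG g^-1%g).2.
have dd w : differential (caplots Mat) (act g^-1%g) (differential MP (act g) (Zv 0 w)) = Zv 0 w.
  apply/funext => psi; have [sp|np] := pselect (smooth_fun MP psi); last first.
    by rewrite Zvec0 // /differential; case: asboolP.
  rewrite /differential; case: asboolP => // _; case: asboolP => [_|[]].
    by congr (Zv 0 w _); apply/funext => x; rewrite -(Geps_actM hG) mulVg (Geps_act1 hG).
  exact: (smooth2_right dG dM g^-1%g (smooth2_act hG sp)).
rewrite !dd (bproj_bpt hG hf) -(Geps_actM hG) mulVg (Geps_act1 hG).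
by move/jrel_origin/Zvec_inj ->.
Qed.

(* The complex structure of the Lie algebra of [H]; junk value off [T_1 H]. *)
Definition vertI (beta : (H -> R) -> R) : (H -> R) -> R :=
  if pselect (exists2 w, TH w & jrel AH 1%g beta w) is left h then s2val (cid2 h) else fun=> 0.

Lemma vertIP beta : TH beta -> TH (vertI beta) /\ jrel AH 1%g beta (vertI beta).
Proof.
move=> /(jrel_exists (H_manifold hH)) h; rewrite /vertI; case: pselect => // h'.
by split; [exact: (s2valP (cid2 h'))|exact: (s2valP' (cid2 h'))].
Qed.

Lemma J0_jrel g h beta beta' : TH beta -> TH beta' -> jrel AH 1%g beta beta' ->
  J0 (bpt g h) (push g h (fun=> 0) (AdH h beta)) = push g h (fun=> 0) (AdH h beta').
Proof. by move=> tb tb' j; have [[_ _ _ Jv] _] := hJ0; rewrite -!dL_push //; exact: Jv. Qed.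

(** At h = 1 the axiom on vertical vectors applies without Ad; right translation by h, which leaves
    frame coordinates unchanged, gives the general case. *)
Lemma J0_vertical g h beta : TH beta ->
  J0 (bpt g h) (push g h (fun=> 0) beta) = push g h (fun=> 0) (vertI beta).
Proof.
move=> tb; have [tI jI] := vertIP tb; have [[_ _ JR _] _] := hJ0.
have J1 := J0_jrel g 1%g tb tI jI; rewrite !Ad1 // in J1.
have tX := push_tangent hG hH f g 1%g TG0 tb.
have := JR _ h _ tX; rewrite J1 !dR_push //; try exact: TG0.
by rewrite (bact_bpt hG hf) !mul1g.
Qed.

(** [jrel] quantifies over all charts of [H]. That it determines the second vector follows because
    [J0] is a map and vertical vectors at <1|1> are faithful. *)
Lemma jrel_vertI beta beta' : TH beta -> TH beta' -> jrel AH 1%g beta beta' -> vertI beta = beta'.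
Proof.
move=> tb tb' j; have [tI _] := vertIP tb.
apply: (push_inj (h := 1%g)) => //.
by rewrite -J0_vertical // -[in LHS](Ad1 tb) (J0_jrel 1%g 1%g tb tb' j) Ad1.
Qed.

(** The value of [J0] on one vertical vector at <1|h> is computed twice, by [J0_vertical] and by the
    axiom containing Ad(h). Real linearity and the square of [vertI] are read off from [J0] in the
    same manner. *)
Lemma vertI_Ad h beta : TH beta -> vertI (AdH h beta) = AdH h (vertI beta).
Proof.
move=> tb; have [tI jI] := vertIP tb.
have tA : TH (AdH h beta) by exact: (T1_Ad dH mulH).
have tAI : TH (AdH h (vertI beta)) by exact: (T1_Ad dH mulH).
apply: (push_inj (h := h)) => //; first by have [] := vertIP tA.
by rewrite -J0_vertical // (J0_jrel 1%g h tb tI jI).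
Qed.

Lemma vertI_lin a beta gamma : TH beta -> TH gamma ->
  vertI (fun phi => a * beta phi + gamma phi) = (fun phi => a * vertI beta phi + vertI gamma phi).
Proof.
move=> tb tc; have [tb' _] := vertIP tb; have [tc' _] := vertIP tc.
have tl := T1_lin dH mulH a tb tc; have tl' := T1_lin dH mulH a tb' tc'.
apply: (push_inj (h := 1%g)) => //; first by have [] := vertIP tl.
have z0 : (fun _ : G -> R => 0 : R) = (fun phi => a * (fun=> 0) phi + (fun=> 0) phi).
  by apply/funext => phi; rewrite mulr0 addr0.
rewrite -J0_vertical // {1}z0 push_lin J0_lin; try exact: (push_tangent hG hH f _ _ TG0).
by rewrite !J0_vertical // -push_lin -z0.
Qed.

Lemma vertIK beta : TH beta -> vertI (vertI beta) = (fun phi => - beta phi).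
Proof.
move=> tb; have [tb' _] := vertIP tb; have [tb'' _] := vertIP tb'.
have tN : TH (fun phi => - beta phi).
  have := T1_lin dH mulH (-1) tb TH0; congr (tangent _ _ _).
  by apply/funext => phi; rewrite mulN1r addr0.
apply: (push_inj (h := 1%g)) => //.
rewrite -!J0_vertical //; have [[[_ _ JJ _] _ _ _] _] := hJ0.
rewrite JJ; last exact: (push_tangent hG hH f _ _ TG0).
apply/funext => phi; have [sp|np] := pselect (smooth_fun QP phi).
  by rewrite -[LHS]/(- push _ _ _ _ phi) !pushE // !add0r.
by rewrite -[LHS]/(- push _ _ _ _ phi) !push0 // oppr0.
Qed.

Lemma lie_vertI s t : TH s -> TH t ->
  lie_bracket HP s (vertI t) = vertI (lie_bracket HP s t).
Proof.
move=> ts tt; have [F HF] := H_span hH.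
have [_ ->] // := lie_linear_of_Ad dH mulH (H_inv hH) HF (I := vertI) (s := s) (t := t)
  (fun v tv => (vertIP tv).1) (fun a v w tv tw => vertI_lin a tv tw)
  (fun h v tv => vertI_Ad h tv) ts tt.
Qed.

Variable b : Z -> (H -> R) -> R.
Hypothesis hb : antilinear_map AH b.
Variable J : Q -> ((Q -> R) -> R) -> ((Q -> R) -> R).
Hypothesis hJ : generated_complexion AG act AH J0 b J.

Lemma b_tan u : TH (b u). Proof. by have [] := hb. Qed.

Lemma b_lin (t : R) u v : b (t%:C *: u + v) = (fun phi => t * b u phi + b v phi).
Proof. by have [_ D L _] := hb; rewrite D L. Qed.

Lemma vertI_b u : vertI (b u) = (fun phi => - b ('i%C *: u) phi).
Proof.
have [tb _ _ jb] := hb; apply: jrel_vertI; [exact: tb| |exact: jb].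
have := T1_lin dH mulH (-1) (tb ('i%C *: u)) TH0; congr (tangent _ _ _).
by apply/funext => phi; rewrite mulN1r addr0.
Qed.

(** [B] at <g|h> carries Ad(h^-1) and [dL_push] contributes Ad(h). They cancel, so the term added to
    [J0] has constant coefficients in the frame. *)
Lemma J_push g h s t xi : TG s -> TH t -> generates act s xi ->
  J (bpt g h) (push g h s t) = J0 (bpt g h) (push g h s t) + push g h (fun=> 0) (b (xi 0)).
Proof.
move=> ts tt gs; have [B [HB HJ]] := hJ.
rewrite HJ; last exact: (push_tangent hG hH f g h ts tt).
rewrite (dproj_push g h ts tt gs) HB dL_push; last exact: (T1_Ad dH mulH _ (b_tan _)).
by rewrite Ad_comp ?mulgV ?Ad1 //; exact: b_tan.
Qed.

Lemma J_push_p g h v beta : TH beta -> J (bpt g h) (push g h (tau_p v) beta) =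
  push g h (tau_p ('i%C *: v)) (fun phi => b v phi + vertI beta phi).
Proof.
move=> tb; have [tv gv] := tau_pP hG v.
rewrite (J_push g h tv tb gv) /p_field tp0r scaler0 addr0.
rewrite push_split J0_add.
- rewrite J0_horizontal J0_vertical // -addrA -push_add -push_add.
  congr (push g h _ _); apply/funext => phi; first by rewrite !addr0.
  by rewrite add0r addrC.
- by apply: (push_tangent hG hH f g h) => //; first [exact: TG0|exact: TH0].
- by apply: (push_tangent hG hH f g h) => //; first [exact: TG0|exact: TH0].
Qed.

(** [J] is given only through the generating formula; its additivity is obtained from its expression
    in the frame. *)
Lemma J_add g h X Y : tangent QP (bpt g h) X -> tangent QP (bpt g h) Y ->
  J (bpt g h) (X + Y) = J (bpt g h) X + J (bpt g h) Y.
Proof.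
move=> /(tangent_push_p)[u [beta [tb ->]]] /(tangent_push_p)[v [gamma [tc ->]]].
have one : (1 : R)%:C *: u + v = u + v by rewrite scale1r.
have tE : (fun phi => tau_p u phi + tau_p v phi) = tau_p (u + v).
  by rewrite -one (tau_p_lin hG); apply/funext => phi; rewrite mul1r.
have tbc : TH (fun phi => beta phi + gamma phi).
  have := T1_lin dH mulH 1 tb tc; congr (tangent _ _ _).
  by apply/funext => phi; rewrite mul1r.
rewrite -push_add tE !J_push_p // -push_add; congr (push g h _ _).
  have := tau_p_lin hG 1 ('i%C *: u) ('i%C *: v); rewrite scale1r scalerDr => ->.
  by apply/funext => phi; rewrite mul1r.
have := vertI_lin 1 tb tc; rewrite (_ : (fun phi => 1 * beta phi + _) = (fun phi => beta phi + gamma phi)).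
  move=> ->; have := b_lin 1 u v; rewrite one => ->.
  by apply/funext => phi; rewrite !mul1r addrACA.
by apply/funext => phi; rewrite mul1r.
Qed.

End Tautological.
End Complexions.

(** * Vector fields in the moving frame *)

Section TangentSums.
Variables (R : realType) (X : Type) (P : plots R X).
Hypothesis dP : diffeology P.

Lemma tan_bigsum x v I (r : seq I) (F : I -> X -> R) : tangent P x v ->
  (forall i, smooth_fun P (F i)) ->
  v (fun y => \sum_(i <- r) F i y) = \sum_(i <- r) v (F i).
Proof.
move=> tv sF; elim: r => [|i r IH].
  rewrite big_nil -[RHS](tan_cst 0 tv); congr v; apply/funext => y.
  by rewrite big_nil.
rewrite big_cons -IH -(tan_add dP tv) //; last exact: (smooth_sum dP).
by congr v; apply/funext => y; rewrite big_cons.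
Qed.

(* Leibniz rule for coefficients [a = u / d] whose smoothness is known only
   through the numerators [u] and the denominator [d]. *)
Lemma tan_quotient x v n (a : X -> 'I_n -> R) (d : X -> R) (u U : 'I_n -> X -> R) (F : X -> R) :
  tangent P x v -> smooth_fun P d -> (forall j, smooth_fun P (u j)) ->
  (forall j, smooth_fun P (U j)) -> smooth_fun P F -> d x = 1 ->
  (forall y j, u j y = d y * a y j) -> (forall y, F y = \sum_j a y j * U j y) ->
  v F = \sum_j (v (u j) - a x j * v d) * U j x + \sum_j a x j * v (U j).
Proof.
move=> tv sd su sU sF dx uE FE.
(* Differentiating d F = sum u_j U_j at a point with d = 1 isolates v F. *)
have E1 : (fun y => d y * F y) = (fun y => \sum_j u j y * U j y).
  by apply/funext => y; rewrite FE mulr_sumr; apply: eq_bigr => j _; rewrite uE mulrA.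
have := tan_mul dP tv sd sF; rewrite E1 dx mul1r.
rewrite (tan_bigsum _ tv); last by move=> j; exact: smooth_mul.
move=> /eqP; rewrite -subr_eq => /eqP <-.
rewrite FE mulr_suml -sumrB -big_split; apply: eq_bigr => j _ /=.
by rewrite (tan_mul dP tv) // uE dx; ring.
Qed.

End TangentSums.

Section LieBilinear.
Variables (R : realType) (G : groupType) (P : plots R G).
Hypotheses (dP : diffeology P)
  (mulS : smooth_map (prod_plots P P) P (fun x => (x.1 * x.2)%g)).
Local Notation T1 := (tangent P 1%g).

Lemma lie_addl s s' t : T1 s -> T1 s' -> T1 t ->
  lie_bracket P (fun phi => s phi + s' phi) t =
  (fun phi => lie_bracket P s t phi + lie_bracket P s' t phi).
Proof.
move=> ts ts' tt; apply/funext => phi.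
have [sp|np] := pselect (smooth_fun P phi); last by rewrite !lie_bracket0 // addr0.
have tss : T1 (fun phi => s phi + s' phi).
  have := T1_lin dP mulS 1 ts ts'; congr (tangent _ _ _).
  by apply/funext => psi; rewrite mul1r.
rewrite !(lie_bracketE dP mulS) //.
have sF := smooth2_mul mulS sp.
rewrite (tan_add dP tt); [by ring|exact: (tan_param dP dP ts sF)|exact: (tan_param dP dP ts' sF)].
Qed.

Lemma lie_addr s t t' : T1 s -> T1 t -> T1 t' ->
  lie_bracket P s (fun phi => t phi + t' phi) =
  (fun phi => lie_bracket P s t phi + lie_bracket P s t' phi).
Proof.
move=> ts tt tt'; apply/funext => phi.
have ttt : T1 (fun phi => t phi + t' phi).
  have := T1_lin dP mulS 1 tt tt'; congr (tangent _ _ _).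
  by apply/funext => psi; rewrite mul1r.
rewrite (lie_antisym dP mulS phi ts ttt) (lie_addl tt tt' ts).
by rewrite opprD -!(lie_antisym dP mulS).
Qed.

End LieBilinear.

Section ModelFields.
Variables (R : realType) (Z : vectType R[i]) (T : hermitian_jordan_triple Z).
Variables (eps : int) (E : vectType R) (G : groupType) (AG : set (chart E G)).
Variables (act : G -> Mpt T eps -> Mpt T eps) (incK : 'End(Z) -> G).
Hypothesis hG : is_Geps AG act incK.
Variables (V : vectType R[i]) (H : groupType) (AH : set (chart V H)).
Hypothesis hH : is_complex_lie_group AH.
Variable f : 'End(Z) -> H.
Hypothesis hf : K_homomorphism T AH f.
Local Notation GP := (Gplots AG).
Local Notation HP := (Hplots AH).
Local Notation GH := (prod_plots GP HP).
Local Notation Q := (bundle T incK f).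
Local Notation QP := (@bplots R Z T E G AG incK V H AH f).
Local Notation MP := (@Mplots R Z T eps).
Local Notation bpt := (bpt T incK f).
Local Notation dG := (G_diffeology hG).
Local Notation dH := (H_diffeology hH).
Local Notation mulG := (G_mul hG).
Local Notation mulH := (H_mul hH).
Local Notation push := (@push R Z T E G AG incK V H AH f).
Local Notation TG := (tangent GP 1%g).
Local Notation TH := (tangent HP 1%g).
Local Notation tau_p := (tau_p AG act).
Local Notation "'model'" := (Z * ((H -> R) -> R))%type.

(* [(v, beta)] stands for the vector [<g tau_v | beta h>] at any [<g|h>]. *)
Definition mpush g h (w : model) : (Q -> R) -> R := push g h (tau_p w.1) w.2.

Definition mtan g h (w : model) : (G * H -> R) -> R := fun F =>
  if `[< smooth_fun GH F >] then
    tau_p w.1 (fun x => F ((g * x)%g, h)) + w.2 (fun y => F (g, (y * h)%g)) else 0.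

Lemma dGH : diffeology GH. Proof. exact: (prod_diffeology dG dH). Qed.

Lemma mtanE g h w F : smooth_fun GH F -> mtan g h w F =
  tau_p w.1 (fun x => F ((g * x)%g, h)) + w.2 (fun y => F (g, (y * h)%g)).
Proof. by rewrite /mtan; case: asboolP. Qed.

Lemma smooth_shift F g h : smooth_fun GH F ->
  smooth2 GP HP (fun x y => F ((g * x)%g, (y * h)%g)).
Proof.
move=> sF n U p [p1 p2]; apply: (sF _ _ (fun x => (g * (p x).1, (p x).2 * h)%g)).
have oU := plot_open dG p1; split.
  by apply: (plot_mul mulG) => //; exact: (plot_cst dG).
by apply: (plot_mul mulH) => //; exact: (plot_cst dH).
Qed.

Lemma mtan_tangent g h w : TH w.2 -> tangent GH (g, h) (mtan g h w).
Proof.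
move=> [d [sd d0 dE]]; have [[c [sc c0 cE]] _] := tau_pP hG w.1.
have sq : smooth_curve GH (fun r => (g * c r, d r * h)%g).
  split; first by apply: (plot_mul mulG) => //; exact: (plot_cst dG _ (@openT _)).
  by apply: (plot_mul mulH) => //; exact: (plot_cst dH _ (@openT _)).
exists (fun r => (g * c r, d r * h)%g); split=> //; first by rewrite c0 d0 mulg1 mul1g.
apply/funext => F; rewrite /mtan [RHS]/velocity; case: asboolP => // sF.
have := tan_pair dG dH (smooth_shift g h sF) sc sd; rewrite c0 d0 mulg1 cE dE.
move=> ->; congr (velocity _ _ _ + _).
by apply/funext => x; rewrite mul1g.
Qed.

Lemma smooth_pull phi : smooth_fun QP phi -> smooth_fun GH (fun x => phi (bpt x.1 x.2)).
Proof. by move/(smooth_bundleP hG hH). Qed.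

Lemma mpush_mtan g h w phi : smooth_fun QP phi ->
  mpush g h w phi = mtan g h w (fun x => phi (bpt x.1 x.2)).
Proof. by move=> sp; rewrite /mpush pushE // mtanE //; exact: smooth_pull. Qed.

Lemma mpush_tangent g h w : TH w.2 -> tangent QP (bpt g h) (mpush g h w).
Proof. by move=> tw; apply: (push_tangent hG hH f g h) => //; exact: (tau_pP hG w.1).1. Qed.

Lemma mpush_smooth w phi : TH w.2 -> smooth_fun QP phi ->
  smooth_fun GH (fun x => mpush x.1 x.2 w phi).
Proof.
move=> tw sp; have sp' := smooth_pull sp; have [tt _] := tau_pP hG w.1.
have -> : (fun x => mpush x.1 x.2 w phi) = (fun x => tau_p w.1 (fun y => phi (bpt (x.1 * y)%g x.2)) +
    w.2 (fun y => phi (bpt x.1 (y * x.2)%g))).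
  by apply/funext => x; rewrite /mpush pushE.
apply: (smooth_add dGH).
  apply: (tan_param dGH dG tt (F := fun x y => phi (bpt (x.1 * y)%g x.2))) => n U p [[p1 p2] p3].
  apply: (sp' _ _ (fun x => ((p x).1.1 * (p x).2, (p x).1.2)%g)); split=> //.
  exact: (plot_mul mulG).
apply: (tan_param dGH dH tw (F := fun x y => phi (bpt x.1 (y * x.2)%g))) => n U p [[p1 p2] p3].
apply: (sp' _ _ (fun x => ((p x).1.1, (p x).2 * (p x).1.2)%g)); split=> //.
exact: (plot_mul mulH).
Qed.

Definition mlin (a : R) (w w' : model) : model :=
  (a%:C *: w.1 + w'.1, fun phi => a * w.2 phi + w'.2 phi).

Definition mzero : model := (0, fun=> 0).

Definition msum n (c : 'I_n -> R) (w : 'I_n -> model) : model :=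
  foldr (fun j acc => mlin (c j) (w j) acc) mzero (index_enum 'I_n).

Lemma mlin_tan a w w' : TH w.2 -> TH w'.2 -> TH (mlin a w w').2.
Proof. exact: (T1_lin dH mulH). Qed.

Lemma msum_tan n (c : 'I_n -> R) w : (forall j, TH (w j).2) -> TH (msum c w).2.
Proof.
move=> tw; rewrite /msum; elim: (index_enum _) => [|j l IH]; first exact: (TH0 hH).
by apply: mlin_tan.
Qed.

Lemma mpush_lin g h a w w' : mpush g h (mlin a w w') = a *: mpush g h w + mpush g h w'.
Proof. by rewrite /mpush (tau_p_lin hG) push_lin. Qed.

Lemma tau_p0 : tau_p 0 = (fun=> 0).
Proof.
have := tau_p_lin hG 1 0 0; rewrite scaler0 addr0 => /(congr1 (fun F => F _)) E0.
by apply/funext => phi; have := E0 phi; rewrite mul1r => /eqP; rewrite -subr_eq subrr => /eqP.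
Qed.

Lemma mpush0 g h : mpush g h mzero = (fun=> 0).
Proof.
apply/funext => phi; rewrite /mpush tau_p0; have [sp|np] := pselect (smooth_fun QP phi).
  by rewrite pushE // addr0.
by rewrite push0.
Qed.

Lemma mpush_sum g h n (c : 'I_n -> R) w phi :
  mpush g h (msum c w) phi = \sum_j c j * mpush g h (w j) phi.
Proof.
rewrite /msum; elim: (index_enum _) => [|j l IH]; first by rewrite big_nil mpush0.
by rewrite big_cons -IH /= mpush_lin.
Qed.

(** The frame is invariant under left translation by [G] and right translation by [H], so questions
    about it reduce to <1|1>. *)
Lemma mpush_shift g h w phi : mpush g h w phi = mpush 1%g 1%g w (fun q => phi (bact g q h)).
Proof.
have sE : smooth_fun QP phi <-> smooth_fun QP (fun q => phi (bact g q h)).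
  have sh a c psi : smooth_fun QP psi -> smooth_fun QP (fun q => psi (bact a q c)).
    move=> sp; apply/(smooth_bundleP hG hH) => n U p [p1 p2].
    have sp' := smooth_pull sp; have oU := plot_open dG p1.
    have -> : (fun x => psi (bact a (bpt (p x).1 (p x).2) c)) =
        (fun x => psi (bpt (a * (p x).1)%g ((p x).2 * c)%g)).
      by apply/funext => x; rewrite (bact_bpt hG hf).
    apply: (sp' _ _ (fun x => ((a * (p x).1)%g, ((p x).2 * c)%g))); split.
      by apply: (plot_mul mulG) => //; exact: (plot_cst dG).
    by apply: (plot_mul mulH) => //; exact: (plot_cst dH).
  split; first exact: sh.
  move=> /(sh g^-1%g h^-1%g); congr (smooth_fun _ _); apply/funext => q.
  rewrite -(brepK q); move: (brep q).1 (brep q).2 => x y.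
  by rewrite !(bact_bpt hG hf) mulVKg mulgVK.
rewrite /mpush; have [sp|np] := pselect (smooth_fun QP phi).
  rewrite !pushE //; last exact/sE.
  by congr (_ _ + w.2 _); apply/funext => x; rewrite (bact_bpt hG hf) ?mul1g ?mulg1.
by rewrite !push0 //; move/sE.
Qed.

(** [dual_basis] for the tangent space at <1|1>. By invariance of the frame the coefficients [a]
    serve at all (g,h) at once, while the dual test functions are normalized at <1|1> only. *)
Lemma frame_exists : exists n (w : 'I_n -> model) (t : 'I_n -> Q -> R),
  [/\ forall j, TH (w j).2, forall j, smooth_fun QP (t j),
      forall i j, mpush 1%g 1%g (w i) (t j) = (i == j)%:R &
      forall v : model, TH v.2 -> exists a : 'I_n -> R, forall g h,
        mpush g h v = mpush g h (msum a w)].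
Proof.
have [FG HG] := G_span hG; have [FH HH] := H_span hH.
pose S (i : 'I_(\dim {:E} + (\dim {:V} + \dim {:V}))) := match fintype.split i with inl k => push 1%g 1%g (FG k) (fun=> 0)
  | inr k => push 1%g 1%g (fun=> 0) (FH k) end.
have [|v|n [B [t [CB Bt HB]]]] := dual_basis (C := tangent QP (bpt 1%g 1%g)) (F := S).
- move=> a v v' /(tangent_push_p hG hH hf)[u [beta [tb ->]]].
  move=> /(tangent_push_p hG hH hf)[u' [beta' [tb' ->]]].
  have := mpush_tangent 1%g 1%g (mlin_tan a (w := (u, beta)) (w' := (u', beta')) tb tb').
  by rewrite mpush_lin.
- move=> /(tangent_push_p hG hH hf)[u [beta [tb ->]]].
  have [r1 H1] := HG _ (tau_pP hG u).1; have [r2 H2] := HH _ tb.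
  exists (fun i => match fintype.split i with inl k => r1 k | inr k => r2 k end) => phi.
  rewrite big_split_ord /=; have [sp|np] := pselect (smooth_fun QP phi); last first.
    rewrite push0 // !big1 ?addr0 // => k _.
      by rewrite /S (unsplitK (inr k)) push0 // mulr0.
    by rewrite /S (unsplitK (inl k)) push0 // mulr0.
  rewrite pushE // H1 H2; congr (_ + _); apply: eq_bigr => k _.
    by rewrite /S !(unsplitK (inl k)) pushE // addr0.
  by rewrite /S !(unsplitK (inr k)) pushE // add0r.
have /choice[w Hw] : forall j, exists w : model, TH w.2 /\ B j = mpush 1%g 1%g w.
  by move=> j; have [u [beta [tb ->]]] := tangent_push_p hG hH hf (CB j); exists (u, beta).
exists n, w, t; split.
- by move=> j; have [] := Hw j.
- move=> j; apply: contrapT => nt; have := Bt j j; have [_ ->] := Hw j.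
  by rewrite /mpush push0 // eqxx => /eqP; rewrite eq_sym oner_eq0.
- by move=> i j; rewrite -Bt; have [_ ->] := Hw i.
move=> v tv; exists (fun j => mpush 1%g 1%g v (t j)) => g h; apply/funext => phi.
rewrite mpush_shift (HB _ (mpush_tangent 1%g 1%g tv)) mpush_sum.
by apply: eq_bigr => j _; have [_ ->] := Hw j; rewrite -mpush_shift.
Qed.

(* By Cramer's rule the coefficients [a] become smooth after multiplication by
   the determinant [d] of the frame against its dual test functions. *)
Lemma field_coefficients eta g h : vector_field QP eta ->
  exists n (w : 'I_n -> model) (a : G * H -> 'I_n -> R) (d : G * H -> R) (u : 'I_n -> G * H -> R),
  [/\ forall j, TH (w j).2, smooth_fun GH d, forall j, smooth_fun GH (u j),
      d (g, h) = 1 & (forall x j, u j x = d x * a x j) /\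
      forall x, eta (bpt x.1 x.2) = mpush x.1 x.2 (msum (a x) w)].
Proof.
move=> [teta seta]; have [n [w [t [tw st wt span]]]] := frame_exists.
have /choice[a Ha] : forall x : G * H, exists a : 'I_n -> R,
    eta (bpt x.1 x.2) = mpush x.1 x.2 (msum a w).
  move=> x; have [u [beta [tb ->]]] := tangent_push_p hG hH hf (teta (bpt x.1 x.2)).
  by have [a Ha] := span (u, beta) tb; exists a; rewrite -Ha.
(* The dual functions are translated so that the matrix [M] is the identity at (g,h); this is the
   source of d(g,h) = 1. *)
pose s k q := t k (bact g^-1%g q h^-1%g).
have sE k q : s k (bact g q h) = t k q.
  rewrite /s -(brepK q); move: (brep q).1 (brep q).2 => x y.
  by rewrite !(bact_bpt hG hf) mulKg mulgK.
have ss k : smooth_fun QP (s k).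
  apply: contrapT => ns; have := wt k k; rewrite eqxx.
  have -> : t k = (fun q => s k (bact g q h)) by apply/funext => q.
  by rewrite -mpush_shift /mpush push0 // => /eqP; rewrite eq_sym oner_eq0.
pose M x := \matrix_(j, k) mpush x.1 x.2 (w j) (s k).
pose e k x := eta (bpt x.1 x.2) (s k).
have se k : smooth_fun GH (e k) by exact: (smooth_pull (seta _ (ss k))).
have sM j k : smooth_fun GH (fun x => M x j k).
  have -> : (fun x => M x j k) = (fun x => mpush x.1 x.2 (w j) (s k)).
    by apply/funext => x; rewrite mxE.
  exact: mpush_smooth.
have sdet m (N : G * H -> 'M[R]_m) : (forall i j, smooth_fun GH (fun x => N x i j)) ->
    smooth_fun GH (fun x => \det (N x)).
  apply: (alg_det (P := smooth_fun GH)).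
  - by move=> c; exact: smooth_cst.
  - by move=> F F' sF sF'; exact: (smooth_add dGH).
  - by move=> F F' sF sF'; exact: (smooth_mul dGH).
exists n, w, a, (fun x => \det (M x)), (fun i x => \sum_k e k x * \adj (M x) k i).
split=> //; first exact: sdet.
- move=> i; apply: (smooth_sum dGH) => k; apply: (smooth_mul dGH) => //.
  have -> : (fun x => \adj (M x) k i) =
      (fun x => (-1) ^+ (i + k) * \det (row' i (col' k (M x)))).
    by apply/funext => x; rewrite mxE.
  apply: (smooth_mul dGH); first exact: smooth_cst.
  apply: sdet => j l; have := sM (lift i j) (lift k l); congr (smooth_fun _ _).
  by apply/funext => x; rewrite [in RHS]mxE [in RHS]mxE.
- rewrite (_ : M (g, h) = 1%:M) ?det1 //; apply/matrixP => j k; rewrite !mxE /=.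
  by rewrite mpush_shift (_ : (fun q => _) = t k) ?wt //; apply/funext => q; exact: sE.
split=> // x i; have E1 : \row_k e k x = (\row_j a x j) *m M x.
  apply/rowP => k; rewrite !mxE /e Ha mpush_sum; apply: eq_bigr => j _.
  by rewrite !mxE.
have : (\row_k e k x) *m \adj (M x) = \det (M x) *: \row_j a x j.
  by rewrite E1 -mulmxA mul_mx_adj mul_mx_scalar.
move/rowP/(_ i); rewrite [LHS]mxE [RHS]mxE [in RHS]mxE => <-; apply: eq_bigr => k _.
by congr (_ * _); rewrite mxE.
Qed.

End ModelFields.

(** * The Nijenhuis tensor *)

Section Nijenhuis.
Variables (R : realType) (Z : vectType R[i]) (T : hermitian_jordan_triple Z).
Variables (eps : int) (E : vectType R) (G : groupType) (AG : set (chart E G)).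
Variables (act : G -> Mpt T eps -> Mpt T eps) (incK : 'End(Z) -> G).
Hypothesis hG : is_Geps AG act incK.
Variables (V : vectType R[i]) (H : groupType) (AH : set (chart V H)).
Hypothesis hH : is_complex_lie_group AH.
Variable f : 'End(Z) -> H.
Hypothesis hf : K_homomorphism T AH f.
Local Notation GP := (Gplots AG).
Local Notation HP := (Hplots AH).
Local Notation GH := (prod_plots GP HP).
Local Notation Q := (bundle T incK f).
Local Notation QP := (@bplots R Z T E G AG incK V H AH f).
Local Notation MP := (@Mplots R Z T eps).
Local Notation bpt := (bpt T incK f).
Local Notation dG := (G_diffeology hG).
Local Notation dH := (H_diffeology hH).
Local Notation dGH := (dGH hG hH).
Local Notation mulG := (G_mul hG).
Local Notation mulH := (H_mul hH).
Local Notation push := (@push R Z T E G AG incK V H AH f).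
Local Notation TG := (tangent GP 1%g).
Local Notation TH := (tangent HP 1%g).
Local Notation tau_p := (tau_p AG act).
Local Notation "'model'" := (Z * ((H -> R) -> R))%type.
Local Notation mpush := (@mpush R Z T eps E G AG act incK V H AH f).
Local Notation mtan := (@mtan R Z T eps E G AG act V H AH).
Variable J0 : Q -> ((Q -> R) -> R) -> ((Q -> R) -> R).
Hypothesis hJ0 : tautological_complexion AG act AH J0.
Variable b : Z -> (H -> R) -> R.
Hypothesis hb : antilinear_map AH b.
Variable J : Q -> ((Q -> R) -> R) -> ((Q -> R) -> R).
Hypothesis hJ : generated_complexion AG act AH J0 b J.
Local Notation vI := (vertI AH).
Local Notation lieG s t := (lie_bracket GP s t).
Local Notation lieH s t := (lie_bracket HP s t).

(* [J] in the frame. *)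
Definition mJ (w : model) : model := ('i%C *: w.1, fun phi => b w.1 phi + vI w.2 phi).

Lemma TH_add s t : TH s -> TH t -> TH (fun phi => s phi + t phi).
Proof.
move=> ts tt; have := T1_lin dH mulH 1 ts tt; congr (tangent _ _ _).
by apply/funext => phi; rewrite mul1r.
Qed.

Lemma TH_opp s : TH s -> TH (fun phi => - s phi).
Proof.
move=> ts; have := T1_lin dH mulH (-1) ts (TH0 hH); congr (tangent _ _ _).
by apply/funext => phi; rewrite mulN1r addr0.
Qed.

Lemma vI_tan s : TH s -> TH (vI s). Proof. by move=> /(vertIP hH)[]. Qed.

Lemma mJ_tan w : TH w.2 -> TH (mJ w).2.
Proof. by move=> tw; apply: TH_add; [exact: (b_tan hb)|exact: vI_tan]. Qed.

Lemma mpush_J g h w : TH w.2 -> J (bpt g h) (mpush g h w) = mpush g h (mJ w).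
Proof. by move=> tw; exact: (J_push_p hG hH hf hJ0 hb hJ). Qed.

Lemma vI_lin a s t : TH s -> TH t ->
  vI (fun phi => a * s phi + t phi) = (fun phi => a * vI s phi + vI t phi).
Proof. exact: (vertI_lin hG hH hf hJ0). Qed.

Lemma vI_add s t : TH s -> TH t ->
  vI (fun phi => s phi + t phi) = (fun phi => vI s phi + vI t phi).
Proof.
move=> ts tt; have := vI_lin 1 ts tt.
rewrite (_ : (fun phi => 1 * s phi + t phi) = (fun phi => s phi + t phi)) => [->|];
  by apply/funext => phi; rewrite mul1r.
Qed.

Lemma vI0 : vI (fun=> 0) = (fun=> 0).
Proof.
have := vI_add (TH0 hH) (TH0 hH).
rewrite (_ : (fun phi => (fun=> 0) phi + (fun=> 0) phi) = (fun _ : H -> R => 0 : R)); last first.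
  by apply/funext => phi; rewrite addr0.
move=> /(congr1 (fun F => F _)) E0; apply/funext => phi; have := E0 phi.
by move/eqP; rewrite -subr_eq subrr => /eqP.
Qed.

Lemma vI_opp s : TH s -> vI (fun phi => - s phi) = (fun phi => - vI s phi).
Proof.
move=> ts; have := vI_lin (-1) ts (TH0 hH); rewrite vI0.
rewrite (_ : (fun phi => -1 * s phi + (fun=> 0) phi) = (fun phi => - s phi)) => [->|];
  by apply/funext => phi; rewrite mulN1r addr0.
Qed.

Lemma b0 : b 0 = (fun=> 0).
Proof.
have := b_lin hb 1 0 0; rewrite scaler0 addr0 => /(congr1 (fun F => F _)) E0.
by apply/funext => phi; have := E0 phi; rewrite mul1r => /eqP; rewrite -subr_eq subrr => /eqP.
Qed.

Lemma mJ_lin a w w' : TH w.2 -> TH w'.2 -> mJ (mlin a w w') = mlin a (mJ w) (mJ w').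
Proof.
move=> tw tw'; rewrite /mJ /mlin /= (b_lin hb) vI_lin //; congr pair.
  by rewrite scalerDr !scalerA mulrC.
by apply/funext => phi; ring.
Qed.

Lemma mJ0 : mJ (mzero Z H) = mzero Z H.
Proof.
rewrite /mJ /mzero /= b0 vI0 scaler0; congr pair.
by apply/funext => phi; rewrite addr0.
Qed.

Lemma mJ_sum n (c : 'I_n -> R) w : (forall j, TH (w j).2) ->
  mJ (msum c w) = msum c (fun j => mJ (w j)).
Proof.
move=> tw; rewrite /msum; elim: (index_enum _) => [|j l IH] /=; first exact: mJ0.
rewrite mJ_lin ?IH //; elim: l {IH} => [|k l IH]; first exact: (TH0 hH).
exact: mlin_tan.
Qed.

(** The second component is b(i v) + i(b v + i beta), and antilinearity of b cancels its first two
    terms. *)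
Lemma mpush_JJ g h w : TH w.2 -> mpush g h (mJ (mJ w)) = - mpush g h w.
Proof.
move=> tw; have -> : mJ (mJ w) = mlin (-1) w (mzero Z H).
  rewrite /mJ /mlin /=; congr pair.
    by rewrite addr0 rmorphN1 scalerA -expr2 sqr_i.
  apply/funext => phi; rewrite vI_add ?(vertI_b hG hH hf hJ0 hb) ?(vertIK hG hH hf hJ0) //;
    [by ring|exact: (b_tan hb)|exact: vI_tan].
by rewrite (mpush_lin hG) (mpush0 hG) scaleN1r; apply/funext => phi; rewrite addr0.
Qed.

Section OneField.
Variable eta : Q -> (Q -> R) -> R.
Hypothesis veta : vector_field QP eta.

(** In the frame [J] has constant coefficients, so it acts on the numerators [u] of the coefficients
    of [eta], which are smooth. *)
Lemma J_vector_field : vector_field QP (fun q => J q (eta q)).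
Proof.
have [teta seta] := veta; split.
  move=> q; rewrite -(brepK q); move: (brep q).1 (brep q).2 => g h.
  have [u [beta [tb E0]]] := tangent_push_p hG hH hf (teta (bpt g h)).
  rewrite E0 -[push _ _ _ _]/(mpush g h (u, beta)) mpush_J //.
  exact/(mpush_tangent hG hH)/mJ_tan.
move=> phi sp; apply/(smooth_bundleP hG hH) => n U p pp; apply: Cinf_local => y Uy.
have [m [w [a [d [u [tw sd su d1 [uE EE]]]]]]] :=
  field_coefficients hG hH hf (p y).1 (p y).2 veta.
have oU := plot_open dGH pp; have cd := sd _ _ _ pp.
(* [d] is 1 at the given point, so it may be divided by where it is positive. *)
pose W := [set x | U x /\ [set v : 'rV[R]_1 | 0 < v 0 0] (line1 (d (p x)))].
have oW : open W.
  apply: (@open_preim R n 1 U _ (fun x => line1 (d (p x))) oU).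
    have -> : [set v : 'rV[R]_1 | 0 < v 0 0] = (fun v : 'rV[R]_1 => v 0 0) @^-1` [set x | 0 < x] by [].
    by apply: open_comp; [move=> v _; exact: coord_continuous|exact: (@open_gt R)].
  move=> i; have -> : (fun x => line1 (d (p x)) 0 i) = (fun x => d (p x)) by apply/funext => x; rewrite mxE.
  exact: cd.
have WU : W `<=` U by move=> x [].
have dW x : W x -> 0 < d (p x) by move=> [_] /=; rewrite mxE.
exists W; first by split=> //=; rewrite mxE [p y]surjective_pairing d1.
pose F x := (d (p x))^-1 * \sum_j u j (p x) * mpush (p x).1 (p x).2 (mJ (w j)) phi.
apply: (Cinf_eq oW (f := F)); last first.
  apply: (Cinf_mul oW).
    apply: (Cinf_inv oW); last exact: (Cinf_sub cd).
    by move=> x /dW h; rewrite gt_eqF.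
  apply: (Cinf_sum _ oW) => j; apply: (Cinf_mul oW).
    exact: (Cinf_sub (su j _ _ _ pp)).
  exact: (Cinf_sub (mpush_smooth hG hH (mJ_tan (tw j)) sp pp)).
move=> x Wx; rewrite /F EE mpush_J; last exact: msum_tan.
rewrite mJ_sum // (mpush_sum hG) mulr_sumr; apply: eq_bigr => j _.
rewrite uE !mulrA mulVf ?mul1r // gt_eqF //; exact: dW.
Qed.

End OneField.

(* First-order jet of a vector field at [<g|h>], read in the frame of left
   translates on [G] and right translates on [H]: its value is [w], and [c]
   is the derivative of its coefficients. *)
Definition jet g h (xi : Q -> (Q -> R) -> R) (w : model) (c : model -> model) :=
  [/\ TH w.2, xi (bpt g h) = mpush g h w, forall w', TH w'.2 -> TH (c w').2 &
      forall w' phi, TH w'.2 -> smooth_fun QP phi ->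
        mtan g h w' (fun x => xi (bpt x.1 x.2) phi) =
        mpush g h (c w') phi + mtan g h w' (fun x => mpush x.1 x.2 w phi)].

(** Because [J] is constant in the frame, the same derivative of coefficients serves for both
    fields, followed by [mJ] for the second. *)
Lemma jet_exists g h eta : vector_field QP eta -> exists w c,
  jet g h eta w c /\ jet g h (fun q => J q (eta q)) (mJ w) (fun w' => mJ (c w')).
Proof.
move=> veta; have [n [w [a [d [u [tw sd su d1 [uE EE]]]]]]] :=
  field_coefficients hG hH hf g h veta.
(* The derivative of a_j = u_j / d at a point where d = 1. *)
pose c w' := msum (fun j => mtan g h w' (u j) - a (g, h) j * mtan g h w' d) w.
have key (v : 'I_n -> model) (xi : Q -> (Q -> R) -> R) w' phi : (forall j, TH (v j).2) ->
    vector_field QP xi -> (forall x, xi (bpt x.1 x.2) = mpush x.1 x.2 (msum (a x) v)) ->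
    TH w'.2 -> smooth_fun QP phi ->
    mtan g h w' (fun x => xi (bpt x.1 x.2) phi) =
    mpush g h (msum (fun j => mtan g h w' (u j) - a (g, h) j * mtan g h w' d) v) phi +
    mtan g h w' (fun x => mpush x.1 x.2 (msum (a (g, h)) v) phi).
  move=> tv [_ sxi] xiE tw' sp; have tm := mtan_tangent hG hH g h tw'.
  have sU j := mpush_smooth hG hH (tv j) sp.
  have sF := smooth_pull hG hH (sxi _ sp).
  rewrite (tan_quotient dGH (U := fun j x => mpush x.1 x.2 (v j) phi) tm sd su sU sF d1 uE); last first.
    by move=> x; rewrite xiE (mpush_sum hG).
  rewrite -(mpush_sum hG) /=; congr (_ + _).
  have -> : (fun x => mpush x.1 x.2 (msum (a (g, h)) v) phi) =
      (fun x => \sum_j a (g, h) j * mpush x.1 x.2 (v j) phi).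
    by apply/funext => x; rewrite (mpush_sum hG).
  rewrite (tan_bigsum dGH _ tm); last first.
    by move=> j; apply: (smooth_mul dGH) => //; exact: smooth_cst.
  by apply: eq_bigr => j _; rewrite (tan_scale dGH _ tm).
exists (msum (a (g, h)) w), c; split; split.
- exact: msum_tan.
- exact: (EE (g, h)).
- by move=> w' _; exact: msum_tan.
- by move=> w' phi tw' sp; exact: key.
- exact/mJ_tan/msum_tan.
- by rewrite (EE (g, h)) mpush_J //; exact: msum_tan.
- by move=> w' tw'; exact/mJ_tan/msum_tan.
- move=> w' phi tw' sp; rewrite mJ_sum // /c mJ_sum //.
  apply: (key _ (fun q => J q (eta q))) => //.
  + by move=> j; exact: mJ_tan.
  + exact: J_vector_field.
  + by move=> x; rewrite EE mpush_J ?mJ_sum //; exact: msum_tan.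
Qed.

(** The bracket of two fields with constant coefficients on [G * H]: left invariant on [G], right
    invariant on [H], whence the sign of the second entry. *)
Definition mbracket g h (w w' : model) : (Q -> R) -> R :=
  push g h (lieG (tau_p w.1) (tau_p w'.1)) (fun psi => - lieH w.2 w'.2 psi).

(** Each iterated derivative splits into four terms by factor. The mixed ones commute by [tan_swap];
    the pure ones give the bracket of [G] and, by [lie_right], minus that of [H]. *)
Lemma mtan_swap g h w w' phi : TH w.2 -> TH w'.2 -> smooth_fun QP phi ->
  mtan g h w (fun x => mpush x.1 x.2 w' phi) - mtan g h w' (fun x => mpush x.1 x.2 w phi) =
  mbracket g h w w' phi.
Proof.
move=> tw tw' sp; have [t1 _] := tau_pP hG w.1; have [t2 _] := tau_pP hG w'.1.
have sF := smooth2_shift hG hH g h sp.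
pose F x y := phi (bpt (g * x)%g (y * h)%g); rewrite -/F in sF.
have expand v v' : TH v.2 -> TH v'.2 -> mtan g h v (fun x => mpush x.1 x.2 v' phi) =
    tau_p v.1 (fun x => tau_p v'.1 (fun x' => F (x * x')%g 1%g)) +
    tau_p v.1 (fun x => v'.2 (F x)) +
    (v.2 (fun y => tau_p v'.1 (fun x' => F x' y)) +
     v.2 (fun y => v'.2 (fun y' => F 1%g (y' * y)%g))).
  move=> tv tv'; have [s1 _] := tau_pP hG v.1; have [s2 _] := tau_pP hG v'.1.
  rewrite mtanE; last exact: mpush_smooth.
  have sF1 := smooth2_left dG dH 1%g sF; have sF2 := smooth2_right dG dH 1%g sF.
  have sw := smooth2_swap sF.
  rewrite -(tan_add dG s1) -?(tan_add dH tv).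
  - congr (_ _ + v.2 _); apply/funext => x; rewrite /mpush pushE //=;
      by congr (_ + _); congr (_ _); apply/funext => y; rewrite /F ?mul1g ?mulg1 ?mulgA.
  - exact: (tan_param dH dG s2 sw).
  - apply: (tan_param dH dH tv' (F := fun y y' => F 1%g (y' * y)%g)).
    exact/smooth2_swap/(smooth2_mul mulH sF2).
  - apply: (tan_param dG dG s2 (F := fun x x' => F (x * x')%g 1%g)).
    exact: (smooth2_mul mulG sF1).
  - exact: (tan_param dG dH tv' sF).
rewrite (expand w w') // (expand w' w) //.
rewrite (tan_swap dG dH t1 tw' sF) (tan_swap dG dH t2 tw sF).
rewrite /mbracket pushE //.
have sF1 : smooth_fun GP (fun x => F x 1%g) by exact: (smooth2_left dG dH 1%g sF).
have sF2 : smooth_fun HP (F 1%g) by exact: (smooth2_right dG dH 1%g sF).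
have -> : (fun x => phi (bpt (g * x)%g h)) = (fun x => F x 1%g).
  by apply/funext => x; rewrite /F mul1g.
have -> : (fun y => phi (bpt g (y * h)%g)) = F 1%g.
  by apply/funext => y; rewrite /F mulg1.
rewrite (lie_bracketE dG mulG t1 t2 sF1) -(lie_right dH mulH tw tw' sF2).
by ring.
Qed.

Lemma bracket_jet g h xi eta w c w' c' : vector_field QP xi -> vector_field QP eta ->
  jet g h xi w c -> jet g h eta w' c' ->
  field_bracket QP xi eta (bpt g h) =
  (mpush g h (c' w) - mpush g h (c w') + mbracket g h w w').
Proof.
move=> [_ sxi] [_ seta] [tw xiE tc Hc] [tw' etaE tc' Hc'].
apply/funext => phi; rewrite -[RHS]/(mpush g h (c' w) phi - mpush g h (c w') phi + mbracket g h w w' phi).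
rewrite /field_bracket; case: asboolP => [sp|np]; last first.
  by rewrite /mpush /mbracket !push0 // subrr addr0.
rewrite xiE etaE !(mpush_mtan hG hH _ _ _ (seta _ sp)) !(mpush_mtan hG hH _ _ _ (sxi _ sp)).
by rewrite Hc // Hc' // -mtan_swap //; ring.
Qed.

Lemma lieG_tan u v : TG (lieG (tau_p u) (tau_p v)).
Proof.
have [F HF] := G_span hG.
exact: (T1_lie dG mulG (G_inv hG) HF (tau_pP hG u).1 (tau_pP hG v).1).
Qed.

Lemma lieH_tan s t : TH s -> TH t -> TH (lieH s t).
Proof. by move=> ts tt; have [F HF] := H_span hH; exact: (T1_lie dH mulH (H_inv hH) HF). Qed.

(** By [lie_generates] the bracket is sesquilinear in each of its two terms, so the factors i and
    its conjugate multiply to 1. *)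
Lemma lieG_ii u v : lieG (tau_p ('i%C *: u)) (tau_p ('i%C *: v)) = lieG (tau_p u) (tau_p v).
Proof.
apply: (generates_inj hG (lieG_tan _ _) (lieG_tan _ _) (lie_generates hG _ _)).
have := lie_generates hG u v; congr (generates act _); apply/funext => z.
have ii : Num.conj ('i%C : R[i]) * 'i%C = 1.
  by apply/eqP; rewrite eq_complex /= !(mul0r, mulr0, mulr1, mulN1r, opprK, addr0, sub0r, subr0, oppr0, add0r) !eqxx.
by rewrite !(tpZl, tpZm) !scalerA mulrC ii !scale1r.
Qed.

(** One factor i enters {v u z} and {u v z} once linearly and once through its conjugate, so the two
    generated fields are opposite. *)
Lemma lieG_i u v phi : lieG (tau_p ('i%C *: u)) (tau_p v) phi +
  lieG (tau_p u) (tau_p ('i%C *: v)) phi = 0.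
Proof.
have t1 := lieG_tan ('i%C *: u) v; have t2 := lieG_tan u ('i%C *: v).
have t3 := T1_lin dG mulG 1 t1 t2.
have g3 := generates_lin 1 (lie_generates hG ('i%C *: u) v) (lie_generates hG u ('i%C *: v)).
have g0 := generates_lin 0 (lie_generates hG u v) (lie_generates hG u v).
have : generates act (fun=> 0) (fun _ : Z => 0).
  have [_] := tau_pP hG 0; rewrite (tau_p0 hG); congr (generates act _).
  by apply/funext => z; rewrite /p_field tp0m scaler0 addr0.
move=> gz; have tz := TG0 hG.
have : generates act (fun phi => 1 * lieG (tau_p ('i%C *: u)) (tau_p v) phi +
    lieG (tau_p u) (tau_p ('i%C *: v)) phi) (fun _ : Z => 0).
  move: g3; congr (generates act _); apply/funext => z.
  have ci : Num.conj ('i%C : R[i]) = - 'i%C by apply/eqP; rewrite eq_complex /= oppr0 !eqxx.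
  rewrite scale1r !(tpZl, tpZm) ci -mulrnDl -scalerDr.
  rewrite (_ : _ - _ + _ = 0) ?scaler0 ?mul0rn // !scaleNr.
  by apply: additive_sep => l lD lN; rewrite !(lD, lN); have := lD 0 0; rewrite addr0; lra.
move/(generates_inj hG t3 tz)/(_ gz)/(congr1 (fun F => F phi)).
by rewrite mul1r.
Qed.

Lemma lieH_vI s t : TH s -> TH t -> lieH s (vI t) = vI (lieH s t).
Proof. exact: (lie_vertI hG hH hf hJ0). Qed.

Lemma lieH_JJ s t phi : TH s -> TH t -> lieH (vI s) (vI t) phi = - lieH s t phi.
Proof.
move=> ts tt; have ts' := vI_tan ts.
rewrite lieH_vI //.
have -> : lieH (vI s) t = (fun psi => - vI (lieH t s) psi).
  by apply/funext => psi; rewrite (lie_antisym dH mulH psi ts' tt) lieH_vI.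
have tl := lieH_tan tt ts.
rewrite vI_opp; last exact: vI_tan.
by rewrite (vertIK hG hH hf hJ0 tl) opprK (lie_antisym dH mulH phi ts tt) opprK.
Qed.

Lemma mbracket_tangent g h w w' : TH w.2 -> TH w'.2 -> tangent QP (bpt g h) (mbracket g h w w').
Proof.
move=> tw tw'; apply: (push_tangent hG hH f g h); first exact: lieG_tan.
exact/TH_opp/lieH_tan.
Qed.

Lemma Q_tan_add g h X Y : tangent QP (bpt g h) X -> tangent QP (bpt g h) Y ->
  tangent QP (bpt g h) (X + Y).
Proof.
move=> /(tangent_push_p hG hH hf)[u [beta [tb ->]]] /(tangent_push_p hG hH hf)[v [gamma [tc ->]]].
have := mpush_tangent hG hH f g h (mlin_tan hH 1 (w := (u, beta)) (w' := (v, gamma)) tb tc).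
by rewrite (mpush_lin hG) scale1r.
Qed.

Lemma mpush_sub_tangent g h w w' : TH w.2 -> TH w'.2 ->
  tangent QP (bpt g h) (mpush g h w - mpush g h w').
Proof.
move=> tw tw'; have := mpush_tangent hG hH f g h (mlin_tan hH (-1) tw' tw).
by rewrite (mpush_lin hG) scaleN1r addrC.
Qed.

(** Write c, c' for the derivatives of coefficients. The terms in c and c' of [J xi, J eta] and
    [xi, eta] reappear in J([J xi, eta] + [xi, J eta]) because J^2 = -1, and cancel. There remain
    the brackets of constant pairs: their [G]-parts vanish by [lieG_ii] and [lieG_i], and with P = b
    u + i beta, P' = b v + i gamma the [H]-part is -[P,P'] + [beta,gamma] + [P,i gamma] +
    [i beta,P'] = -[b u, b v]. *)
Lemma nijenhuis_jet g h xi eta w c w' c' :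
  vector_field QP xi -> vector_field QP eta ->
  jet g h xi w c -> jet g h eta w' c' ->
  jet g h (fun q => J q (xi q)) (mJ w) (fun v => mJ (c v)) ->
  jet g h (fun q => J q (eta q)) (mJ w') (fun v => mJ (c' v)) ->
  nijenhuis QP J xi eta (bpt g h) =
  push g h (fun=> 0) (fun psi => - lieH (b w.1) (b w'.1) psi).
Proof.
move=> vxi veta jx je jJx jJe; have vJx := J_vector_field vxi; have vJe := J_vector_field veta.
have [tw _ tc _] := jx; have [tw' _ tc' _] := je.
have tJw := mJ_tan tw; have tJw' := mJ_tan tw'.
rewrite /nijenhuis (bracket_jet vJx vJe jJx jJe) (bracket_jet vxi veta jx je).
have E1 := bracket_jet vJx veta jJx je; have E2 := bracket_jet vxi vJe jx jJe.
set X1 := field_bracket QP (fun q => J q (xi q)) eta (bpt g h) in E1 *.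
set X2 := field_bracket QP xi (fun q => J q (eta q)) (bpt g h) in E2 *.
have tX1 : tangent QP (bpt g h) X1.
  rewrite E1; apply: Q_tan_add; last exact: mbracket_tangent.
  by apply: mpush_sub_tangent; [exact: tc'|apply: mJ_tan; exact: tc].
have tX2 : tangent QP (bpt g h) X2.
  rewrite E2; apply: Q_tan_add; last exact: mbracket_tangent.
  by apply: mpush_sub_tangent; [apply: mJ_tan; exact: tc'|exact: tc].
rewrite -[_ - J _ X1 - J _ X2]addrA -opprD -(J_add hG hH hf hJ0 hb hJ tX1 tX2).
(* The [G]-parts of the two mixed brackets add up to 0, so their sum is vertical with this component
   and [mJ] applies to it. *)
pose beta0 psi := - lieH (mJ w).2 w'.2 psi + - lieH w.2 (mJ w').2 psi.
have tb0 : TH beta0 by apply: TH_add; apply: TH_opp; exact: lieH_tan.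
have EB : mbracket g h (mJ w) w' + mbracket g h w (mJ w') = mpush g h (0, beta0).
  rewrite /mbracket -push_add /mpush (tau_p0 hG); congr (push g h _ _).
  by apply/funext => phi; exact: lieG_i.
(* [J] is known on frame vectors, so the whole sum of the two brackets is assembled into a single
   pair. *)
pose W0 := mlin 1 (c' (mJ w)) (mlin (-1) (mJ (c w')) (mlin 1 (mJ (c' w))
  (mlin (-1) (c (mJ w')) (0, beta0)))).
have t1 := tc' _ tJw; have t2 := mJ_tan (tc _ tw'); have t3 := mJ_tan (tc' _ tw).
have t4 := tc _ tJw'.
have u4 : TH (mlin (-1) (c (mJ w')) (0, beta0)).2 by exact: mlin_tan.
have u3 := mlin_tan hH 1 t3 u4; have u2 := mlin_tan hH (-1) t2 u3.
have EX : X1 + X2 = mpush g h W0.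
  rewrite E1 E2 addrACA EB !(mpush_lin hG) !scale1r !scaleN1r.
  by apply/funext => phi; rewrite !fctE; ring.
rewrite EX mpush_J; last exact: mlin_tan.
rewrite !mJ_lin // !(mpush_lin hG) !mpush_JJ //; [|exact: tc'|exact: tc].
rewrite !scale1r !scaleN1r.
(* What is left after the derivatives of coefficients cancel: brackets of constant pairs only. *)
have EL : mbracket g h (mJ w) (mJ w') - mbracket g h w w' - mpush g h (mJ (0, beta0)) =
    push g h (fun=> 0) (fun psi => - lieH (b w.1) (b w'.1) psi).
  apply/funext => phi; rewrite -[LHS]/(mbracket g h (mJ w) (mJ w') phi - mbracket g h w w' phi - mpush g h (mJ (0, beta0)) phi).
  rewrite /mbracket /mpush; have [sp|np] := pselect (smooth_fun QP phi); last first.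
    by rewrite !push0 // !subr0.
  rewrite !pushE // lieG_ii /= scaler0 (tau_p0 hG) b0.
  set X := lieG _ _ _; set psi := fun y : H => phi (bpt g (y * h)%g).
  have tb u := b_tan hb u; have vw := vI_tan tw; have vw' := vI_tan tw'.
  have tbw : TH (fun phi => b w.1 phi + vI w.2 phi) by exact: TH_add.
  have tbw' : TH (fun phi => b w'.1 phi + vI w'.2 phi) by exact: TH_add.
  have -> : vI beta0 psi = - lieH (mJ w).2 (vI w'.2) psi - lieH (vI w.2) (mJ w').2 psi.
    rewrite /beta0 vI_add; [|by apply: TH_opp; exact: lieH_tan ..].
    rewrite !vI_opp; [|exact: lieH_tan ..].
    rewrite -lieH_vI //; congr (_ - _).
    rewrite (lie_antisym dH mulH psi vw tJw') lieH_vI //.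
    have -> : lieH w.2 (mJ w').2 = (fun psi => - lieH (mJ w').2 w.2 psi).
      by apply/funext => y; exact: (lie_antisym dH mulH).
    by rewrite vI_opp //; exact: lieH_tan.
  have JJ := lieH_JJ psi tw tw'.
  rewrite /= !(lie_addl dH mulH, lie_addr dH mulH) //= JJ.
  by ring.
rewrite -EL; apply/funext => phi; rewrite !fctE; ring.
Qed.

(** These fields are defined on all of [Q], unlike frame vectors, which depend on the
    representative; they supply the global fields on which integrability is tested. *)
Lemma fundamental_field u : vector_field QP
  (fun q => differential QP (fun x => bact x q 1%g) (tau_p u)).
Proof.
have [tu _] := tau_pP hG u.
have E0 g h phi : smooth_fun QP phi ->
    differential QP (fun x => bact x (bpt g h) 1%g) (tau_p u) phi =
    tau_p u (fun x => phi (bpt (x * g)%g h)).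
  move=> sp; rewrite /differential; case: asboolP => // _; congr (tau_p u _).
  by apply/funext => x; rewrite (bact_bpt hG hf) mulg1.
split=> [q|phi sp]; last first.
  apply/(smooth_bundleP hG hH).
  rewrite (_ : (fun g h => _) = (fun g h => tau_p u (fun x => phi (bpt (x * g)%g h)))); last first.
    by apply/funext => g; apply/funext => h; exact: E0.
  apply: (tan_param dGH dG tu (F := fun z x => phi (bpt (x * z.1)%g z.2))) => n U p [[p1 p2] p3].
  have sp' := smooth_pull hG hH sp.
  apply: (sp' _ _ (fun x => ((p x).2 * (p x).1.1, (p x).1.2)%g)); split=> //.
  exact: (plot_mul mulG).
rewrite -(brepK q); move: (brep q).1 (brep q).2 => g h.
(* x g = g (g^-1 x g): multiplication on the left of g appears in the frame through Ad(g^-1). *)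
have -> : differential QP (fun x => bact x (bpt g h) 1%g) (tau_p u) =
    push g h (Ad GP g^-1%g (tau_p u)) (fun=> 0).
  apply/funext => phi; have [sp|np] := pselect (smooth_fun QP phi); last first.
    by rewrite push0 // /differential; case: asboolP.
  rewrite E0 // pushE // addr0 AdE; last first.
    have := smooth2_left dG dH 1%g (smooth2_shift hG hH g h sp).
    by congr (smooth_fun _ _); apply/funext => x; rewrite !mul1g.
  by congr (tau_p u _); apply/funext => x; rewrite invgK !mulgA mulgV mul1g.
apply: (push_tangent hG hH f g h); last exact: (TH0 hH).
exact: (T1_Ad dG mulG).
Qed.

(** The tensor depends on the Z-components only, and these are determined by projecting the field at
    <1|1> to M. *)
Lemma fundamental_jet u w c :
  jet 1%g 1%g (fun q => differential QP (fun x => bact x q 1%g) (tau_p u)) w c -> w.1 = u.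
Proof.
move=> [tw E0 _ _]; have [t1 g1] := tau_pP hG u; have [t2 g2] := tau_pP hG w.1.
have E1 : mpush 1%g 1%g w = push 1%g 1%g (tau_p u) (fun=> 0).
  rewrite -E0; apply/funext => phi; have [sp|np] := pselect (smooth_fun QP phi); last first.
    by rewrite push0 // /differential; case: asboolP.
  rewrite pushE // addr0 /differential; case: asboolP => // _; congr (tau_p u _).
  by apply/funext => x; rewrite (bact_bpt hG hf) !mulg1 mul1g.
have := congr1 (differential MP (@bproj R Z T eps G act incK H f)) E1.
rewrite /mpush (dproj_push hG hH hf _ _ t2 tw g2) (dproj_push hG hH hf _ _ t1 (TH0 hH) g1).
have pf0 v : p_field T eps v 0 = v by rewrite /p_field tp0r scaler0 addr0.
rewrite !pf0; have d1 v : differential MP (act 1%g) (@Zvec R Z T eps 0 v) = @Zvec R Z T eps 0 v.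
  apply/funext => psi; rewrite /differential; case: asboolP => [sp|np]; last by rewrite Zvec0.
  by congr (Zvec 0 v _); apply/funext => x; rewrite (Geps_act1 hG).
by rewrite !d1 => /Zvec_inj.
Qed.

Lemma integrableP : integrable_acs QP J <-> (forall u v, lieH (b u) (b v) = 0).
Proof.
split=> [int u v|b_comm xi eta vxi veta q].
  have vu := fundamental_field u; have vv := fundamental_field v.
  have [w [c [jx jJx]]] := jet_exists 1%g 1%g vu.
  have [w' [c' [je jJe]]] := jet_exists 1%g 1%g vv.
  have := int _ _ vu vv (bpt 1%g 1%g); rewrite (nijenhuis_jet vu vv jx je jJx jJe).
  rewrite (fundamental_jet jx) (fundamental_jet je) => E0.
  have tl := TH_opp (lieH_tan (b_tan hb u) (b_tan hb v)).
  have E1 : push 1%g 1%g (fun=> 0) (fun psi => - lieH (b u) (b v) psi) =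
      push 1%g 1%g (fun=> 0) (fun=> 0).
    rewrite E0; apply/funext => phi; have [sp|np] := pselect (smooth_fun QP phi).
      by rewrite pushE // addr0.
    by rewrite push0.
  have := push_inj hG hH hf tl (TH0 hH) E1.
  move=> /(congr1 (fun F => F _)) E2; apply/funext => phi; have := E2 phi.
  by move/eqP; rewrite oppr_eq0 => /eqP.
rewrite -(brepK q); move: (brep q).1 (brep q).2 => g h.
have [w [c [jx jJx]]] := jet_exists g h vxi.
have [w' [c' [je jJe]]] := jet_exists g h veta.
rewrite (nijenhuis_jet vxi veta jx je jJx jJe) b_comm; apply/funext => phi.
have [sp|np] := pselect (smooth_fun QP phi); last by rewrite push0.
by rewrite pushE // add0r; exact: oppr0.
Qed.

End Nijenhuis.

Theorem theorem6p4 (R : realType) (Z : vectType R[i])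
    (T : hermitian_jordan_triple Z)
    (T_pos : positive_triple T) (T_irr : irreducible_triple T)
    (eps : int) (eps_val : eps \in [:: -1; 0; 1])
    (E : vectType R) (G : groupType) (AG : set (chart E G))
    (act : G -> Mpt T eps -> Mpt T eps) (incK : 'End(Z) -> G)
    (G_eps : is_Geps AG act incK)
    (V : vectType R[i]) (H : groupType) (AH : set (chart V H))
    (H_lie : is_complex_lie_group AH)
    (H_conn : Dconnected (Hplots AH) setT)
    (f : 'End(Z) -> H) (f_hom : K_homomorphism T AH f)
    (b : Z -> (H -> R) -> R) (b_anti : antilinear_map AH b)
    (b_cov : covariant act incK AH f b)
    (J0 : bundle T incK f -> ((bundle T incK f -> R) -> R) ->
          ((bundle T incK f -> R) -> R))
    (J0_taut : tautological_complexion AG act AH J0)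
    (J : bundle T incK f -> ((bundle T incK f -> R) -> R) ->
         ((bundle T incK f -> R) -> R))
    (J_gen : generated_complexion AG act AH J0 b J) :
  integrable_acs (bplots AG AH (f := f)) J <->
  (forall u v : Z, lie_bracket (Hplots AH) (b u) (b v) = 0).
Proof. exact: (integrableP G_eps H_lie f_hom J0_taut b_anti J_gen). Qed.
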